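(* Let $n\geq 2$, put $m=2n$, let $S$ be a basic spinor representation of $Spin(2n)$, and let $k\in\mathbb{N}_0$. Then the $\mathfrak{so}(2n)$-module $\mathcal{M}_k(\mathbb{R}^{2n},S)$ decomposes into inequivalent irreducible $\mathfrak{so}(2n-1)$-submodules as $$\mathcal{M}_k(\mathbb{R}^{2n},S)=\bigoplus_{j=0}^k X^{(j)}_{k-j}\,\mathcal{M}_{k-j}(\mathbb{R}^{2n-1},S),$$ where $X^{(j)}_{k-j}$ is the Clifford-valued polynomial on $\mathbb{R}^{m}$, $m=2n$, defined in the context, acting by left Clifford multiplication.
   Context: Clifford algebra: $\mathbb{C}_m$ is the complex Clifford algebra generated by the standard basis $e_1,\dots,e_m$ of $\mathbb{R}^m$ with $e_j^2=-1$ and $e_ie_j=-e_je_i$ for $i\ne j$; $x=(x_1,\dots,x_m)\in\mathbb{R}^m$ is identified with $\sum_j x_je_j$. $Spin(m)$ is the group of products of an even number of unit vectors of $\mathbb{R}^m$. Its Lie algebra is realized as $\mathfrak{so}(m)=\mathrm{span}\{e_{ij}:1\le i<j\le m\}$, $e_{ij}=e_ie_j$; for $l\le m$, $\mathfrak{so}(l)=\mathrm{span}\{e_{ij}:1\le i<j\le l\}\subset\mathfrak{so}(m)$. Spinors: a basic spinor representation $S$ of $Spin(m)$ for even $m=2n$ is one of the two inequivalent half-spin representations; it is realized as a subspace of the Clifford algebra invariant under left multiplication by $Spin(m)$. Spherical monogenics: the Dirac operator in $\mathbb{R}^m$ is $\partial=\sum_{j=1}^m e_j\frac{\partial}{\partial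 x_j}$. $\mathcal{P}_k(\mathbb{R}^m,S)$ is the space of $S$-valued $k$-homogeneous polynomials on $\mathbb{R}^m$ and $\mathcal{M}_k(\mathbb{R}^m,S)=\{P\in\mathcal{P}_k(\mathbb{R}^m,S):\partial P=0\}$. Similarly $\mathcal{M}_k(\mathbb{R}^{m-1},S)$ is defined with the Dirac operator $\underline{\partial}=\sum_{j=1}^{m-1}e_j\frac{\partial}{\partial x_j}$ in the variable $\underline{x}=(x_1,\dots,x_{m-1})$. $Spin(m)$ acts on $\mathcal{M}_k(\mathbb{R}^m,S)$ by $[L(s)P](x)=s\,P(s^{-1}xs)$, and $\mathfrak{so}(m)$ acts by the derivative of $L$. The polynomials $X^{(j)}_k$: write $\underline{x}=\sum_{i=1}^{m-1}x_ie_i$, $r=(x_1^2+\cdots+x_m^2)^{1/2}$, and let $C^{\nu}_j(z)=\sum_{i=0}^{[j/2]}\frac{(-1)^i(\nu)_{j-i}}{i!(j-2i)!}(2z)^{j-2i}$ with $(\nu)_j=\nu(\nu+1)\cdots(\nu+j-1)$ be the Gegenbauer polynomial. Put $X^{(0)}_k=1$ and, for $j\ge1$, $$X^{(j)}_k(\underline{x},x_m)=\mu^j_kr^j\left(C_j^{m/2+k-1}\!\left(\tfrac{x_m}{r}\right)+\frac{m+2k-2}{m+2k+j-2}\,C_{j-1}^{m/2+k}\!\left(\tfrac{x_m}{r}\right)\frac{\underline{x}e_m}{r}\right),$$ where $\mu^{2l}_k=(-1)^l\big(C_{2l}^{m/2+k-1}(0)\big)^{-1}$ and $\mu^{2l+1}_k=(-1)^l\frac{m+2k+2l-1}{m+2k-2}\big(C_{2l}^{m/2+k}(0)\big)^{-1}$.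 The set $X^{(j)}_{k-j}\mathcal{M}_{k-j}(\mathbb{R}^{m-1},S)$ consists of all products $X^{(j)}_{k-j}(\underline{x},x_m)\,p(\underline{x})$ with $p\in\mathcal{M}_{k-j}(\mathbb{R}^{m-1},S)$. *)

(* Defs.v *)
(* MathComp, with multinomials for polynomials with Clifford coefficients and
   MathComp-Analysis for derivatives along real curves.  [mpoly] has to be
   imported before the analysis files, whose notations otherwise clash with
   its own. *)
From HB Require Import structures.
From mathcomp Require Import all_boot all_order all_algebra all_field.
From mathcomp Require Import complex mpoly.
From mathcomp Require classical_sets.
From mathcomp Require Import reals topology normedtype.
From mathcomp Require Import derive.

Set Implicit Arguments.
Unset Strict Implicit.
Unset Printing Implicit Defensive.

Import Order.TTheory GRing.Theory Num.Theory numFieldNormedType.Exports.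

Local Open Scope ring_scope.

(* The Clifford algebra with e_i^2 = -1 and e_i e_j = - e_j e_i, given by its
   basis e_A = e_{a_1} ... e_{a_r}, where A = {a_1 < ... < a_r}.  Moving the
   factors of e_B into place inside e_A e_B costs one sign for each pair
   (i, j) in A x B with j < i, and one more for each i in A and B, because
   e_i^2 = -1; hence e_A e_B = cl_sign A B e_(symdiff A B). *)
Definition clifford (K : fieldType) (m : nat) : Type := {ffun {set 'I_m} -> K}.

Definition symdiff (T : finType) (A B : {set T}) : {set T} :=
  [set x | (x \in A) (+) (x \in B)].

Section Clifford.

Context {K : fieldType} {m : nat}.

Implicit Types (A B C D : {set 'I_m}) (a b c : clifford K m).

Definition cl_sign A B : K := \prod_(i in A) \prod_(j in B | (j <= i)%N) (- 1).

Definition cl_basis A : clifford K m := [ffun B => (B == A)%:R].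

Definition cl_mul a b : clifford K m :=
  [ffun C => \sum_A cl_sign A (symdiff A C) * (a A * b (symdiff A C))].

HB.instance Definition _ := Vector.copy (clifford K m) {ffun {set 'I_m} -> K^o}.

Lemma symdiffA A B C : symdiff A (symdiff B C) = symdiff (symdiff A B) C.
Proof. by apply/setP => x; rewrite !inE addbA. Qed.

Lemma symdiffK A : involutive (symdiff A).
Proof. by move=> B; apply/setP => x; rewrite !inE addKb. Qed.

Lemma symdiffKr A B : symdiff A (symdiff B A) = B.
Proof. by apply/setP => x; rewrite !inE addbC addbK. Qed.

Lemma symdiff0s A : symdiff set0 A = A.
Proof. by apply/setP => x; rewrite !inE. Qed.

Lemma symdiffs0 A : symdiff A set0 = A.
Proof. by apply/setP => x; rewrite !inE addbF. Qed.

Lemma symdiffss A : symdiff A A = set0.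
Proof. by apply/setP => x; rewrite !inE addbb. Qed.

Lemma prod_symdiff (F : 'I_m -> K) A B : (forall i, F i * F i = 1) ->
  \prod_(i in symdiff A B) F i = (\prod_(i in A) F i) * \prod_(i in B) F i.
Proof.
move=> FF; rewrite big_mkcond [in RHS]big_mkcond [X in _ * X]big_mkcond /=.
rewrite -big_split; apply: eq_bigr => i _; rewrite inE.
by case: (i \in A); case: (i \in B); rewrite /= ?FF ?mulr1 ?mul1r.
Qed.

Lemma prodN1_sqr (P : pred 'I_m) :
  (\prod_(j | P j) (- 1 : K)) * (\prod_(j | P j) (- 1 : K)) = 1.
Proof. by rewrite -big_split /= big1 // => j _; rewrite mulrNN mulr1. Qed.

Lemma cl_sign_symdiffl A B C :
  cl_sign (symdiff A B) C = cl_sign A C * cl_sign B C.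
Proof. by apply: prod_symdiff => i; exact: prodN1_sqr. Qed.

Lemma cl_sign_symdiffr A B C :
  cl_sign A (symdiff B C) = cl_sign A B * cl_sign A C.
Proof.
rewrite /cl_sign -big_split /=; apply: eq_bigr => i _.
have H D : \prod_(j in D | (j <= i)%N) (- 1 : K) =
    \prod_(j in D) (if (j <= i)%N then - 1 else 1) by rewrite big_mkcondr.
rewrite !H prod_symdiff // => j.
by case: ifP => _; rewrite ?mulrNN mulr1.
Qed.

Lemma cl_sign0s A : cl_sign set0 A = 1.
Proof. by rewrite /cl_sign big_set0. Qed.

Lemma cl_signs0 A : cl_sign A set0 = 1.
Proof. by rewrite /cl_sign big1 // => i _; rewrite big1 // => j; rewrite inE. Qed.

Lemma cl_mulA : associative cl_mul.
Proof.
move=> a b c; apply/ffunP => D; rewrite !ffunE.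
transitivity (\sum_A \sum_E cl_sign A (symdiff A D) *
    (cl_sign (symdiff A E) (symdiff (symdiff A E) (symdiff A D)) *
    (a A * (b (symdiff A E) *
            c (symdiff (symdiff A E) (symdiff A D)))))).
  apply: eq_bigr => A _; rewrite ffunE (reindex_inj (inv_inj (symdiffK A))) /=.
  rewrite !mulr_sumr; apply: eq_bigr => E _.
  by congr (_ * _); rewrite mulrCA.
rewrite exchange_big /=; apply: eq_bigr => E _.
rewrite ffunE mulr_suml mulr_sumr; apply: eq_bigr => A _.
have -> : symdiff (symdiff A E) (symdiff A D) = symdiff E D.
  by apply/setP => x; rewrite !inE; do !case: (x \in _).
have -> : cl_sign A (symdiff A D) =
    cl_sign A (symdiff A E) * cl_sign A (symdiff E D).
  by rewrite -cl_sign_symdiffr -symdiffA symdiffK.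
rewrite cl_sign_symdiffl.
have sq B C : cl_sign B C * cl_sign B C = 1.
  by rewrite -cl_sign_symdiffl symdiffss cl_sign0s.
have := sq A (symdiff E D).
set s := cl_sign A (symdiff E D); set t := cl_sign A (symdiff A E).
set u := cl_sign E _; move=> ss.
rewrite !mulrA -[t * s * s]mulrA ss mulr1.
by rewrite [u * t]mulrC -!mulrA.
Qed.

Lemma cl_mul1x : left_id (cl_basis set0) cl_mul.
Proof.
move=> a; apply/ffunP => C; rewrite !ffunE (bigD1 set0) //= big1 ?addr0.
  by rewrite !ffunE eqxx symdiff0s cl_sign0s !mul1r.
by move=> A /negPf A0; rewrite !ffunE A0 mul0r mulr0.
Qed.

Lemma cl_mulx1 : right_id (cl_basis set0) cl_mul.
Proof.
move=> a; apply/ffunP => C; rewrite !ffunE (bigD1 C) //= big1 ?addr0.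
  by rewrite !ffunE symdiffss eqxx cl_signs0 mul1r mulr1.
move=> A /negPf AC; rewrite !ffunE; case: eqP => [h|_]; last by rewrite !mulr0.
by rewrite -(symdiffK A C) h symdiffs0 eqxx in AC.
Qed.

Lemma cl_mulDl : left_distributive cl_mul +%R.
Proof.
move=> a b c; apply/ffunP => C; rewrite !ffunE -big_split; apply: eq_bigr => A _.
by rewrite ffunE mulrDl mulrDr.
Qed.

Lemma cl_mulDr : right_distributive cl_mul +%R.
Proof.
move=> a b c; apply/ffunP => C; rewrite !ffunE -big_split; apply: eq_bigr => A _.
by rewrite ffunE !mulrDr.
Qed.

Lemma cl_1_neq0 : cl_basis set0 != 0.
Proof.
by apply/eqP => /ffunP/(_ set0)/eqP; rewrite !ffunE eqxx oner_eq0.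
Qed.

HB.instance Definition _ := GRing.Zmodule_isNzRing.Build (clifford K m)
  cl_mulA cl_mul1x cl_mulx1 cl_mulDl cl_mulDr cl_1_neq0.

Lemma cl_scalerAl (k : K) a b : k *: (a * b) = k *: a * b.
Proof.
apply/ffunP => C; rewrite !ffunE /= scaler_sumr; apply: eq_bigr => A _.
rewrite ffunE.
change (k * (cl_sign A (symdiff A C) * (a A * b (symdiff A C))) =
  cl_sign A (symdiff A C) * (k * a A * b (symdiff A C))).
by rewrite mulrCA -[k * a A * _]mulrA.
Qed.

HB.instance Definition _ :=
  GRing.Lmodule_isLalgebra.Build K (clifford K m) cl_scalerAl.

Lemma cl_scalerAr (k : K) a b : k *: (a * b) = a * (k *: b).
Proof.
apply/ffunP => C; rewrite !ffunE /= scaler_sumr; apply: eq_bigr => A _.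
rewrite ffunE.
change (k * (cl_sign A (symdiff A C) * (a A * b (symdiff A C))) =
  cl_sign A (symdiff A C) * (a A * (k * b (symdiff A C)))).
by rewrite mulrCA; congr (_ * _); rewrite mulrCA.
Qed.

HB.instance Definition _ :=
  GRing.Lalgebra_isAlgebra.Build K (clifford K m) cl_scalerAr.
HB.instance Definition _ := Algebra_isFalgebra.Build K (clifford K m).

Definition cl_gen (i : 'I_m) : clifford K m := cl_basis [set i].

Lemma cl_basisM A B :
  cl_basis A * cl_basis B = cl_sign A B *: cl_basis (symdiff A B).
Proof.
apply/ffunP => C; rewrite !ffunE (bigD1 A) //= big1 ?addr0.
  rewrite !ffunE eqxx mul1r /GRing.scale /=.
  have -> : (symdiff A C == B) = (C == symdiff A B).
    by rewrite -(inj_eq (inv_inj (symdiffK A))) symdiffK.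
  by case: eqP => [->|]; rewrite ?symdiffK // !mulr0.
by move=> D /negPf DA; rewrite !ffunE DA mul0r mulr0.
Qed.

Lemma cl_sign1 i j : cl_sign [set i] [set j] = if (j <= i)%N then - 1 else 1.
Proof. by rewrite /cl_sign big_set1 big_mkcondr big_set1. Qed.

Lemma cl_gen_sqr i : cl_gen i * cl_gen i = - 1.
Proof. by rewrite cl_basisM symdiffss cl_sign1 leqnn scaleN1r. Qed.

Lemma cl_gen_anticomm i j :
  i != j -> cl_gen i * cl_gen j = - (cl_gen j * cl_gen i).
Proof.
move=> ij; rewrite !cl_basisM !cl_sign1.
have -> : symdiff [set j] [set i] = symdiff [set i] [set j].
  by apply/setP => x; rewrite !inE addbC.
have : (i != j :> nat) by [].
by rewrite neq_ltn; case: ltngtP => // _ _; rewrite ?scaleN1r ?scale1r ?opprK.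
Qed.

End Clifford.

Notation "''Cl[' R ]_ m" := (clifford (complex R) m)
  (at level 8, m at level 2, format "''Cl[' R ]_ m").

Section Spin.

Context {R : realType} {m : nat}.

Definition cl_vec (v : 'rV[R]_m) : 'Cl[R]_m :=
  \sum_(i < m) (v 0 i)%:C%C *: cl_gen i.

Definition spin_group (s : 'Cl[R]_m) : Prop :=
  exists vs : seq 'rV[R]_m,
    [/\ ~~ odd (size vs),
        forall v, v \in vs -> \sum_(i < m) v 0 i ^+ 2 = 1
      & s = \prod_(v <- vs) cl_vec v].

Definition so_algebra (l : nat) (w : 'Cl[R]_m) : Prop :=
  exists a : 'M[R]_m,
    w = \sum_(i < m) \sum_(j < m | (i < j < l)%N)
          (a i j)%:C%C *: (cl_gen i * cl_gen j).

(* The product of the commuting idempotents (1 + i e_{2p-1} e_{2p}) / 2 is a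
   primitive idempotent of the Clifford algebra when m is even; the left ideal
   that it generates is the spinor space, whose even and odd parts are the two
   half-spin representations.  Indices start at 0 here, and [ordS i] is the
   index i + 1 (there is no wrap-around for i even and m even). *)
Definition spinor_idempotent : 'Cl[R]_m :=
  \prod_(i < m | ~~ odd i) (2^-1 *: (1 + 'i%C *: (cl_gen i * cl_gen (ordS i)))).

Definition cl_parity (b : bool) : {vspace 'Cl[R]_m} :=
  (\sum_(A : {set 'I_m} | odd #|A| == b) <[cl_basis A]>)%VS.

Definition half_spin (b : bool) : {vspace 'Cl[R]_m} :=
  (cl_parity b * <[spinor_idempotent]>)%VS.

Definition basic_spinor (S : {vspace 'Cl[R]_m}) : Prop :=
  (forall s a, spin_group s -> a \in S -> s * a \in S) /\
  exists (b : bool) (f : 'End('Cl[R]_m)),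
    [/\ (f @: S = half_spin b)%VS,
        {in S &, injective f}
      & forall s a, spin_group s -> a \in S -> f (s * a) = s * f a].

End Spin.

Section Modules.

Context {R : realType} {m : nat}.

Local Notation Cl := ('Cl[R]_m).
(* Clifford-valued polynomials on R^m: the variables commute with the
   coefficients. *)
Local Notation CP := {mpoly Cl[m]}.

Implicit Types (P Q : CP) (V W : CP -> Prop) (w : Cl) (l : nat).

(* (L(s) P)(x) = s P(s^-1 x s): the j-th coordinate of s^-1 x s is the sum over
   i of x_i times the e_j-coefficient of s^-1 e_i s. *)
Definition spin_act (s : Cl) P : CP :=
  s%:MP * (P \mPo [tuple \sum_(i < m)
             ((s^-1 * cl_gen i * s) [set j])%:A *: 'X_i | j < m]).

Definition is_cderive0 (f : R -> R[i]) (d : R[i]) : Prop :=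
  is_derive (0 : R) 1 (fun t => complex.Re (f t)) (complex.Re d) /\
  is_derive (0 : R) 1 (fun t => complex.Im (f t)) (complex.Im d).

(* Q is the image of P under the differential of [spin_act] at 1 in the
   direction w, computed coefficientwise along curves of Spin(m). *)
Definition is_spin_deriv w P Q : Prop :=
  forall g : R -> Cl,
    (forall t, spin_group (g t)) -> g 0 = 1 ->
    (forall A, is_cderive0 (fun t => g t A) (w A)) ->
    forall mon A, is_cderive0 (fun t => (spin_act (g t) P)@_mon A) (Q@_mon A).

(* The derivative exists and does not depend on the curve when w is in
   so(m), which is the only case in which [so_act] is used. *)
Definition so_act w P : CP := classical_sets.xget 0 (is_spin_deriv w P).

Definition csubspace V : Prop :=
  V 0 /\ forall (c : R[i]) P Q, V P -> V Q -> V (c%:A *: P + Q).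

Definition so_module l V : Prop :=
  csubspace V /\ forall w P, so_algebra l w -> V P -> V (so_act w P).

Definition so_irreducible l V : Prop :=
  [/\ so_module l V,
      exists2 P, V P & P <> 0
    & forall U, so_module l U -> (forall P, U P -> V P) ->
        (forall P, U P -> P = 0) \/ (forall P, V P -> U P)].

Definition so_equivalent l V W : Prop :=
  exists f : CP -> CP,
    [/\ forall (c : R[i]) P Q, V P -> V Q ->
          f (c%:A *: P + Q) = c%:A *: f P + f Q,
        forall P Q, V P -> V Q -> f P = f Q -> P = Q,
        forall Q, W Q <-> exists2 P, V P & Q = f P
      & forall w P, so_algebra l w -> V P -> f (so_act w P) = so_act w (f P)].

Definition direct_sum (I : finType) V (W : I -> CP -> Prop) : Prop :=
  (forall P, V P <->
     exists2 Q : I -> CP, (forall i, W i (Q i)) & P = \sum_i Q i) /\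
  (forall Q : I -> CP, (forall i, W i (Q i)) -> \sum_i Q i = 0 ->
     forall i, Q i = 0).

Definition dirac l P : CP := \sum_(i < m | (i < l)%N) (cl_gen i)%:MP * P^`M(i).

(* The monogenics on R^l, for l <= m, as polynomials on R^m in which only the
   first l variables occur. *)
Definition monogenic l (k : nat) (S : {vspace Cl}) P : Prop :=
  [/\ P \is k.-homog,
      forall mon, P@_mon \in S,
      forall mon (i : 'I_m), mon \in msupp P -> (l <= i)%N -> mon i = 0%N
    & dirac l P = 0].

End Modules.

Section Gegenbauer.

Context {R : realType}.

Implicit Types (nu : R) (j k m : nat).

Definition rising nu j : R := \prod_(i < j) (nu + i%:R).

Definition gegen_coef nu j i : R :=
  (-1) ^+ i * rising nu (j - i) / ((i`!)%:R * ((j - i.*2)`!)%:R).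

Definition gegenbauer nu j : {poly R} :=
  \sum_(i < j./2.+1) (gegen_coef nu j i) *: (2%:R *: 'X) ^+ (j - i.*2).

(* F at the last index m - 1 of a vector of length m, and 0 when m = 0. *)
Definition at_last (T : nmodType) m (F : 'I_m -> T) : T :=
  if insub m.-1 is Some i then F i else 0.

(* r^j C_j^nu (x_m / r), a polynomial because the powers of 1 / r that occur
   in it are r^(2 i - j); see [gegenbauer_homE]. *)
Definition gegenbauer_hom nu j m : {mpoly R[m]} :=
  \sum_(i < j./2.+1) gegen_coef nu j i *:
    ((2%:R *: at_last (fun p : 'I_m => 'X_p)) ^+ (j - i.*2) *
     (\sum_(p < m) 'X_p ^+ 2) ^+ i).

Lemma gegenbauer_homE nu j m (x : 'I_m -> R) :
  let r := Num.sqrt (\sum_(p < m) x p ^+ 2) in r != 0 ->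
  (gegenbauer_hom nu j m).@[x] = r ^+ j * (gegenbauer nu j).[at_last x / r].
Proof.
move=> r r0.
have lastE : (at_last (fun p : 'I_m => 'X_p) : {mpoly R[m]}).@[x] = at_last x.
  by rewrite /at_last; case: insubP => [u _ _|_]; rewrite ?mevalXU ?meval0.
have r2E : (\sum_(p < m) 'X_p ^+ 2 : {mpoly R[m]}).@[x] = r ^+ 2.
  rewrite raddf_sum /= sqr_sqrtr; last by apply: sumr_ge0 => p _; exact: sqr_ge0.
  by apply: eq_bigr => p _; rewrite rmorphXn /= mevalXU.
rewrite /gegenbauer_hom /gegenbauer raddf_sum horner_sum mulr_sumr /=.
apply: eq_bigr => i _.
have ij : (i.*2 <= j)%N.
  rewrite -[leqRHS](odd_double_half j) (leq_trans _ (leq_addl _ _)) //.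
  by rewrite leq_double -ltnS.
rewrite mevalZ rmorphM !rmorphXn /= mevalZ lastE r2E.
rewrite hornerZ horner_exp hornerZ hornerX [RHS]mulrCA; congr (_ * _).
rewrite -exprM mul2n -[in r ^+ j](subnKC ij) exprD -mulrA -exprMn mulrC.
by congr (_ * _); congr (_ ^+ _); rewrite mulrCA [r * _]mulrC divfK.
Qed.

Definition mu_const m k j : R :=
  let l := j./2 in
  if odd j then
    (-1) ^+ l * ((m + 2 * k + 2 * l)%:R - 1) / ((m + 2 * k)%:R - 2%:R)
      * ((gegenbauer (m%:R / 2%:R + k%:R) l.*2).[0])^-1
  else (-1) ^+ l * ((gegenbauer (m%:R / 2%:R + k%:R - 1) l.*2).[0])^-1.

Definition xunder m : {mpoly 'Cl[R]_m[m]} :=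
  \sum_(i < m | (i < m.-1)%N) cl_gen i *: 'X_i.

Definition cl_poly m (p : {mpoly R[m]}) : {mpoly 'Cl[R]_m[m]} :=
  map_mpoly (in_alg 'Cl[R]_m \o real_complex R) p.

Definition Xpoly m j k : {mpoly 'Cl[R]_m[m]} :=
  if j is j'.+1 then
    cl_poly (mu_const m k j *: gegenbauer_hom (m%:R / 2%:R + k%:R - 1) j m)
    + cl_poly ((mu_const m k j *
                (((m + 2 * k)%:R - 2%:R) / ((m + 2 * k + j)%:R - 2%:R)))
               *: gegenbauer_hom (m%:R / 2%:R + k%:R) j' m)
      * (xunder m * (at_last (fun i : 'I_m => cl_gen i))%:MP)
  else 1.

Definition Xmonogenic m k (S : {vspace 'Cl[R]_m}) (j : 'I_k.+1)
    (P : {mpoly 'Cl[R]_m[m]}) : Prop :=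
  exists2 p, monogenic m.-1 (k - j) S p & P = Xpoly m j (k - j) * p.

End Gegenbauer.

(* Main.v *)
Require Import Defs.
From HB Require Import structures.
From mathcomp Require Import all_boot all_order all_algebra all_field.
From mathcomp Require Import complex mpoly.
From mathcomp Require Import reals.
From mathcomp Require classical_sets boolp.
From mathcomp Require Import topology normedtype derive.
From mathcomp Require Import realfun exp trigo.
From mathcomp Require Import ring lra zify.

Set Implicit Arguments.
Unset Strict Implicit.
Unset Printing Implicit Defensive.

Import Order.TTheory GRing.Theory Num.Theory numFieldNormedType.Exports.

Local Open Scope ring_scope.

(** The proof follows the representation theory of the two orthogonal algebras,
    made explicit in a few families of operators.

    The abstract derivative that defines the action is computed first. On the
    spin group the inverse is the Clifford conjugation, which is linear, so that
    the curve [L(s) P] can be differentiated by the product rule; a product of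
    plane rotations is a curve with any prescribed tangent, which makes the
    derivative unique. The result is that [e_p e_q] acts by
    [e_p e_q + 2 (x_q d_p - x_p d_q)] ([so_act_pair], [so_moduleP]).

    Decomposition. A monogenic polynomial on R^m is determined by its restriction
    to the hyperplane x_m = 0 (Cauchy-Kovalevskaya, [ck_unique]), and every
    homogeneous polynomial on the hyperplane is a unique sum of terms
    [x'^j p_j] with [p_j] monogenic, where [x'] is the vector variable times
    [e_m] (Fischer decomposition, [fischer_full], [fischer_direct]). The
    polynomial [X^(j) p_j] is monogenic ([Xp_monogenic], by two identities
    between Gegenbauer polynomials) and restricts to [x'^j p_j] ([rst_Xp]); hence
    the sum of these products is the given polynomial. Multiplication by [X^(j)]
    is injective and commutes with so(m - 1) ([Xp_inj], [spin_rot_Xp]), so that each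
    summand is isomorphic to a space of monogenic polynomials on R^(m - 1).

    Irreducibility. With the null coordinate [z = x_1 + i x_2], the operators
    [L_(1 q) + i L_(2 q)] for [2 < q < m] commute and are locally nilpotent,
    so that each nonzero submodule contains a nonzero vector killed by all of
    them ([common_kernel]). A monogenic polynomial killed by them is [z^k s] with
    a constant spinor [s] killed by [e_1 + i e_2] ([extremalP],
    [extremal_power]), and a submodule that contains one such vector contains all
    of them, because the spinor space is irreducible under the products
    [e_p e_q] with [p, q < m] ([spinor_irr], [all_extremal]). The operators of
    so(m) are skew for the Fischer inner product ([fischer_ip_sog]), so the orthogonal
    complement of a proper nonzero submodule would be a nonzero submodule and
    contain the same vectors, which is impossible ([mono_irreducible]).

    Inequivalence. An equivalence maps a vector killed by the raising operators to
    another one, and preserves its eigenvalue under the rotation of the plane of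
    [x_1] and [x_2], which is [- i (2 k + 1)] on [z^k s] ([iter_zl_weight]); hence it
    preserves the degree ([branch_inequivalent]). *)

(** * Parity and the primitive idempotent of the Clifford algebra *)

Section CliffordBasis.
Context {K : fieldType} {m : nat}.
Implicit Types (A B C : {set 'I_m}) (a b : clifford K m).
Local Notation e := (@cl_basis K m).

Lemma cl_addE a b A : (a + b) A = a A + b A.
Proof. by rewrite ffunE. Qed.

Lemma cl_scaleE (c : K) a A : (c *: a) A = c * a A.
Proof. by rewrite ffunE. Qed.

Lemma cl_oppE a A : (- a) A = - a A.
Proof. by rewrite ffunE. Qed.

Lemma cl_zeroE A : (0 : clifford K m) A = 0.
Proof. by rewrite ffunE. Qed.

Lemma cl_sumE (I : Type) (r : seq I) (P : pred I) (F : I -> clifford K m) A :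
  (\sum_(i <- r | P i) F i) A = \sum_(i <- r | P i) F i A.
Proof. exact: (big_morph (fun a : clifford K m => a A) (fun a b => cl_addE a b A) (cl_zeroE A)). Qed.

Lemma cl_basisE A B : e A B = (B == A)%:R.
Proof. by rewrite ffunE. Qed.

Lemma cl_basis0 : e set0 = 1. Proof. by []. Qed.

Lemma cl_expand a : a = \sum_A a A *: e A.
Proof.
apply/ffunP => B; rewrite cl_sumE (bigD1 B) //= big1 ?addr0.
  by rewrite cl_scaleE cl_basisE eqxx mulr1.
by move=> A AB; rewrite cl_scaleE cl_basisE eq_sym (negPf AB) mulr0.
Qed.

Lemma cl_sign_sqr A B : cl_sign A B * cl_sign A B = 1 :> K.
Proof. by rewrite -cl_sign_symdiffl symdiffss cl_sign0s. Qed.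

Lemma cl_sign_neq0 A B : cl_sign A B != 0 :> K.
Proof. by apply/eqP => h; have /eqP := cl_sign_sqr A B; rewrite h mul0r eq_sym oner_eq0. Qed.

Lemma cl_basis_symdiff A B : e (symdiff A B) = cl_sign A B *: (e A * e B).
Proof. by rewrite cl_basisM scalerA cl_sign_sqr scale1r. Qed.

Lemma cl_basis_sqr A : e A * e A = (cl_sign A A)%:A.
Proof. by rewrite cl_basisM symdiffss. Qed.

Lemma cl_basisV A : (cl_sign A A *: e A) * e A = 1.
Proof. by rewrite -scalerAl cl_basis_sqr scalerA cl_sign_sqr scale1r. Qed.

Lemma cl_basis_mulI A a : e A * a = 0 -> a = 0.
Proof. by move=> h; rewrite -[a]mul1r -(cl_basisV A) -mulrA h mulr0. Qed.

Lemma cl_gen_mulI i a : cl_gen i * a = 0 -> a = 0.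
Proof. exact: cl_basis_mulI. Qed.

Lemma symdiffC A B : symdiff A B = symdiff B A.
Proof. by apply/setP => x; rewrite !inE addbC. Qed.

Lemma odd_symdiff A B : odd #|symdiff A B| = odd #|A| (+) odd #|B|.
Proof.
have -> : symdiff A B = (A :\: B) :|: (B :\: A).
  by apply/setP => x; rewrite !inE; do !case: (x \in _).
have := cardsID B A; have := cardsID A B; rewrite setIC => <- <-.
rewrite cardsU !oddD; have -> : (A :\: B) :&: (B :\: A) = set0.
  by apply/setP => x; rewrite !inE; do !case: (x \in _).
rewrite cards0 subn0 oddD.
rewrite ?[B :&: A]setIC; by case: (odd #|A :&: B|); case: (odd #|A :\: B|); case: (odd #|B :\: A|).
Qed.

(** Moving [e B] across [e A] costs one sign for each pair of distinct
    indices. *)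
Lemma cl_sign_swap A B : cl_sign A B * cl_sign B A =
  \prod_(i in A) \prod_(j in B) (if i == j then 1 else - 1) :> K.
Proof.
rewrite /cl_sign [X in _ * X](exchange_big_dep (mem A)) //=; last by move=> i j _ /andP[].
rewrite -big_split /=; apply: eq_bigr => i iA.
rewrite [X in X * _]big_mkcondr /= [X in _ * X]big_mkcondr /= -big_split /=.
rewrite (eq_bigr (fun j => if i == j then 1 else -1)) // => j jB.
by rewrite -(inj_eq val_inj) /= iA; case: ltngtP; rewrite ?mulr1 ?mul1r ?mulrNN ?mulr1.
Qed.

Lemma cl_basis_swap A B : e A * e B =
  (\prod_(i in A) \prod_(j in B) (if i == j then 1 else - 1)) *: (e B * e A).
Proof.
rewrite -cl_sign_swap !cl_basisM scalerA -mulrA cl_sign_sqr mulr1.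
by rewrite symdiffC.
Qed.

Lemma cl_gen_swap i A : cl_gen i * e A =
  (-1) ^+ (#|A| + (i \in A)) *: (e A * cl_gen i).
Proof.
rewrite cl_basis_swap; congr (_ *: _); rewrite big_set1.
case: (boolP (i \in A)) => iA.
  rewrite (big_setD1 i) //= eqxx mul1r (eq_bigr (fun=> -1)).
    by rewrite prodr_const (cardsD1 i A) iA addn1 !exprS !mulN1r opprK.
  by move=> j; rewrite !inE eq_sym => /andP[/negPf ->].
rewrite addn0 (eq_bigr (fun=> -1)) ?prodr_const // => j jA.
by case: eqP => // ij; rewrite ij jA in iA.
Qed.

Definition cl_even (b : bool) a := forall A, odd #|A| != b -> a A = 0.

Lemma cl_evenM (b c : bool) x y : cl_even b x -> cl_even c y -> cl_even (b (+) c) (x * y).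
Proof.
move=> hx hy C hC; rewrite ffunE big1 // => A _.
case: (eqVneq (odd #|A|) b) => [hA|hA]; last by rewrite hx // mul0r mulr0.
rewrite [y _]hy ?mulr0 // odd_symdiff; move: hC hA.
by case: (odd #|A|); case: (odd #|C|); case: b {hx}; case: c {hy}.
Qed.

Lemma cl_evenZ (b : bool) c a : cl_even b a -> cl_even b (c *: a).
Proof. by move=> h A hA; rewrite cl_scaleE h ?mulr0. Qed.

Lemma cl_evenD (b : bool) x y : cl_even b x -> cl_even b y -> cl_even b (x + y).
Proof. by move=> hx hy A hA; rewrite cl_addE hx ?hy ?addr0. Qed.

Lemma cl_even_basis A : cl_even (odd #|A|) (e A).
Proof. by move=> B; rewrite cl_basisE; case: (eqVneq B A) => [->|]; rewrite ?eqxx. Qed.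

Lemma cl_even1 : cl_even false 1.
Proof. by have := @cl_even_basis set0; rewrite cards0. Qed.

Lemma cl_even_disj a : cl_even true a -> cl_even false a -> a = 0.
Proof.
move=> h1 h0; apply/ffunP => A; rewrite [RHS]ffunE.
by case h : (odd #|A|); [apply: h0 | apply: h1]; rewrite h.
Qed.

Lemma cl_even_prod (I : Type) (r : seq I) (P : pred I) (F : I -> clifford K m) :
  (forall i, cl_even false (F i)) -> cl_even false (\prod_(i <- r | P i) F i).
Proof.
move=> h; elim/big_ind: _ => [|x y hx hy|i _]; [exact: cl_even1| |exact: h].
exact: (cl_evenM hx hy).
Qed.

Lemma cl_even_expand (b : bool) a : cl_even b a ->
  a = \sum_(A : {set 'I_m} | odd #|A| == b) a A *: e A.
Proof.
move=> h; rewrite {1}[a]cl_expand (bigID (fun A : {set 'I_m} => odd #|A| == b)) /=.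
by rewrite [X in _ + X]big1 ?addr0 // => A hA; rewrite h // scale0r.
Qed.

End CliffordBasis.

Lemma cl_parityP (R : realType) m b (a : 'Cl[R]_m) :
  reflect (cl_even b a) (a \in cl_parity b).
Proof.
apply: (iffP idP) => [/memv_sumP[f hf ->] B hB | h].
  rewrite cl_sumE big1 // => A hA; have /vlineP[c ->] := hf A hA.
  by rewrite cl_scaleE cl_basisE; case: (eqVneq B A) => [BA|]; rewrite ?mulr0 //; move: hB; rewrite BA hA.
rewrite (cl_even_expand h); apply: memv_sumr => A _.
exact/memvZ/memv_line.
Qed.

Section Idempotent.
Context (R : realType) (n : nat).
Local Notation m := (2 * n)%N.
Local Notation C := R[i].
Local Notation Cl := ('Cl[R]_m).
Implicit Types (p q : 'I_m) (A B : {set 'I_m}) (t x : Cl).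
Local Notation i := ('i%C : C).

Let pairE p : Cl := cl_gen p * cl_gen (ordS p).
Let pairI p : Cl := 2^-1 *: (1 + i *: pairE p).

Lemma val_ordS_even p : ~~ odd p -> ordS p = p.+1 :> nat.
Proof.
move=> hp; rewrite /= modn_small //; have := ltn_ord p.
rewrite leq_eqVlt => /orP[/eqP h|//]; move: hp; have : odd p.+1 = false by rewrite h mul2n odd_double.
by rewrite /= => ->.
Qed.

Lemma ordS_even_neq p : ~~ odd p -> p != ordS p.
Proof. by move=> hp; apply/eqP => /(congr1 val)/=/esym/eqP; rewrite -[X in X == _]/(nat_of_ord (ordS p)) val_ordS_even // eqn_leq ltnn. Qed.

Let pairEE p : ~~ odd p -> pairE p = cl_basis [set p; ordS p].
Proof.
move=> hp; rewrite /pairE cl_basisM cl_sign1 val_ordS_even // ltnn scale1r.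
congr cl_basis; apply/setP => x; rewrite !inE.
by case: (eqVneq x p) => // ->; rewrite (negPf (ordS_even_neq hp)).
Qed.

Let pairE_swap p A : ~~ odd p -> pairE p * cl_basis A =
  (-1) ^+ ((p \in A) + (ordS p \in A)) *: (cl_basis A * pairE p).
Proof.
move=> hp; rewrite {1}/pairE -mulrA cl_gen_swap -scalerAr mulrA cl_gen_swap -scalerAl.
rewrite scalerA -mulrA; congr (_ *: _); rewrite -exprD addnACA addnn -muln2 exprD mulnC exprM.
by rewrite sqrrN expr1n expr1n mul1r addnC.
Qed.

Let pairE_sqr p : ~~ odd p -> pairE p * pairE p = -1.
Proof.
move=> hp; rewrite /pairE -mulrA [X in _ * X]mulrA.
rewrite [cl_gen (ordS p) * cl_gen p]cl_gen_anticomm 1?eq_sym ?ordS_even_neq //.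
by rewrite mulNr mulrN !mulrA cl_gen_sqr mulN1r mulNr opprK cl_gen_sqr.
Qed.

Let ii : i * i = -1. Proof. by rewrite -expr2 sqr_i. Qed.

Let pairE_I p : ~~ odd p -> pairE p * pairI p = - i *: pairI p.
Proof.
move=> hp; rewrite /pairI -scalerAr scalerA mulrC -scalerA; congr (_ *: _).
rewrite mulrDr mulr1 -scalerAr pairE_sqr // scalerDr scalerA mulNr ii opprK scale1r.
by rewrite addrC scalerN scaleNr.
Qed.

Let pairE_commI p q : ~~ odd p -> ~~ odd q -> pairE p * pairI q = pairI q * pairE p.
Proof.
move=> hp hq; rewrite /pairI -scalerAr -scalerAl; congr (_ *: _).
rewrite mulrDr mulrDl mulr1 mul1r -scalerAr -scalerAl; congr (_ + _ *: _).
rewrite (pairEE hq) pairE_swap // -[RHS]scale1r; congr (_ *: _); rewrite !inE.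
have ev : (p == ordS q) = false.
  apply/negP => /eqP pq; move: hp; rewrite pq val_ordS_even //=; by rewrite hq.
have ev' : (ordS p == q) = false.
  apply/negP => /eqP pq; move: hq; rewrite -pq val_ordS_even //=; by rewrite hp.
have inj : (ordS p == ordS q) = (p == q).
  exact: (inj_eq (@ordS_inj _)).
by rewrite ev ev' inj orbF; case: (p == q); rewrite -signr_odd /= expr0.
Qed.

Let gen_commI p q : ~~ odd p -> ~~ odd q -> p != q -> cl_gen p * pairI q = pairI q * cl_gen p.
Proof.
move=> hp hq pq; rewrite /pairI -scalerAr -scalerAl; congr (_ *: _).
rewrite mulrDr mulrDl mulr1 mul1r -scalerAr -scalerAl; congr (_ + _ *: _).
rewrite pairE_swap // !inE [q == p]eq_sym (negPf pq).
have -> : (ordS q == p) = false.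
  apply/negP => /eqP qp; move: hp; rewrite -qp val_ordS_even //=; by rewrite hq.
by rewrite expr0 scale1r.
Qed.

Let prodI (r : seq 'I_m) : Cl := \prod_(p <- r) pairI p.

Let pairE_prodI p r : ~~ odd p -> all (fun q => ~~ odd (val q)) r ->
  pairE p * prodI r = prodI r * pairE p.
Proof.
move=> hp; elim: r => [|q r IH] /=; rewrite /prodI ?big_nil ?mulr1 ?mul1r //.
case/andP => hq hr; rewrite big_cons [LHS]mulrA pairE_commI // -[LHS]mulrA -[RHS]mulrA; congr (_ * _).
exact: IH.
Qed.

Let gen_prodI p r : ~~ odd p -> all (fun q => ~~ odd (val q)) r -> p \notin r ->
  cl_gen p * prodI r = prodI r * cl_gen p.
Proof.
move=> hp; elim: r => [|q r IH] /=; rewrite /prodI ?big_nil ?mulr1 ?mul1r //.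
case/andP => hq hr; rewrite inE negb_or => /andP[pq pr].
rewrite big_cons [LHS]mulrA gen_commI // -[LHS]mulrA -[RHS]mulrA; congr (_ * _).
exact: IH.
Qed.

Let pairE_prodI_mem p r : ~~ odd p -> all (fun q => ~~ odd (val q)) r -> p \in r ->
  pairE p * prodI r = - i *: prodI r.
Proof.
move=> hp; elim: r => [|q r IH] //=; case/andP => hq hr; rewrite inE /prodI big_cons.
case/orP => [/eqP <-|pr]; first by rewrite mulrA pairE_I // -scalerAl.
by rewrite mulrA pairE_commI // -mulrA [X in _ * X](IH hr pr) -scalerAr.
Qed.

(* [cl_gen p] exchanges the kernel and the image of the projection [pairI p], so
   one of [u] and [cl_gen p * u] survives it; the other projections commute with
   [cl_gen p]. *)
Let prodI_sep r t : uniq r -> all (fun q => ~~ odd (val q)) r -> t != 0 ->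
  exists A, prodI r * (cl_basis A * t) != 0.
Proof.
move=> + + t0; elim: r => [|p r IH] /=.
  by move=> _ _; exists set0; rewrite /prodI big_nil cl_basis0 !mul1r.
case/andP=> pr ur /andP[hp hr]; have [A hA] := IH ur hr.
case: (eqVneq (pairI p * (prodI r * (cl_basis A * t))) 0) => [h|h]; last first.
  by exists A; rewrite /prodI big_cons -mulrA.
exists (symdiff [set p] A); rewrite cl_basis_symdiff -!scalerAl -scalerAr.
rewrite /prodI big_cons -!mulrA -/(prodI r) -/(cl_gen p).
rewrite [X in pairI p * X]mulrA -gen_prodI // scaler_eq0 negb_or cl_sign_neq0 /=.
set u := prodI r * _ in h hA *; rewrite -[cl_gen p * _ * _]mulrA -/u.
have -> : pairI p * (cl_gen p * u) = cl_gen p * (u - pairI p * u).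
  have sw : pairE p * (cl_gen p * u) = - (cl_gen p * (pairE p * u)).
    rewrite [LHS]mulrA pairE_swap // !inE eqxx [ordS p == p]eq_sym.
    by rewrite (negPf (ordS_even_neq hp)) addn0 expr1 scaleN1r mulNr -[in LHS]mulrA.
  rewrite /pairI -!scalerAl !mulrDl !mul1r -!scalerAl sw mulrBr -scalerAr mulrDr -scalerAr.
  move: (cl_gen p * u) (cl_gen p * _) => x y; rewrite scalerN !scalerDr scalerN opprD addrA.
  congr (_ - _); apply/eqP; rewrite eq_sym subr_eq -scalerDl.
  by rewrite (_ : 2^-1 + 2^-1 = 1) ?scale1r //; field.
rewrite h subr0; apply: contra hA => /eqP/cl_gen_mulI/eqP //.
Qed.

Let evens : seq 'I_m := [seq p : 'I_m <- index_enum 'I_m | ~~ odd (val p)].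

Local Notation eps := (@spinor_idempotent R m).

Let epsE : eps = prodI evens.
Proof. by rewrite /spinor_idempotent /prodI /evens big_filter. Qed.

Let mem_evens p : (p \in evens) = ~~ odd p.
Proof. by rewrite mem_filter mem_index_enum andbT. Qed.

Let evensP : all (fun q => ~~ odd (val q)) evens. Proof. exact: filter_all. Qed.

Lemma spinor_idempotent_sep t : t != 0 -> exists A, eps * (cl_basis A * t) != 0.
Proof. by rewrite epsE; apply: prodI_sep; rewrite ?filter_uniq ?index_enum_uniq ?filter_all. Qed.

Lemma spinor_idempotent_neq0 : eps != 0.
Proof.
have [A hA] := spinor_idempotent_sep (oner_neq0 _).
by apply: contraNneq hA => ->; rewrite mul0r.
Qed.

Let pairE_eps p : ~~ odd p -> pairE p * eps = - i *: eps.
Proof. by move=> hp; rewrite epsE pairE_prodI_mem // mem_evens. Qed.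

Let eps_pairE p : ~~ odd p -> eps * pairE p = - i *: eps.
Proof. by move=> hp; rewrite -(pairE_eps hp) epsE pairE_prodI. Qed.

Lemma spinor_idempotentK : eps * eps = eps.
Proof.
suff h r : all (fun q => ~~ odd (val q)) r -> prodI r * eps = eps by rewrite {1}epsE h.
elim: r => [|p r IH] /=; first by rewrite /prodI big_nil mul1r.
case/andP=> hp hr; rewrite /prodI big_cons -mulrA [X in _ * X]IH //.
rewrite /pairI -scalerAl mulrDl mul1r -scalerAl pairE_eps // scalerA mulrN ii opprK scale1r.
rewrite -[X in _ *: (X + _)]scale1r -[X in _ *: (_ + X)]scale1r -scalerDl scalerA.
by rewrite (_ : _ * _ = 1) ?scale1r //; field.
Qed.

Lemma spinor_idempotent_even : cl_even false eps.
Proof.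
rewrite epsE; apply: cl_even_prod => p; apply: cl_evenZ; apply: cl_evenD; first exact: cl_even1.
apply: cl_evenZ; rewrite -[false]/(true (+) true); apply: cl_evenM.
  by have := @cl_even_basis C m [set p]; rewrite cards1.
by have := @cl_even_basis C m [set ordS p]; rewrite cards1.
Qed.

(** The idempotent is primitive: a basis element that splits some pair
    anticommutes with that pair and is killed between two copies of the
    idempotent, and the others are products of pairs, which act on it by
    scalars. *)
Lemma spinor_idempotent_primitive x : exists c, eps * x * eps = c *: eps.
Proof.
suff h A : exists c, eps * cl_basis A * eps = c *: eps.
  have hsum (r : seq {set 'I_m}) : exists c,
      eps * (\sum_(A <- r) x A *: cl_basis A) * eps = c *: eps.
    elim: r => [|A r [c hc]]; first by exists 0; rewrite big_nil mulr0 mul0r scale0r.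
    have [d hd] := h A; exists (x A * d + c).
    by rewrite big_cons mulrDr mulrDl hc -scalerAr -scalerAl hd scalerA scalerDl.
  by rewrite [x]cl_expand; exact: hsum.
have [k] := ubnP #|A|; elim: k A => // k IH A; rewrite ltnS => hk.
case: (set_0Vmem A) => [->|[j jA]].
  by exists 1; rewrite cl_basis0 mulr1 spinor_idempotentK scale1r.
have [p hp pj] : exists2 p : 'I_m, ~~ odd p & (j == p) || (j == ordS p).
  case: (boolP (odd j)) => [oj|]; last by exists j => //; rewrite eqxx.
  have j0 : (0 < j)%N by case: (nat_of_ord j) oj.
  have lt_j1 : (j.-1 < m)%N by rewrite (leq_ltn_trans (leq_pred j)).
  have ej1 : ~~ odd (Ordinal lt_j1) by move: oj; rewrite -{1}(prednK j0) /=.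
  exists (Ordinal lt_j1) => //; apply/orP; right; apply/eqP/val_inj.
  by rewrite -[RHS]/(nat_of_ord (ordS (Ordinal lt_j1))) val_ordS_even //= prednK.
case: (boolP ((p \in A) == (ordS p \in A))) => [/eqP hA|hA]; last first.
  exists 0; rewrite scale0r.
  have sw : pairE p * cl_basis A = - (cl_basis A * pairE p).
    rewrite pairE_swap // (_ : _ + _ = 1)%N ?expr1 ?scaleN1r //.
    by move: hA; case: (p \in A); case: (ordS p \in A).
  have h1 : eps * (pairE p * cl_basis A) * eps = - i *: (eps * cl_basis A * eps).
    by rewrite mulrA eps_pairE // -scalerAl -scalerAl.
  have h2 : eps * (cl_basis A * pairE p) * eps = - i *: (eps * cl_basis A * eps).
    by rewrite (mulrA eps) -[LHS](mulrA (eps * cl_basis A)) pairE_eps // -scalerAr.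
  have /eqP : - i *: (eps * cl_basis A * eps) = i *: (eps * cl_basis A * eps).
    by rewrite -h1 sw mulrN mulNr h2 scaleNr opprK.
  rewrite scaleNr -subr_eq0 -opprD oppr_eq0 -scalerDl scaler_eq0 => /orP[|/eqP //].
  by rewrite -mulr2n -mulr_natl mulf_eq0 pnatr_eq0 /= => /eqP i0; move: ii;
     rewrite i0 mul0r => /eqP; rewrite eq_sym oppr_eq0 oner_eq0.
have pA : p \in A by case/orP: pj => /eqP jp; [|rewrite hA]; rewrite -jp.
have pA' : ordS p \in A by rewrite -hA.
pose B := symdiff A [set p; ordS p].
have sB : (#|B| < k)%N.
  have -> : B = A :\: [set p; ordS p].
    apply/setP => y; rewrite !inE; case: (eqVneq y p) => [->|_] /=; first by rewrite pA.
    by case: (eqVneq y (ordS p)) => [->|_]; rewrite ?pA' //= addbF.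
  apply: leq_trans hk; apply: proper_card; rewrite properEneq subsetDl andbT.
  by apply: contraTneq pA => <-; rewrite !inE eqxx.
have [c hc] := IH B sB.
have -> : A = symdiff B [set p; ordS p] by rewrite /B -symdiffA symdiffss symdiffs0.
exists (cl_sign B [set p; ordS p] * (- i * c)).
rewrite cl_basis_symdiff -pairEE // -scalerAr -scalerAl (mulrA eps).
by rewrite -[X in _ *: X](mulrA (eps * cl_basis B)) pairE_eps // -scalerAr hc !scalerA mulrA.
Qed.

Definition cl_subspace (T : Cl -> Prop) := T 0 /\ forall (c : C) a b, T a -> T b -> T (c *: a + b).

Lemma cl_subspace_sum T (r : seq {set 'I_m}) (P : pred {set 'I_m}) (F : {set 'I_m} -> Cl) (f : {set 'I_m} -> C) :
  cl_subspace T -> (forall A, P A -> T (F A)) -> T (\sum_(A <- r | P A) f A *: F A).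
Proof.
case=> T0 TD TF; elim: r => [|A r IH]; first by rewrite big_nil.
by rewrite big_cons; case: ifP => // /TF hA; exact: TD.
Qed.

Lemma half_spinP b x : reflect (exists2 a, cl_even b a & x = a * eps) (x \in half_spin b).
Proof.
by apply: (iffP memv_cosetP) => -[a ha ->]; exists a => //; apply/cl_parityP.
Qed.

Lemma half_spin_neq0 b : (0 < n)%N -> exists2 s : Cl, s \in half_spin b & s != 0.
Proof.
move=> n0; have m0 : (0 < m)%N by rewrite muln_gt0.
pose B : {set 'I_m} := if b then [set Ordinal m0] else set0.
exists (cl_basis B * eps).
  apply/half_spinP; exists (cl_basis B) => //.
  have <- : odd #|B| = b by rewrite /B; case: (b); rewrite ?cards1 ?cards0.
  exact: cl_even_basis.
apply/eqP => /cl_basis_mulI/eqP; exact/negP/spinor_idempotent_neq0.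
Qed.

(** A nonzero [t] has some [eps * e_A * t <> 0], which is a multiple of [eps]
    because the idempotent is primitive; the left ideal of [eps] is reached from
    it. Parity shows that even elements suffice. *)
Lemma half_spin_irr b T : cl_subspace T -> (forall t, T t -> t \in half_spin b) ->
  (forall A t, ~~ odd #|A| -> T t -> T (cl_basis A * t)) ->
  (exists2 t, T t & t != 0) -> forall s, s \in half_spin b -> T s.
Proof.
move=> Tsub Tb TA [t Tt t0] s /half_spinP[a' ha' ->].
have [A hA] := spinor_idempotent_sep t0.
have [a ha ta] := half_spinP _ _ (Tb _ Tt).
have [c hc] := spinor_idempotent_primitive (cl_basis A * a).
have tc : eps * (cl_basis A * t) = c *: eps by rewrite ta mulrA mulrA -[eps * _ * a]mulrA.
have c0 : c != 0 by apply: contraNneq hA => c0; rewrite tc c0 scale0r.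
have hAb : odd #|A| = b.
  apply/eqP; apply: contraT => hAb.
  have e1 : cl_even true (c *: eps).
    rewrite -hc; apply: (cl_evenM (b := true) (c := false)) spinor_idempotent_even.
    apply: (cl_evenM (b := false) (c := true)) spinor_idempotent_even _.
    have -> : true = odd #|A| (+) b by move: hAb; case: (odd _); case: (b).
    by apply: cl_evenM => //; exact: cl_even_basis.
  have e0 : cl_even false (c *: eps) by apply: cl_evenZ; exact: spinor_idempotent_even.
  have /eqP := cl_even_disj e1 e0.
  by rewrite scaler_eq0 (negPf c0) (negPf spinor_idempotent_neq0).
pose y := a' * eps * cl_basis A.
have hy : cl_even false y.
  rewrite -[false](addbb b) -{2}hAb; apply: cl_evenM; last exact: cl_even_basis.
  rewrite -[b]addbF; exact: cl_evenM ha' spinor_idempotent_even.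
have -> : a' * eps = c^-1 *: (y * t).
  by rewrite /y -!mulrA tc -scalerAr scalerA mulVf // scale1r.
rewrite (cl_even_expand hy) mulr_suml -[_ *: _]addr0; apply: Tsub.2 (Tsub.1).
under eq_bigr do rewrite -scalerAl.
by apply: cl_subspace_sum => // B /eqP hB; apply: TA => //; rewrite hB.
Qed.

(** The volume element acts on a half-spin space by a scalar, because it
    commutes or anticommutes with each element of given parity. *)
Lemma half_spin_volume b : exists c, forall s : Cl, s \in half_spin b -> cl_basis [set: 'I_m] * s = c *: s.
Proof.
have sw (A : {set 'I_m}) : cl_basis [set: 'I_m] * cl_basis A = (-1) ^+ odd #|A| *: (cl_basis A * cl_basis [set: 'I_m]) :> Cl.
  rewrite cl_basis_swap exchange_big /=; congr (_ *: _).
  rewrite (eq_bigr (fun=> -1)) ?prodr_const ?signr_odd // => j _.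
  have hm : odd m = false by rewrite mul2n odd_double.
  rewrite (eq_bigl xpredT) => [|q]; last by rewrite inE.
  rewrite (bigD1 j) //= eqxx mul1r (eq_bigr (fun=> -1)) => [|q /negPf -> //].
  rewrite prodr_const -signr_odd.
  rewrite cardC1 card_ord.
  by have := leq_ltn_trans (leq0n j) (ltn_ord j); case: (m) hm => // k /= /negbFE ->.
have sweps : cl_basis [set: 'I_m] * eps = eps * cl_basis [set: 'I_m] :> Cl.
  rewrite [eps](cl_even_expand spinor_idempotent_even) mulr_suml mulr_sumr.
  by apply: eq_bigr => A /eqP hA; rewrite -scalerAr sw hA scale1r scalerAl.
have [c hc] := spinor_idempotent_primitive (cl_basis [set: 'I_m]).
have hc' : cl_basis [set: 'I_m] * eps = c *: eps.
  by rewrite -hc -sweps -mulrA spinor_idempotentK.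
exists ((-1) ^+ b * c) => s /half_spinP[a ha ->].
rewrite [a](cl_even_expand ha) mulr_suml mulr_sumr scaler_sumr.
apply: eq_bigr => A /eqP hA; rewrite -scalerAl -scalerAr mulrA sw hA -!scalerAl -mulrA hc'.
by rewrite -scalerAr !scalerA; congr (_ *: _); ring.
Qed.

End Idempotent.

(** * Irreducibility of the spinor space *)

(** Every even subset of [D] is built by adding two elements at a time. *)
Lemma even_set_ind (m : nat) (D : {set 'I_m}) (P : {set 'I_m} -> Prop) :
  P set0 ->
  (forall p q A, p \in D -> q \in D -> p != q -> P A ->
     P (symdiff (symdiff [set p] [set q]) A)) ->
  forall A : {set 'I_m}, A \subset D -> ~~ odd #|A| -> P A.
Proof.
move=> P0 PS A; have [k] := ubnP #|A|; elim: k A => // k IH A; rewrite ltnS => hk AD eA.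
case: (set_0Vmem A) => [-> //|[p pA]].
case: (set_0Vmem (A :\ p)) => [Ap|[q]].
  by move: eA; rewrite (cardsD1 p) pA Ap cards0.
rewrite !inE => /andP[qp qA].
pose B := symdiff (symdiff [set p] [set q]) A.
have -> : A = symdiff (symdiff [set p] [set q]) B by rewrite /B symdiffK.
have BE : B = A :\ p :\ q.
  apply/setP => x; rewrite !inE; case: (eqVneq x p) => [->|_].
    by rewrite pA eq_sym (negPf qp) /=.
  by case: (eqVneq x q) => [->|_]; rewrite ?qA.
have sB : #|A| = #|B|.+2 by rewrite BE (cardsD1 p) pA (cardsD1 q (A :\ p)) !inE qp qA.
apply: PS; rewrite ?(subsetP AD) //; first by rewrite eq_sym.
apply: IH.
- by move: hk; rewrite sB => /ltnW.
- by rewrite BE; apply: subset_trans AD; exact: subset_trans (subsetDl _ _) (subsetDl _ _).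
- by move: eA; rewrite sB /= negbK.
Qed.

Section SpinorInterface.
Context (R : realType) (n : nat) (n0 : (0 < n)%N).
Local Notation m := (2 * n)%N.
Local Notation C := R[i].
Local Notation Cl := ('Cl[R]_m).
Context (S : {vspace Cl}) (hS : basic_spinor S).
Implicit Types (p q : 'I_m) (A B : {set 'I_m}) (T : Cl -> Prop).

Lemma cl_vec_delta p : cl_vec (delta_mx 0 p : 'rV[R]_m) = cl_gen p.
Proof.
rewrite /cl_vec (bigD1 p) //= big1 => [|q qp]; first by rewrite mxE !eqxx scale1r addr0.
by rewrite mxE eqxx (negPf qp) scale0r.
Qed.

Lemma spin_group_pair p q : @spin_group R m (cl_gen p * cl_gen q).
Proof.
exists [:: delta_mx 0 p; delta_mx 0 q]; split => //; last first.
  by rewrite !big_cons big_nil mulr1 !cl_vec_delta.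
have h (j : 'I_m) : \sum_(k < m) (delta_mx 0 j : 'rV[R]_m) 0 k ^+ 2 = 1.
  rewrite (bigD1 j) //= big1 => [|k kj]; first by rewrite mxE !eqxx expr1n addr0.
  by rewrite mxE eqxx (negPf kj) expr0n.
by move=> v; rewrite !inE => /orP[/eqP ->|/eqP ->].
Qed.

Lemma cl_basis_pair p q A a : cl_basis (symdiff (symdiff [set p] [set q]) A) * a =
  (cl_sign (symdiff [set p] [set q]) A * cl_sign [set p] [set q]) *:
     (cl_gen p * cl_gen q * (cl_basis A * a)) :> Cl.
Proof. by rewrite !cl_basis_symdiff -!scalerAl scalerA mulrA. Qed.

Lemma pairs_closed T (D : {set 'I_m}) : cl_subspace T ->
  (forall p q t, p \in D -> q \in D -> p != q -> T t -> T (cl_gen p * cl_gen q * t)) ->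
  forall A t, A \subset D -> ~~ odd #|A| -> T t -> T (cl_basis A * t).
Proof.
move=> Tsub TD A t AD eA Tt; apply: (even_set_ind (D := D) (P := fun A => T (cl_basis A * t))) AD eA.
  by rewrite cl_basis0 mul1r.
move=> p q B pD qD pq TB; rewrite cl_basis_pair -[_ *: _]addr0.
apply: Tsub.2 Tsub.1; exact: TD.
Qed.

Lemma spinor_pair p q a : a \in S -> cl_gen p * cl_gen q * a \in S.
Proof. by move=> aS; apply: hS.1 => //; exact: spin_group_pair. Qed.

Lemma spinor_even A a : ~~ odd #|A| -> a \in S -> cl_basis A * a \in S.
Proof.
move=> eA aS; apply: (@pairs_closed (fun x => x \in S) [set: 'I_m]) => //.
  by split=> [|c x y xS yS]; rewrite ?mem0v // memvD // memvZ.
by move=> p q t _ _ _; exact: spinor_pair.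
Qed.

Lemma spinor_neq0 : exists2 s : Cl, s \in S & s != 0.
Proof.
case: hS => _ [b [f [fS finj _]]]; have [s sb s0] := half_spin_neq0 R b n0.
move: sb; rewrite -fS => /memv_imgP[t tS sE]; exists t => //.
by apply: contraNneq s0 => t0; rewrite sE t0 linear0.
Qed.

(** The equivalence with a half-spin space is given on the group only; it commutes
    with the even basis elements because they are products of pairs of unit
    vectors. *)
Lemma spinor_intertwine (f : 'End(Cl)) :
  (forall s a, spin_group s -> a \in S -> f (s * a) = s * f a) ->
  forall A a, ~~ odd #|A| -> a \in S -> f (cl_basis A * a) = cl_basis A * f a.
Proof.
move=> hf A a eA aS.
suff [] : f (cl_basis A * a) = cl_basis A * f a /\ cl_basis A * a \in S by [].
apply: (even_set_ind (D := [set: 'I_m]) (P := fun A => f (cl_basis A * a) = cl_basis A * f a /\ cl_basis A * a \in S)) eA => //.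
  by rewrite cl_basis0 !mul1r.
move=> p q B _ _ pq [fB BS]; rewrite !cl_basis_pair linearZ /= hf ?fB //; last exact: spin_group_pair.
by split => //; rewrite memvZ //; exact: spinor_pair.
Qed.

(** The rotations that fix the last axis already act irreducibly: the volume
    element acts by a scalar, so an even product of generators that involves the
    last one acts like the complementary product. *)
Lemma spinor_irr T : cl_subspace T -> (forall t, T t -> t \in S) ->
  (forall p q t, (p < m.-1)%N -> (q < m.-1)%N -> p != q -> T t ->
     T (cl_gen p * cl_gen q * t)) ->
  (exists2 t, T t & t != 0) -> forall s, s \in S -> T s.
Proof.
move=> Tsub TS Tpair [t Tt t0].
case: hS => hsp [b [f [fS finj hf]]].
have fA := spinor_intertwine hf.
have m0 : (0 < m)%N by rewrite muln_gt0.
have even_m : odd m = false by rewrite mul2n odd_double.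
have [c hc] := @half_spin_volume R n b.
have vol a : a \in S -> cl_basis [set: 'I_m] * a = c *: a.
  move=> aS; apply: finj.
  - by apply: spinor_even; rewrite // cardsT card_ord even_m.
  - exact: memvZ.
  rewrite fA //; last by rewrite cardsT card_ord even_m.
  by rewrite hc ?linearZ // -fS memv_img.
pose D : {set 'I_m} := [set p : 'I_m | (p < m.-1)%N].
have TD A x : A \subset D -> ~~ odd #|A| -> T x -> T (cl_basis A * x).
  by apply: pairs_closed => // p q y; rewrite !inE; exact: Tpair.
have lt_last : (m.-1 < m)%N by rewrite prednK.
have TA A x : ~~ odd #|A| -> T x -> T (cl_basis A * x).
  move=> eA Tx; case: (boolP (Ordinal lt_last \in A)) => lA; last first.
    apply: TD => //; apply/subsetP => p pA; rewrite inE ltn_neqAle -ltnS prednK // ltn_ord andbT.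
    by apply: contraNneq lA => pl; rewrite (_ : Ordinal _ = p) //; apply: val_inj.
  have -> : A = symdiff (~: A) [set: 'I_m] by apply/setP => y; rewrite !inE addbT negbK.
  rewrite cl_basis_symdiff -scalerAl -mulrA vol; last exact: TS.
  rewrite -scalerAr scalerA -[_ *: _]addr0; apply: Tsub.2 Tsub.1; apply: TD => //.
    apply/subsetP => p; rewrite !inE => pA; rewrite ltn_neqAle -ltnS prednK // ltn_ord andbT.
    by apply: contraNneq pA => pl; rewrite (_ : p = Ordinal lt_last) //; apply: val_inj.
  by have := cardsC A; rewrite card_ord => /(congr1 odd); rewrite oddD even_m (negPf eA) => /= ->.
move=> s sS.
have [] := @half_spin_irr R n b (fun y => exists2 x, T x & y = f x) _ _ _ _ (f s).
- split; first by exists 0; [exact: Tsub.1 | rewrite linear0].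
  by move=> k _ _ [x Tx ->] [y Ty ->]; exists (k *: x + y); [exact: Tsub.2 | rewrite linearP].
- by move=> _ [x Tx ->]; rewrite -fS memv_img // TS.
- by move=> A _ eA [x Tx ->]; exists (cl_basis A * x); [exact: TA | rewrite fA // TS].
- exists (f t); first by exists t.
  apply: contraNneq t0 => ft; apply/eqP/finj; rewrite ?mem0v ?TS //.
  by rewrite ft linear0.
- by rewrite -fS memv_img.
by move=> x Tx /finj -> //; exact: TS.
Qed.

End SpinorInterface.

(** * Derivatives of curves *)

Section CDerive.
Context {R : realType}.
Local Notation C := R[i].

Lemma rderive_eq (f g : R -> R) d d' : is_derive (0 : R) 1 f d -> f =1 g -> d = d' ->
  is_derive (0 : R) 1 g d'.
Proof. by move=> h /boolp.funext <- <-. Qed.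

Lemma cderive_ext (f g : R -> C) d : f =1 g -> is_cderive0 f d -> is_cderive0 g d.
Proof. by move=> fg [h1 h2]; split; [apply: rderive_eq h1 _ _ | apply: rderive_eq h2 _ _] => // t; rewrite fg. Qed.

Lemma cderive_unique (f : R -> C) d d' : is_cderive0 f d -> is_cderive0 f d' -> d = d'.
Proof.
case=> h1 h2 [h3 h4]; apply/eqP; rewrite eq_complex.
by rewrite -(derive_val (is_derive := h1)) -(derive_val (is_derive := h2))
  -(derive_val (is_derive := h3)) -(derive_val (is_derive := h4)) !eqxx.
Qed.

Lemma cderive_cst (c : C) : is_cderive0 (fun=> c) 0.
Proof. by split; exact: is_derive_cst. Qed.

Lemma cderiveD (f g : R -> C) d d' : is_cderive0 f d -> is_cderive0 g d' ->
  is_cderive0 (fun t => f t + g t) (d + d').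
Proof.
case=> h1 h2 [h3 h4]; split.
  apply: rderive_eq (is_deriveD h1 h3) _ _; last by case: (d); case: (d').
  by move=> t /=; rewrite /GRing.add /=; case: (f t); case: (g t).
apply: rderive_eq (is_deriveD h2 h4) _ _; last by case: (d); case: (d').
by move=> t /=; rewrite /GRing.add /=; case: (f t); case: (g t).
Qed.

Lemma cderiveM (f g : R -> C) d d' : is_cderive0 f d -> is_cderive0 g d' ->
  is_cderive0 (fun t => f t * g t) (d * g 0 + f 0 * d').
Proof.
case=> h1 h2 [h3 h4]; split.
  apply: rderive_eq (is_deriveB (is_deriveM h1 h3) (is_deriveM h2 h4)) _ _.
    move=> t; change (complex.Re (f t) * complex.Re (g t) - complex.Im (f t) * complex.Im (g t) = complex.Re (f t * g t)).
    by case: (f t) (g t) => ? ? [? ?].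
  rewrite /GRing.scale /=.
  by case: (d) (d') (f 0) (g 0) => ? ? [? ?] [? ?] [? ?] /=; ring.
apply: rderive_eq (is_deriveD (is_deriveM h1 h4) (is_deriveM h2 h3)) _ _.
  move=> t; change (complex.Re (f t) * complex.Im (g t) + complex.Im (f t) * complex.Re (g t) = complex.Im (f t * g t)).
  by case: (f t) (g t) => ? ? [? ?] /=.
rewrite /GRing.scale /=.
by case: (d) (d') (f 0) (g 0) => ? ? [? ?] [? ?] [? ?] /=; ring.
Qed.

Lemma cderiveZ (f : R -> C) d (c : C) : is_cderive0 f d -> is_cderive0 (fun t => c * f t) (c * d).
Proof. by move=> h; have := cderiveM (cderive_cst c) h; rewrite mul0r add0r. Qed.

Lemma cderive_sum (I : Type) (r : seq I) (P : pred I) (f : I -> R -> C) (d : I -> C) :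
  (forall i, P i -> is_cderive0 (f i) (d i)) ->
  is_cderive0 (fun t => \sum_(i <- r | P i) f i t) (\sum_(i <- r | P i) d i).
Proof.
move=> h; elim: r => [|i r IH].
  rewrite big_nil; apply: cderive_ext (cderive_cst 0) => t; by rewrite big_nil.
rewrite big_cons; case Pi: (P i); last by apply: cderive_ext IH => t; rewrite big_cons Pi.
apply: cderive_ext (cderiveD (h i Pi) IH) => t; by rewrite big_cons Pi.
Qed.

Lemma cderive_real (f : R -> R) (d : R) : is_derive (0 : R) 1 f d ->
  is_cderive0 (fun t => (f t)%:C%C) d%:C%C.
Proof. by move=> h; split => //=; exact: is_derive_cst. Qed.

Context {m : nat}.
Local Notation Cl := ('Cl[R]_m).
Local Notation CP := {mpoly Cl[m]}.

Definition is_clderive0 (g : R -> Cl) (w : Cl) := forall A, is_cderive0 (fun t => g t A) (w A).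

Lemma clderive_ext (f g : R -> Cl) d : f =1 g -> is_clderive0 f d -> is_clderive0 g d.
Proof. by move=> fg h A; apply: cderive_ext (h A) => t; rewrite fg. Qed.

Lemma clderive_cst c : is_clderive0 (fun=> c) 0.
Proof. by move=> A; rewrite cl_zeroE; exact: cderive_cst. Qed.

Lemma clderiveD f g d d' : is_clderive0 f d -> is_clderive0 g d' ->
  is_clderive0 (fun t => f t + g t) (d + d').
Proof.
move=> h h' A; rewrite cl_addE; apply: cderive_ext (cderiveD (h A) (h' A)) => t.
by rewrite cl_addE.
Qed.

Lemma clderiveM f g d d' : is_clderive0 f d -> is_clderive0 g d' ->
  is_clderive0 (fun t => f t * g t) (d * g 0 + f 0 * d').
Proof.
move=> h h' A.
have {h h'}h B : is_cderive0 (fun t => cl_sign B (symdiff B A) * (f t B * g t (symdiff B A)))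
    (cl_sign B (symdiff B A) * (d B * g 0 (symdiff B A)) + cl_sign B (symdiff B A) * (f 0 B * d' (symdiff B A))).
  by rewrite -mulrDr; apply: cderiveZ; exact: cderiveM.
have := cderive_sum (index_enum _) (fun B (_ : xpredT B) => h B).
rewrite big_split cl_addE !ffunE; apply: cderive_ext => t; by rewrite ffunE.
Qed.

Lemma clderive_alg (f : R -> C) d (a : Cl) : is_cderive0 f d -> is_clderive0 (fun t => f t *: a) (d *: a).
Proof.
move=> h A; rewrite cl_scaleE mulrC; apply: cderive_ext (cderiveZ (a A) h) => t.
by rewrite cl_scaleE mulrC.
Qed.

Lemma clderive_sum (I : Type) (r : seq I) (P : pred I) (f : I -> R -> Cl) (d : I -> Cl) :
  (forall i, P i -> is_clderive0 (f i) (d i)) ->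
  is_clderive0 (fun t => \sum_(i <- r | P i) f i t) (\sum_(i <- r | P i) d i).
Proof.
move=> h A; rewrite cl_sumE; apply: cderive_ext (cderive_sum (r) (fun i Pi => h i Pi A)) => t.
by rewrite cl_sumE.
Qed.

(** The factors that are not differentiated take the value 1. *)
Lemma clderive_prod1 (I : Type) (r : seq I) (P : pred I) (f : I -> R -> Cl) (d : I -> Cl) :
  (forall i, P i -> is_clderive0 (f i) (d i)) -> (forall i, P i -> f i 0 = 1) ->
  is_clderive0 (fun t => \prod_(i <- r | P i) f i t) (\sum_(i <- r | P i) d i).
Proof.
move=> h h1; elim: r => [|i r IH].
  rewrite big_nil; apply: clderive_ext (clderive_cst 1) => t; by rewrite big_nil.
rewrite big_cons; case Pi: (P i); last by apply: clderive_ext IH => t; rewrite big_cons Pi.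
have := clderiveM (h i Pi) IH; rewrite h1 // big1 // mulr1 mul1r.
by apply: clderive_ext => t; rewrite big_cons Pi.
Qed.

End CDerive.

(** Leibniz calculus for polynomial-valued curves, coefficient by coefficient,
    over any ring whose curves have a derivative obeying the product rule. *)
Section PolynomialCurves.
Context (T : Type) (t0 : T) (A : nzRingType) (m : nat) (dr : (T -> A) -> A -> Prop).
Context (dr_ext : forall f g d, f =1 g -> dr f d -> dr g d).
Context (dr_cst : forall c, dr (fun=> c) 0).
Context (dr_sum : forall (I : Type) (r : seq I) (P : pred I) (f : I -> T -> A) (d : I -> A),
  (forall i, P i -> dr (f i) (d i)) ->
  dr (fun t => \sum_(i <- r | P i) f i t) (\sum_(i <- r | P i) d i)).
Context (drM : forall f g d d', dr f d -> dr g d' ->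
  dr (fun t => f t * g t) (d * g t0 + f t0 * d')).
Local Notation CP := {mpoly A[m]}.
Arguments dr_ext {f g d}.
Arguments drM {f g d d'}.
Arguments dr_sum {I} r {P f d}.

Definition is_mpderive (f : T -> CP) (d : CP) := forall mon, dr (fun t => (f t)@_mon) (d@_mon).

Lemma mpderive_ext f g d : f =1 g -> is_mpderive f d -> is_mpderive g d.
Proof. by move=> fg h mon; apply: dr_ext (h mon) => t; rewrite fg. Qed.

Lemma mpderive_cst c : is_mpderive (fun=> c) 0.
Proof. by move=> mon; rewrite mcoeff0; exact: dr_cst. Qed.

Lemma mpderive_sum (I : Type) (r : seq I) (P : pred I) (f : I -> T -> CP) (d : I -> CP) :
  (forall i, P i -> is_mpderive (f i) (d i)) ->
  is_mpderive (fun t => \sum_(i <- r | P i) f i t) (\sum_(i <- r | P i) d i).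
Proof.
move=> h mon; rewrite raddf_sum; apply: dr_ext (dr_sum r (fun i Pi => h i Pi mon)) => t.
by rewrite raddf_sum.
Qed.

Lemma mpderiveM f g d d' : is_mpderive f d -> is_mpderive g d' ->
  is_mpderive (fun t => f t * g t) (d * g t0 + f t0 * d').
Proof.
move=> h h' mon.
rewrite mcoeffD !mcoeffM -big_split /=.
have hk (k : 'X_{1..m < (mdeg mon).+1, (mdeg mon).+1}) : dr (fun t => (f t)@_k.1 * (g t)@_k.2)
  (d@_k.1 * (g t0)@_k.2 + (f t0)@_k.1 * d'@_k.2) by exact: drM.
have := dr_sum (index_enum _) (P := fun k : 'X_{1..m < (mdeg mon).+1, (mdeg mon).+1} => mon == (k.1 + k.2)%MM)
  (fun k _ => hk k).
by apply: dr_ext => t; rewrite mcoeffM.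
Qed.

Lemma mpderiveC f d : dr f d -> is_mpderive (fun t => (f t)%:MP) d%:MP.
Proof.
move=> h mon; rewrite mcoeffC; have := drM h (dr_cst (mon == 0%MM)%:R).
by rewrite mulr0 addr0; apply: dr_ext => t; rewrite mcoeffC.
Qed.

Lemma mpderiveZ f d c : is_mpderive f d -> is_mpderive (fun t => c *: f t) (c *: d).
Proof.
move=> h; have := mpderiveM (mpderive_cst c%:MP) h; rewrite mul0r add0r mul_mpolyC.
by apply: mpderive_ext => t; rewrite mul_mpolyC.
Qed.

Lemma mpderiveCX f d Q : dr f d -> is_mpderive (fun t => f t *: Q) (d *: Q).
Proof.
move=> h; have := mpderiveM (mpderiveC h) (mpderive_cst Q).
by rewrite mulr0 addr0 mul_mpolyC; apply: mpderive_ext => t; rewrite mul_mpolyC.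
Qed.

Lemma mpderive_act f d F D : f t0 = 1 -> dr f d -> is_mpderive F D ->
  is_mpderive (fun t => (f t)%:MP * F t) (d *: F t0 + D).
Proof.
by move=> f0 h hF; have := mpderiveM (mpderiveC h) hF; rewrite f0 mpolyC1 mul1r mul_mpolyC.
Qed.

(** [xi i] is the derivative at 0 of a curve of variables through ['X_i]. *)
Lemma mpderive_comp (f : T -> 'I_m -> CP) (xi : 'I_m -> CP) P :
  (forall i, f t0 i = 'X_i) -> (forall i, is_mpderive (fun t => f t i) (xi i)) ->
  (forall i Q, GRing.comm (xi i) Q) ->
  is_mpderive (fun t => P \mPo [tuple f t i | i < m]) (\sum_i xi i * P^`M(i)).
Proof.
move=> f0 hf cx; pose del (Q : CP) := \sum_i xi i * Q^`M(i).
have delM Q Q' : del (Q * Q') = del Q * Q' + Q * del Q'.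
  rewrite /del mulr_suml mulr_sumr -big_split; apply: eq_bigr => i _ /=.
  by rewrite mderivM mulrDr mulrA; congr (_ + _); rewrite !mulrA cx.
have delX i : del 'X_i = xi i.
  rewrite /del (bigD1 i) //= big1 => [|j ji]; rewrite mderivX mnm1E.
    by rewrite eqxx scale1r -{1}[U_(i)%MM]add0m addmK mpolyX0 mulr1 addr0.
  by rewrite eq_sym (negPf ji) scale0r mulr0.
have del1 : del 1 = 0 by rewrite /del big1 // => i _; rewrite -mpolyC1 mderivC mulr0.
have hXn i k : is_mpderive (fun t => f t i ^+ k) (del ('X_i ^+ k)).
  elim: k => [|k IH]; first by rewrite expr0 del1; exact: mpderive_cst.
  have := mpderiveM (hf i) IH; rewrite f0 -delX -delM -exprS.
  by apply: mpderive_ext => t; rewrite exprS.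
have hprod (r : seq 'I_m) (mon : 'X_{1..m}) :
    is_mpderive (fun t => \prod_(i <- r) f t i ^+ mon i) (del (\prod_(i <- r) 'X_i ^+ mon i)).
  elim: r => [|i r IH].
    by rewrite big_nil del1; apply: mpderive_ext (mpderive_cst 1) => t; rewrite big_nil.
  have := mpderiveM (hXn i (mon i)) IH; rewrite f0.
  under eq_bigr do rewrite f0.
  by rewrite -delM big_cons; apply: mpderive_ext => t; rewrite big_cons.
have -> : \sum_i xi i * P^`M(i) = \sum_(mon <- msupp P) P@_mon *: del 'X_[mon].
  rewrite {1}[P]mpolyE /del; under [RHS]eq_bigr do rewrite scaler_sumr.
  rewrite exchange_big /=; apply: eq_bigr => i _; rewrite raddf_sum mulr_sumr.
  apply: eq_bigr => mon _ /=; rewrite mderivZ -!mul_mpolyC !mulrA; congr (_ * _).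
  exact: cx.
have h mon : is_mpderive (fun t => P@_mon *: \prod_(i < m) f t i ^+ mon i) (P@_mon *: del 'X_[mon]).
  apply: mpderiveZ; rewrite mpolyXE_id; exact: hprod.
apply: mpderive_ext (mpderive_sum (msupp P) (fun mon (_ : xpredT mon) => h mon)) => t.
rewrite comp_mpolyEX; apply: eq_bigr => mon _; rewrite comp_mpolyX; congr (_ *: _).
by apply: eq_bigr => i _; rewrite tnth_mktuple.
Qed.

Lemma mpderive_subst (s : T -> A) d (f : T -> 'I_m -> CP) (xi : 'I_m -> CP) P :
  s t0 = 1 -> dr s d ->
  (forall i, f t0 i = 'X_i) -> (forall i, is_mpderive (fun t => f t i) (xi i)) ->
  (forall i Q, GRing.comm (xi i) Q) ->
  is_mpderive (fun t => (s t)%:MP * (P \mPo [tuple f t i | i < m])) (d *: P + \sum_i xi i * P^`M(i)).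
Proof.
move=> s0 ds f0 hf cx; have := mpderive_act s0 ds (mpderive_comp P f0 hf cx).
have -> : [tuple f t0 i | i < m] = [tuple 'X_i | i < m].
  by apply: eq_from_tnth => i; rewrite !tnth_mktuple.
by rewrite comp_mpoly_id.
Qed.

End PolynomialCurves.

(** * Curves in the spin group *)

Section CliffordConj.
Context {K : fieldType} {m : nat}.
Local Notation Cl := (clifford K m).
Implicit Types (a b : Cl) (A B : {set 'I_m}).

(** The Clifford conjugation: it inverts each basis element, and hence each
    element of the spin group. *)
Definition cl_conj a : Cl := [ffun A => cl_sign A A * a A].

Lemma cl_conjE a A : cl_conj a A = cl_sign A A * a A.
Proof. by rewrite ffunE. Qed.

Lemma cl_conjM a b : cl_conj (a * b) = cl_conj b * cl_conj a.
Proof.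
have key A B : cl_sign (symdiff A B) (symdiff A B) * (cl_sign A B * (a A * b B)) =
    cl_sign B A * ((cl_sign B B * b B) * (cl_sign A A * a A)) :> K.
  rewrite !(cl_sign_symdiffl, cl_sign_symdiffr).
  transitivity ((cl_sign A B * cl_sign A B) * (cl_sign A A * cl_sign B A * cl_sign B B * (a A * b B)) : K); first ring.
  by rewrite cl_sign_sqr; ring.
apply/ffunP => D; rewrite cl_conjE !ffunE mulr_sumr.
have bij : {on predT, bijective (fun A => symdiff A D)}.
  by exists (fun A => symdiff A D) => A _; rewrite -symdiffA symdiffss symdiffs0.
rewrite [RHS](reindex _ bij) /=; apply: eq_bigr => A _.
have -> : symdiff (symdiff A D) D = A by rewrite -symdiffA symdiffss symdiffs0.
by rewrite !cl_conjE -key symdiffK.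
Qed.

Lemma cl_conj1 : cl_conj 1 = 1.
Proof.
apply/ffunP => A; rewrite cl_conjE -cl_basis0 cl_basisE; case: (eqVneq A set0) => [->|_].
  by rewrite cl_sign0s mulr1.
by rewrite mulr0.
Qed.

Lemma cl_conjD a b : cl_conj (a + b) = cl_conj a + cl_conj b.
Proof. by apply/ffunP => A; rewrite cl_addE !cl_conjE cl_addE mulrDr. Qed.

Lemma cl_conjZ k a : cl_conj (k *: a) = k *: cl_conj a.
Proof. by apply/ffunP => A; rewrite cl_scaleE !cl_conjE cl_scaleE mulrCA. Qed.

Lemma cl_conj0 : cl_conj 0 = 0.
Proof. by apply/ffunP => A; rewrite cl_conjE cl_zeroE mulr0. Qed.

Lemma cl_conj_sum (I : Type) (r : seq I) (P : pred I) (F : I -> Cl) :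
  cl_conj (\sum_(i <- r | P i) F i) = \sum_(i <- r | P i) cl_conj (F i).
Proof. exact: (big_morph _ cl_conjD cl_conj0). Qed.

Lemma cl_conj_gen i : cl_conj (cl_gen i) = - cl_gen i.
Proof.
apply/ffunP => A; rewrite cl_oppE cl_conjE cl_basisE; case: (eqVneq A [set i]) => [->|_].
  by rewrite cl_sign1 leqnn mulN1r.
by rewrite mulr0 oppr0.
Qed.

(** The square of a vector is minus the sum of the squares of its coordinates: the
    generators anticommute. *)
Lemma cl_comb_sqr (c : 'I_m -> K) (r : seq 'I_m) : uniq r ->
  (\sum_(i <- r) c i *: cl_gen i) * (\sum_(i <- r) c i *: cl_gen i) =
  - (\sum_(i <- r) c i ^+ 2)%:A :> Cl.
Proof.
elim: r => [|i r IH] /=; first by rewrite !big_nil mul0r scale0r oppr0.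
case/andP=> ir /IH {}IH; rewrite !big_cons; set s := \sum_(j <- r) c j *: cl_gen j in IH *.
have anti : cl_gen i * s = - (s * cl_gen i).
  rewrite /s mulr_sumr mulr_suml -sumrN big_seq [RHS]big_seq; apply: eq_bigr => j jr.
  rewrite -scalerAr -scalerAl cl_gen_anticomm ?scalerN //.
  by apply: contraNneq ir => ->.
rewrite mulrDl !mulrDr IH -!scalerAl -!scalerAr anti cl_gen_sqr !scalerN [in RHS]scalerDl.
by rewrite scalerA -expr2 addrA addrNK opprD.
Qed.

End CliffordConj.

Section SpinInverse.
Context {R : realType} {m : nat}.
Local Notation C := R[i].
Local Notation Cl := ('Cl[R]_m).

Lemma cl_vec_sqr (v : 'rV[R]_m) : cl_vec v * cl_vec v = - (\sum_(i < m) v 0 i ^+ 2)%:C%C%:A.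
Proof.
have E : (\sum_(i < m) v 0 i ^+ 2)%:C%C = \sum_(i < m) (v 0 i)%:C%C ^+ 2 :> C.
  by rewrite rmorph_sum /=; apply: eq_bigr => i _; rewrite rmorphXn.
rewrite E; exact: cl_comb_sqr (index_enum_uniq _).
Qed.

Lemma cl_conj_vec (v : 'rV[R]_m) : cl_conj (cl_vec v) = - cl_vec v.
Proof.
rewrite /cl_vec cl_conj_sum -sumrN; apply: eq_bigr => i _.
by rewrite cl_conjZ cl_conj_gen scalerN.
Qed.

Lemma spin_groupV (s : Cl) : spin_group s -> s^-1 = cl_conj s.
Proof.
case=> vs [_ hvs sE].
have [h1 h2] : s * cl_conj s = 1 /\ cl_conj s * s = 1.
  rewrite {s}sE; elim: vs hvs => [|v vs IH] hvs; first by rewrite big_nil cl_conj1 mulr1.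
  rewrite big_cons cl_conjM; set s := \prod_(_ <- _) _ in IH *.
  have [|h1 h2] := IH; first by move=> w wvs; apply: hvs; rewrite inE wvs orbT.
  have hv : cl_vec v * cl_conj (cl_vec v) = 1 /\ cl_conj (cl_vec v) * cl_vec v = 1.
    by rewrite cl_conj_vec mulrN mulNr cl_vec_sqr opprK hvs ?inE ?eqxx // rmorph1 scale1r.
  split; first by rewrite mulrA -[_ * s * _]mulrA h1 mulr1 hv.1.
  by rewrite mulrA -[_ * _ * cl_vec v]mulrA hv.2 mulr1 h2.
have us : s \is a GRing.unit by apply/unitrP; exists (cl_conj s).
by rewrite -[LHS]mulr1 -h1 mulKr.
Qed.

Lemma spin_group1 : spin_group (1 : Cl).
Proof. by exists [::]; split => //; rewrite big_nil. Qed.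

Lemma spin_groupM (s t : Cl) : spin_group s -> spin_group t -> spin_group (s * t).
Proof.
case=> vs [e1 h1 ->] [ws [e2 h2 ->]]; exists (vs ++ ws); split.
- by rewrite size_cat oddD (negPf e1) (negPf e2).
- by move=> v; rewrite mem_cat => /orP[/h1|/h2].
by rewrite big_cat.
Qed.

Lemma spin_group_prod (I : Type) (r : seq I) (P : pred I) (F : I -> Cl) :
  (forall i, P i -> spin_group (F i)) -> spin_group (\prod_(i <- r | P i) F i).
Proof.
by move=> h; elim/big_rec: _ => [|i x Pi hx]; [exact: spin_group1 | apply: spin_groupM => //; exact: h].
Qed.

(** It is the product of the unit vectors [e_i] and [- cos u e_i + sin u e_j]. *)
Lemma spin_group_rotation (i j : 'I_m) (u : R) : i != j ->
  spin_group ((cos u)%:C%C%:A + (sin u)%:C%C *: (cl_gen i * cl_gen j) : Cl).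
Proof.
move=> ij; exists [:: delta_mx 0 i; - cos u *: delta_mx 0 i + sin u *: delta_mx 0 j]; split => //.
- have ee (a b : R) : \sum_(k < m) (a *: delta_mx 0 i + b *: delta_mx 0 j : 'rV[R]_m) 0 k ^+ 2 = a ^+ 2 + b ^+ 2.
    rewrite (bigD1 i) //= (bigD1 j) 1?eq_sym //= big1 => [|k /andP[ki kj]].
      by rewrite !mxE !eqxx /= ![j == i]eq_sym !(negPf ij) /=; ring.
    by rewrite !mxE !eqxx (negPf ki) (negPf kj) /=; ring.
  move=> v; rewrite !inE => /orP[] /eqP ->.
    by have := ee 1 0; rewrite scale1r scale0r addr0 => ->; ring.
  by rewrite ee sqrrN cos2Dsin2.
have vD (v w : 'rV[R]_m) (a b : R) : cl_vec (a *: v + b *: w) = a%:C%C *: cl_vec v + b%:C%C *: cl_vec w.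
  rewrite /cl_vec !scaler_sumr -big_split; apply: eq_bigr => k _ /=.
  by rewrite !mxE rmorphD !rmorphM /= scalerDl !scalerA.
have vd k : cl_vec (delta_mx 0 k : 'rV[R]_m) = cl_gen k.
  rewrite /cl_vec (bigD1 k) //= big1 => [|q qp]; first by rewrite mxE !eqxx scale1r addr0.
  by rewrite mxE eqxx (negPf qp) scale0r.
rewrite !big_cons big_nil mulr1 vD !vd mulrDr -!scalerAr cl_gen_sqr.
by rewrite rmorphN scalerN scaleNr opprK.
Qed.

(** A product of plane rotations through 1 has the sum of their generators as its
    tangent. Such a curve is what makes the derivative of the action unique. *)
Lemma so_tangent l (w : Cl) : so_algebra l w -> exists g : R -> Cl,
  [/\ forall t, spin_group (g t), g 0 = 1 & is_clderive0 g w].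
Proof.
case=> a ->; rewrite pair_big_dep /=.
exists (fun t => \prod_(p : 'I_m * 'I_m | (p.1 < p.2 < l)%N)
  ((cos (t * a p.1 p.2))%:C%C%:A + (sin (t * a p.1 p.2))%:C%C *: (cl_gen p.1 * cl_gen p.2))).
have f0 (p : 'I_m * 'I_m) : (cos (0 * a p.1 p.2))%:C%C%:A + (sin (0 * a p.1 p.2))%:C%C *: (cl_gen p.1 * cl_gen p.2) = 1 :> Cl.
  by rewrite mul0r cos0 sin0 scale0r addr0 scale1r.
split.
- move=> t; apply: spin_group_prod => p /andP[p12 _]; apply: spin_group_rotation.
  by rewrite -(inj_eq val_inj) /= neq_ltn p12.
- by rewrite big1 // => p _; exact: f0.
apply: clderive_prod1 => [p _|p _]; last exact: f0.
set x := a p.1 p.2.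
have hx : is_derive (0 : R) 1 (fun t : R => t * x) x.
  have := @is_deriveM R R (fun t => t) (fun=> x) 0 1 _ _ (is_derive_id _ _) (is_derive_cst _ _ _).
  by move=> h; apply: rderive_eq h _ _ => //; rewrite /GRing.scale /= mulr0 add0r mulr1.
rewrite -[_ *: _]add0r -[X in X + _](scale0r 1); apply: clderiveD; apply: clderive_alg.
  have hc : is_derive (0 : R) 1 (fun t : R => cos (t * x)) 0.
    apply: (rderive_eq (@is_derive1_comp _ cos (fun t => t * x) 0 _ _ (is_derive_cos (0 * x)) hx)) => //.
    by rewrite mul0r sin0 oppr0 mul0r.
  exact: (cderive_real hc).
have hs : is_derive (0 : R) 1 (fun t : R => sin (t * x)) x.
  apply: (rderive_eq (@is_derive1_comp _ sin (fun t => t * x) 0 _ _ (is_derive_sin (0 * x)) hx)) => //.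
  by rewrite mul0r cos0 mul1r.
exact: (cderive_real hs).
Qed.

Lemma clderive_conj (g : R -> Cl) w : is_clderive0 g w -> is_clderive0 (fun t => cl_conj (g t)) (cl_conj w).
Proof.
move=> h A; rewrite cl_conjE; apply: cderive_ext (cderiveZ _ (h A)) => t.
by rewrite cl_conjE.
Qed.

Lemma cl_conj_so l (w : Cl) : so_algebra l w -> cl_conj w = - w.
Proof.
case=> a ->; rewrite cl_conj_sum -sumrN; apply: eq_bigr => i _; rewrite cl_conj_sum -sumrN.
apply: eq_bigr => j /andP[ij _]; rewrite cl_conjZ cl_conjM !cl_conj_gen mulrNN cl_gen_anticomm ?scalerN ?opprK //.
by rewrite -(inj_eq val_inj) /= neq_ltn ij .
Qed.

End SpinInverse.

(** * The action of so(m) on polynomials *)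

(** The commutator with [e_p e_q] is twice the rotation of the plane of [p] and
    [q]: conjugation by a spin element turns vectors by twice its angle. *)
Lemma cl_comm_pair (K : fieldType) m (i p q : 'I_m) : p != q ->
  cl_gen i * (cl_gen p * cl_gen q) - (cl_gen p * cl_gen q) * cl_gen i =
  ((i == q)%:R *: cl_gen p - (i == p)%:R *: cl_gen q) *+ 2 :> clifford K m.
Proof.
move=> pq; case: (eqVneq i p) => [->|ip].
  rewrite (negPf pq) scale0r sub0r scale1r mulrA cl_gen_sqr -mulrA [cl_gen q * _]cl_gen_anticomm 1?eq_sym //.
  by rewrite mulrN mulrA cl_gen_sqr opprK !mulN1r mulr2n.
case: (eqVneq i q) => [->|iq].
  rewrite scale0r subr0 scale1r -mulrA cl_gen_sqr mulrA [cl_gen q * _]cl_gen_anticomm 1?eq_sym //.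
  by rewrite mulNr -mulrA cl_gen_sqr !mulrN1 !opprK mulr2n.
rewrite !scale0r subr0 mul0rn [X in X - _]mulrA [cl_gen i * cl_gen p]cl_gen_anticomm // mulNr -mulrA.
by rewrite -!mulrA [cl_gen i * cl_gen q]cl_gen_anticomm // mulrN opprK subrr.
Qed.

Lemma cl_comm_pair_coef (K : fieldType) m (i j p q : 'I_m) : p != q ->
  (cl_gen i * (cl_gen p * cl_gen q) - (cl_gen p * cl_gen q) * cl_gen i : clifford K m) [set j] =
  ((i == q)%:R * (j == p)%:R - (i == p)%:R * (j == q)%:R) *+ 2.
Proof.
move=> pq; rewrite cl_comm_pair // mulr2n [RHS]mulr2n [LHS]cl_addE.
by rewrite [X in X + X]cl_addE cl_oppE !cl_scaleE !cl_basisE !(inj_eq set1_inj).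
Qed.

Lemma cl_comm_coefP (K : fieldType) m (k : K) (a x w : clifford K m) A :
  (a * (k *: x + w) - (k *: x + w) * a) A = k * (a * x - x * a) A + (a * w - w * a) A.
Proof.
rewrite -cl_scaleE -cl_addE; congr (fun_of_fin _ A).
by rewrite mulrDr mulrDl -scalerAr -scalerAl scalerBr opprD addrACA.
Qed.

Section CentralCoefficients.
Context (A : nzRingType) (n : nat).
Implicit Types (Q : {mpoly A[n]}).

Lemma mpolyC_comm (c : A) Q : (forall a, c * a = a * c) -> c%:MP * Q = Q * c%:MP.
Proof.
move=> hc; elim/mpolyind: Q => [|a mon Q _ _ IH]; first by rewrite mulr0 mul0r.
rewrite mulrDr mulrDl IH; congr (_ + _).
rewrite -mul_mpolyC mulrA -mpolyCM hc mpolyCM -!mulrA; congr (_ * _).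
by rewrite commr_mpolyX.
Qed.

Lemma mpolyX_comm i Q : 'X_i * Q = Q * 'X_i.
Proof. by rewrite commr_mpolyX. Qed.

Lemma mulXZ i (a : A) Q : 'X_i * (a *: Q) = a *: ('X_i * Q).
Proof. by rewrite -!mul_mpolyC !mulrA mpolyX_comm. Qed.

Lemma scaleX_comm (c : A) i Q : (forall a, c * a = a * c) -> GRing.comm (c *: 'X_i) Q.
Proof.
move=> hc; rewrite /GRing.comm -mul_mpolyC [RHS]mulrA -(mpolyC_comm Q hc) -!mulrA.
by rewrite mpolyX_comm.
Qed.

End CentralCoefficients.

Section FlowAlgebra.
Context (K : comNzRingType) (A : algType K) (n : nat).
Implicit Types (P Q : {mpoly A[n]}) (w : A) (c : 'I_n -> 'I_n -> K).

Lemma alg_comm (k : K) (a : A) : k%:A * a = a * k%:A.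
Proof. by rewrite -scalerAl -scalerAr mul1r mulr1. Qed.

Definition flow c j : {mpoly A[n]} := \sum_(i < n) (c i j)%:A *: 'X_i.

Lemma flow_comm c j Q : GRing.comm (flow c j) Q.
Proof.
rewrite /flow; elim/big_ind: _ => [|x y hx hy|i _]; first by rewrite /GRing.comm mul0r mulr0.
  by rewrite /GRing.comm mulrDl mulrDr hx hy.
by apply: scaleX_comm => a; exact: alg_comm.
Qed.

(** The infinitesimal action of a curve of the spin group with tangent [w], when
    [c] is the tangent of the matrix by which it moves the coordinates. *)
Definition flow_diff w c P : {mpoly A[n]} := w *: P + \sum_(j < n) flow c j * P^`M(j).

Lemma flow_diff_ext w w' c c' P : w = w' -> c =2 c' -> flow_diff w c P = flow_diff w' c' P.
Proof.
move=> -> h; congr (_ + _); apply: eq_bigr => j _; congr (_ * _).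
by apply: eq_bigr => i _; rewrite h.
Qed.

Lemma flow_diff0 P : flow_diff 0 (fun _ _ => 0) P = 0.
Proof.
rewrite /flow_diff scale0r add0r big1 // => j _; rewrite /flow big1 ?mul0r // => i _.
by rewrite !scale0r.
Qed.

Lemma flow_diffP k w c w' c' P : flow_diff (k *: w + w') (fun i j => k * c i j + c' i j) P =
  k%:A *: flow_diff w c P + flow_diff w' c' P.
Proof.
rewrite /flow_diff scalerDl scalerDr addrACA scalerA -scalerAl mul1r; congr (_ + _).
rewrite scaler_sumr -big_split; apply: eq_bigr => j _ /=.
rewrite scalerAl -mulrDl; congr (_ * _); rewrite /flow scaler_sumr -big_split; apply: eq_bigr => i _ /=.
by rewrite scalerA -scalerDl -scalerAl mul1r scalerA -scalerDl.
Qed.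

Lemma flow_diff_pair w p q P : flow_diff w (fun i j => ((i == q)%:R * (j == p)%:R - (i == p)%:R * (j == q)%:R) *+ 2) P =
  w *: P + ('X_q * P^`M(p) - 'X_p * P^`M(q)) *+ 2.
Proof.
rewrite /flow_diff; congr (_ + _).
have fE j : flow (fun i j => ((i == q)%:R * (j == p)%:R - (i == p)%:R * (j == q)%:R) *+ 2) j =
    ((j == p)%:R *: 'X_q - (j == q)%:R *: 'X_p) *+ 2.
  have sE r (b : bool) : \sum_(i < n) ((i == r)%:R * b%:R : K)%:A *: 'X_i = b%:R *: 'X_r :> {mpoly A[n]}.
    rewrite (bigD1 r) //= big1 => [|i /negPf ->]; last by rewrite mul0r !scale0r.
    by rewrite eqxx mul1r addr0 scaler_nat; case: b; rewrite ?scale1r ?scale0r.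
  rewrite /flow -!sE -sumrB -sumrMnl; apply: eq_bigr => i _.
  by rewrite !mulr2n scalerDl scalerDl scalerBl scalerBl.
under eq_bigr do rewrite fE mulrnAl; rewrite sumrMnl; congr (_ *+ 2).
under eq_bigr do rewrite mulrBl -!scalerAl; rewrite sumrB.
have dE r s : \sum_(j < n) (j == r)%:R *: ('X_s * P^`M(j)) = 'X_s * P^`M(r).
  rewrite (bigD1 r) //= big1 => [|i /negPf ->]; last by rewrite scale0r.
  by rewrite eqxx scale1r addr0.
by rewrite !dE.
Qed.

End FlowAlgebra.

Section SoAct.
Context {R : realType} {m : nat}.
Local Notation C := R[i].
Local Notation Cl := ('Cl[R]_m).
Local Notation CP := {mpoly Cl[m]}.
Implicit Types (p q i j : 'I_m) (P : CP) (w : Cl).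

Definition so_gen p q P : CP :=
  (cl_gen p * cl_gen q) *: P + ('X_q * P^`M(p) - 'X_p * P^`M(q)) *+ 2.

Let comm_coef w i j : C := (cl_gen i * w - w * cl_gen i) [set j].

Lemma so_diff_comb l (a : 'M[R]_m) P :
  let w := \sum_(i < m) \sum_(j < m | (i < j < l)%N) (a i j)%:C%C *: (cl_gen i * cl_gen j) in
  flow_diff w (comm_coef w) P =
  \sum_(i < m) \sum_(j < m | (i < j < l)%N) ((a i j)%:C%C)%:A *: so_gen i j P.
Proof.
move=> w; rewrite {}/w !pair_big_dep /=.
elim: (index_enum _) => [|[p q] r IH].
  rewrite !big_nil -(flow_diff0 P); apply: flow_diff_ext => // i j.
  by rewrite /comm_coef mulr0 mul0r subr0 cl_zeroE.
rewrite !big_cons; case: ifP => // /andP[/= pq _]; set w := \sum_(j <- r | _) _ in IH *.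
set w' := \sum_(j <- r | _) _ in IH *.
have npq : p != q by rewrite -(inj_eq val_inj) neq_ltn pq.
rewrite -{}IH.
have -> : so_gen p q P = flow_diff (cl_gen p * cl_gen q) (comm_coef (cl_gen p * cl_gen q)) P.
  rewrite /so_gen -(flow_diff_pair _ p q); apply: flow_diff_ext => // i j.
  exact: (esym (cl_comm_pair_coef _ _ _ npq)).
refine (etrans _ (flow_diffP (a p q)%:C%C (cl_gen p * cl_gen q) (comm_coef (cl_gen p * cl_gen q)) w (comm_coef w) P)).
apply: flow_diff_ext => [|i j]; first by [].
exact: cl_comm_coefP.
Qed.

(** On the spin group the inverse is the Clifford conjugation, which is linear:
    hence the inverse of the curve has the derivative [- w], and the coordinates
    of [s^-1 e_i s] move by the commutator of [e_i] and [w]. *)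
Lemma spin_deriv_so l w P : so_algebra l w -> is_spin_deriv w P (flow_diff w (comm_coef w) P).
Proof.
move=> hw g gS g0 gw; pose f (t : R) (j : 'I_m) : CP := \sum_(i < m) (((g t)^-1 * cl_gen i * g t) [set j])%:A *: 'X_i.
suff h : is_mpderive (is_clderive0 (m := m)) (fun t => spin_act (g t) P) (flow_diff w (comm_coef w) P).
  exact: h.
have dM := @clderiveM R m.
have dC := @clderive_cst R m.
have dE := @clderive_ext R m.
have dS := @clderive_sum R m.
have f0 i : f 0 i = 'X_i.
  rewrite /f g0 invr1 (bigD1 i) //= big1 => [|j ji].
    by rewrite mul1r mulr1 cl_basisE eqxx scale1r scale1r addr0.
  by rewrite mul1r mulr1 cl_basisE (inj_eq set1_inj) eq_sym (negPf ji) !scale0r.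
have hconj : is_clderive0 (fun t => (g t)^-1) (- w).
  rewrite -(cl_conj_so hw); apply: clderive_ext (clderive_conj gw) => t.
  by rewrite spin_groupV.
have hf j : is_mpderive (is_clderive0 (m := m)) (fun t => f t j) (flow Cl (comm_coef w) j).
  rewrite /f /flow; apply: (mpderive_sum dE dS) => i _.
  have hc : is_cderive0 (fun t => ((g t)^-1 * cl_gen i * g t) [set j]) (comm_coef w i j).
    have := clderiveM (clderiveM hconj (clderive_cst (cl_gen i))) gw.
    rewrite g0 invr1 mulr0 addr0 mulr1 mul1r => /(_ [set j]).
    by rewrite /comm_coef mulNr addrC.
  exact: (mpderiveCX dE dC dS dM 'X_i (clderive_alg 1 hc)).
exact: (mpderive_subst dE dC dS dM P g0 gw f0 hf (flow_comm (comm_coef w))).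
Qed.

Lemma so_actE l w P : so_algebra l w -> so_act w P = flow_diff w (comm_coef w) P.
Proof.
move=> hw; have h := spin_deriv_so P hw; apply: classical_sets.xget_unique => // Q hQ.
have [g [gS g0 gw]] := so_tangent hw.
apply/mpolyP => mon; apply/ffunP => A.
exact: cderive_unique (hQ _ gS g0 gw mon A) (h _ gS g0 gw mon A).
Qed.

Lemma so_act_comb l (a : 'M[R]_m) P :
  so_act (\sum_(i < m) \sum_(j < m | (i < j < l)%N) (a i j)%:C%C *: (cl_gen i * cl_gen j)) P =
  \sum_(i < m) \sum_(j < m | (i < j < l)%N) ((a i j)%:C%C)%:A *: so_gen i j P.
Proof. by rewrite -so_diff_comb; apply: (@so_actE l); exists a. Qed.

Lemma so_act_pair l p q P : (p < q < l)%N ->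
  so_algebra l (cl_gen p * cl_gen q : Cl) /\ so_act (cl_gen p * cl_gen q) P = so_gen p q P.
Proof.
move=> hpq; pose a := delta_mx p q : 'M[R]_m.
have E (V : lmodType Cl) (F : 'I_m -> 'I_m -> V) : \sum_(i < m) \sum_(j < m | (i < j < l)%N) ((a i j)%:C%C)%:A *: F i j = F p q.
  rewrite (bigD1 p) //= [X in _ + X]big1 => [|i /negPf ip]; last first.
    by apply: big1 => j _; rewrite mxE ip /= !scale0r.
  rewrite (bigD1 q) //= big1 => [|j /andP[_ /negPf jq]]; last by rewrite mxE jq andbF !scale0r.
  by rewrite mxE !eqxx !scale1r !addr0.
have wE : cl_gen p * cl_gen q = \sum_(i < m) \sum_(j < m | (i < j < l)%N) (a i j)%:C%C *: (cl_gen i * cl_gen j) :> Cl.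
  rewrite -(E (Cl^o : lmodType Cl) (fun i j => cl_gen i * cl_gen j)); apply: eq_bigr => i _; apply: eq_bigr => j _.
  exact: mulr_algl.
by split; [exists a | rewrite {1}wE so_act_comb E].
Qed.

(** The pairs of generators span so(l), and the action is linear in the element of
    the Lie algebra. *)
Lemma so_moduleP l (V : CP -> Prop) : so_module l V <->
  csubspace V /\ forall p q P, (p < q < l)%N -> V P -> V (so_gen p q P).
Proof.
split=> -[V0 hV]; split=> //.
  by move=> p q P pq VP; have [hw <-] := so_act_pair P pq; exact: hV.
move=> _ P [a ->] VP; rewrite so_act_comb.
have sumV (I : finType) (B : pred I) (F : I -> CP) : (forall t, B t -> V (F t)) -> V (\sum_(t | B t) F t).
  move=> h; elim/big_rec: _ => [|t x Bt Vx]; first exact: V0.1.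
  by have := V0.2 1 (F t) x (h t Bt) Vx; rewrite !scale1r.
apply: (sumV) => i _; apply: (sumV) => j ij; rewrite -[_ *: _]addr0; apply: V0.2; last exact: V0.1.
exact: hV.
Qed.

End SoAct.

(** * Identities in abelian groups *)

(** Identities in an abelian group are decided by comparing the integer
    coefficients of the atoms. *)
Section ZmodReflection.
Inductive zexp := ZVar of nat | ZZero | ZAdd of zexp & zexp | ZOpp of zexp | ZMuln of zexp & nat.

Fixpoint zcoef (e : zexp) (i : nat) : int :=
  match e with
  | ZVar j => (i == j)%:Z
  | ZZero => 0
  | ZAdd a b => zcoef a i + zcoef b i
  | ZOpp a => - zcoef a i
  | ZMuln a n => zcoef a i * n%:Z
  end.

Fixpoint zvars (e : zexp) (n : nat) : bool :=
  match e with
  | ZVar j => (j < n)%N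
  | ZZero => true
  | ZAdd a b => zvars a n && zvars b n
  | ZOpp a => zvars a n
  | ZMuln a _ => zvars a n
  end.

Context (V : zmodType).

Fixpoint zeval (env : seq V) (e : zexp) : V :=
  match e with
  | ZVar j => nth 0 env j
  | ZZero => 0
  | ZAdd a b => zeval env a + zeval env b
  | ZOpp a => - zeval env a
  | ZMuln a n => zeval env a *+ n
  end.

Lemma zevalE env e : zvars e (size env) ->
  zeval env e = \sum_(i < size env) nth 0 env i *~ zcoef e i.
Proof.
elim: e => /= [j hj||a IHa b IHb /andP[ha hb]|a IH ha|a IH n ha].
- rewrite (bigD1 (Ordinal hj)) //= eqxx mulr1z big1 ?addr0 // => i.
  by rewrite -(inj_eq val_inj) /= => /negPf ->.
- by rewrite big1.
- by rewrite IHa // IHb // -big_split; apply: eq_bigr => i _; rewrite mulrzDr.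
- by rewrite IH // -sumrN; apply: eq_bigr => i _; rewrite mulrNz.
- by rewrite IH // -sumrMnl; apply: eq_bigr => i _; rewrite mulrzA.
Qed.

Lemma zmod_correct env e1 e2 :
  [&& zvars e1 (size env), zvars e2 (size env) &
      all (fun i => zcoef e1 i == zcoef e2 i) (iota 0 (size env))] ->
  zeval env e1 = zeval env e2.
Proof.
case/and3P=> h1 h2 /allP h; rewrite !zevalE //; apply: eq_bigr => i _.
by rewrite (eqP (h i _)) ?mem_iota ?add0n ?ltn_ord.
Qed.
End ZmodReflection.

(* Atoms are compared up to conversion: equal terms may carry different
   canonical structures. *)
Ltac zmod_same x y :=
  match constr:(tt) with
  | _ => let _ := match constr:(tt) with _ => unify x y end in constr:(true)
  | _ => constr:(false)
  end.
Ltac zmod_add x l0 l :=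
  lazymatch l with
  | cons ?y ?l' =>
    let b := zmod_same x y in
    lazymatch b with true => l0 | false => zmod_add x l0 l' end
  | nil => constr:(cons x l0)
  end.
Ltac zmod_env l t :=
  lazymatch t with
  | (?a + ?b)%R => let l' := zmod_env l a in zmod_env l' b
  | (- ?a)%R => zmod_env l a
  | (?a *+ S ?n)%R => zmod_env l a
  | 0%R => l
  | _ => zmod_add t l l
  end.
Ltac zmod_idx x l :=
  lazymatch l with
  | cons ?y ?l' =>
    let b := zmod_same x y in
    lazymatch b with
    | true => constr:(0%N)
    | false => let n := zmod_idx x l' in constr:(S n)
    end
  end.
Ltac zmod_reify l t :=
  lazymatch t with
  | (?a + ?b)%R => let a' := zmod_reify l a in let b' := zmod_reify l b in constr:(ZAdd a' b')
  | (- ?a)%R => let a' := zmod_reify l a in constr:(ZOpp a')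
  | (?a *+ S ?n)%R => let a' := zmod_reify l a in constr:(ZMuln a' (S n))
  | 0%R => constr:(ZZero)
  | _ => let n := zmod_idx t l in constr:(ZVar n)
  end.
Ltac zmod :=
  match goal with
  | |- @eq ?T ?a ?b =>
    let l := zmod_env (@nil T) a in
    let l := zmod_env l b in
    let a' := zmod_reify l a in
    let b' := zmod_reify l b in
    exact (@zmod_correct _ l a' b' isT)
  end.

(** * Rotations and the Dirac operator *)

(** The variables, the partial derivatives and the generators are used through
    their commutation relations only, as operators on a module over an arbitrary
    ring. *)
Section WeylClifford.
Context (A : nzRingType) (V : lmodType A) (m : nat).
Context (e : 'I_m -> A) (X D : 'I_m -> {linear V -> V}).
Context (e_sqr : forall i, e i * e i = -1).
Context (e_anti : forall i j, i != j -> e i * e j = - (e j * e i)).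
Context (DX : forall i j v, D i (X j v) = v *+ (i == j) + X j (D i v)).
Context (XX : forall i j v, X i (X j v) = X j (X i v)).
Context (DD : forall i j v, D i (D j v) = D j (D i v)).
Context (char0 : forall n (v : V), v *+ n.+1 = 0 -> v = 0).
Implicit Types (p q i j : 'I_m) (v : V) (B : pred 'I_m) (a : 'I_m -> A).

Lemma lin_addE (f : {linear V -> V}) v w : f (v + w) = f v + f w. Proof. exact: linearD. Qed.
Lemma lin_oppE (f : {linear V -> V}) v : f (- v) = - f v. Proof. exact: linearN. Qed.
Lemma lin_mulnE (f : {linear V -> V}) v k : f (v *+ k) = f v *+ k. Proof. exact: linearMn. Qed.
Lemma lin_scaleE (f : {linear V -> V}) b v : f (b *: v) = b *: f v. Proof. exact: linearZ. Qed.
Lemma lin_sumE (f : {linear V -> V}) (P : pred 'I_m) (F : 'I_m -> V) :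
  f (\sum_(i | P i) F i) = \sum_(i | P i) f (F i).
Proof. exact: (big_morph f (lin_addE f) (linear0 f)). Qed.
Let XE i := (lin_addE (X i), lin_oppE (X i), lin_mulnE (X i), lin_scaleE (X i), linear0 (X i)).
Let DE i := (lin_addE (D i), lin_oppE (D i), lin_mulnE (D i), lin_scaleE (D i), linear0 (D i)).

Lemma scale_e_eq0 i v : e i *: v = 0 -> v = 0.
Proof.
move=> h; have : (e i * e i) *: v = 0 by rewrite -scalerA h scaler0.
by rewrite e_sqr scaleN1r => /eqP; rewrite oppr_eq0 => /eqP.
Qed.

(** [rot_gen p q] is the generator of the rotations of the plane of [p] and [q] on
    the variables, and [spin_rot p q] is the action of [e p * e q] in so(m). *)
Definition rot_gen p q v : V := X q (D p v) - X p (D q v).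
Definition spin_rot p q v : V := (e p * e q) *: v + rot_gen p q v *+ 2.

Lemma rotD p q v w : rot_gen p q (v + w) = rot_gen p q v + rot_gen p q w.
Proof. by rewrite /rot_gen !DE !XE; zmod. Qed.

Lemma rotZ p q b v : rot_gen p q (b *: v) = b *: rot_gen p q v.
Proof. by rewrite /rot_gen !DE !XE scalerBr. Qed.

Lemma rotX p q i v : rot_gen p q (X i v) = X i (rot_gen p q v) + (X q v *+ (p == i) - X p v *+ (q == i)).
Proof. by rewrite /rot_gen !DX !XE (XX q i) (XX p i); zmod. Qed.

Lemma rotDer p q i v : rot_gen p q (D i v) = D i (rot_gen p q v) + (D q v *+ (p == i) - D p v *+ (q == i)).
Proof.
rewrite /rot_gen !DE !DX [i == q]eq_sym [i == p]eq_sym (DD p) (DD q).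
by case: (q == i); case: (p == i); rewrite ?mulr1n ?mulr0n; zmod.
Qed.

Lemma spin_rotD p q v w : spin_rot p q (v + w) = spin_rot p q v + spin_rot p q w.
Proof. by rewrite /spin_rot rotD [_ *: (v + w)]scalerDr; zmod. Qed.

Lemma spin_rotZ p q b v : spin_rot p q (b *: v) = b *: spin_rot p q v + (e p * e q * b - b * (e p * e q)) *: v.
Proof. by rewrite /spin_rot rotZ [b *: (_ *: _ + _)]scalerDr !scalerA scalerBl -scalerMnr; zmod. Qed.

Lemma spin_rot_central p q b v : (forall x, b * x = x * b) -> spin_rot p q (b *: v) = b *: spin_rot p q v.
Proof. by move=> hb; rewrite spin_rotZ hb subrr scale0r addr0. Qed.

Lemma spin_rotX p q i v : spin_rot p q (X i v) = X i (spin_rot p q v) + (X q v *+ (p == i) - X p v *+ (q == i)) *+ 2.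
Proof. by rewrite /spin_rot rotX !XE; zmod. Qed.

Lemma spin_rotDer p q i v : spin_rot p q (D i v) = D i (spin_rot p q v) + (D q v *+ (p == i) - D p v *+ (q == i)) *+ 2.
Proof. by rewrite /spin_rot rotDer !DE; zmod. Qed.

Lemma spin_rot0 p q : spin_rot p q 0 = 0.
Proof. by rewrite /spin_rot /rot_gen !DE !XE scaler0; zmod. Qed.

Lemma spin_rot_sum p q B (F : 'I_m -> V) : spin_rot p q (\sum_(i | B i) F i) = \sum_(i | B i) spin_rot p q (F i).
Proof. exact: (big_morph _ (spin_rotD p q) (spin_rot0 p q)). Qed.

(** The relation of the generators of the Clifford algebra to a rotation; the
    products [e i * e l] with a fixed axis [l] satisfy it as well. *)
Definition vector_like a p q := forall i,
  e p * e q * a i - a i * (e p * e q) = (a q *+ (p == i) - a p *+ (q == i)) *+ 2.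

Lemma sum_delta B a (F : 'I_m -> V) p : B p -> \sum_(i | B i) F i *+ (p == i) = F p.
Proof.
move=> Bp; rewrite (bigD1 p) //= eqxx big1 ?addr0 // => i /andP[_ ip].
by rewrite eq_sym (negPf ip).
Qed.

(** The coefficients and the coordinates, or the partial derivatives, turn in
    opposite ways, so that their pairing is invariant. This covers the Dirac
    operator and the vector variable. *)
Lemma spin_rot_pairing (Y : 'I_m -> V -> V) B a p q v : B p -> B q -> vector_like a p q ->
  (forall i w, spin_rot p q (Y i w) = Y i (spin_rot p q w) + (Y q w *+ (p == i) - Y p w *+ (q == i)) *+ 2) ->
  spin_rot p q (\sum_(i | B i) a i *: Y i v) = \sum_(i | B i) a i *: Y i (spin_rot p q v).
Proof.
move=> Bp Bq ha hY; rewrite spin_rot_sum.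
transitivity (\sum_(i | B i) (a i *: Y i (spin_rot p q v) +
    ((a i *: Y q v) *+ (p == i) - (a i *: Y p v) *+ (q == i)) *+ 2 +
    ((a q *: Y i v) *+ (p == i) - (a p *: Y i v) *+ (q == i)) *+ 2)).
  apply: eq_bigr => i _; rewrite spin_rotZ hY scalerDr ha -!scalerMnl scalerBl -!scalerMnl.
  by rewrite -scalerMnr scalerBr -!scalerMnr.
rewrite big_split big_split /= !sumrMnl !sumrB.
rewrite (sum_delta a (fun i => a i *: Y q v) Bp) (sum_delta a (fun i => a i *: Y p v) Bq).
rewrite (sum_delta a (fun i => a q *: Y i v) Bp) (sum_delta a (fun i => a p *: Y i v) Bq).
zmod.
Qed.

Lemma vector_like_e p q : p != q -> vector_like e p q.
Proof.
move=> pq i; case: (eqVneq p i) => [<-|pi].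
  rewrite eq_sym (negPf pq) mulr0n subr0 mulr1n -mulrA (e_anti (i := q)) 1?eq_sym //.
  by rewrite mulrN !mulrA e_sqr !mulN1r opprK mulr2n.
case: (eqVneq q i) => [<-|qi].
  rewrite mulr0n sub0r mulr1n -mulrA e_sqr mulrN1 mulrA (e_anti (i := q)) 1?eq_sym //.
  by rewrite mulNr -mulrA e_sqr mulrN1 opprK mulr2n; zmod.
by rewrite !mulr0n subrr mul0rn -mulrA (e_anti (i := q)) // mulrN !mulrA (e_anti (i := i)) 1?eq_sym // !mulNr subrr.
Qed.

Lemma vector_like_M p q l : p != l -> q != l -> p != q -> vector_like (fun i => e i * e l) p q.
Proof.
move=> pl ql pq i.
have cl : e l * (e p * e q) = e p * e q * e l.
  by rewrite mulrA (e_anti (i := l)) 1?eq_sym // mulNr -[e p * e l * e q]mulrA (e_anti (i := l)) 1?eq_sym // mulrN opprK mulrA.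
rewrite mulrA -[e i * e l * _]mulrA cl mulrA -mulrBl vector_like_e // mulrnAl mulrBl.
by rewrite !mulrnAl.
Qed.

(** The Dirac operator in the variables of [B]. *)
Definition dir B v : V := \sum_(i | B i) e i *: D i v.

Lemma spin_rot_dir B p q v : B p -> B q -> p != q -> dir B (spin_rot p q v) = spin_rot p q (dir B v).
Proof.
move=> Bp Bq pq; apply: esym; rewrite /dir.
apply: (spin_rot_pairing (Y := fun i => D i)) => //; first exact: vector_like_e.
by move=> i w; exact: spin_rotDer.
Qed.

Lemma spin_rot_swap p q v : p != q -> spin_rot q p v = - spin_rot p q v.
Proof. by move=> pq; rewrite /spin_rot /rot_gen (e_anti (i := q)) 1?eq_sym // scaleNr; zmod. Qed.

(** * The Fischer decomposition *)

Section Fischer.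
Context (B : pred 'I_m) (la : 'I_m) (Bla : ~~ B la).
Context (W : nat -> V -> Prop).
Context (W0 : forall k, W k 0) (WD : forall k v w, W k v -> W k w -> W k (v + w)).
Context (WX : forall k i v, B i -> W k v -> W k.+1 (X i v)).
Context (WDer : forall k i v, B i -> W k.+1 v -> W k (D i v)).
Context (W0Der : forall i v, B i -> W 0 v -> D i v = 0).
Context (We : forall k i j v, W k v -> W k ((e i * e j) *: v)).
Context (Wdiv : forall k n v, W k v -> exists2 w, W k w & w *+ n.+1 = v).
Context (Weul : forall k v, W k v -> \sum_(i | B i) X i (D i v) = v *+ k).

(** The vector variable and the Dirac operator, with the factor [e la] on the side
    that makes their coefficients even. *)
Definition vmul v : V := \sum_(i | B i) (e i * e la) *: X i v.
Definition dirl v : V := \sum_(i | B i) (e la * e i) *: D i v.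

Lemma dirlE v : dirl v = e la *: dir B v.
Proof. by rewrite /dirl /dir scaler_sumr; apply: eq_bigr => i _; rewrite scalerA. Qed.

Lemma dirl_eq0 v : dirl v = 0 <-> dir B v = 0.
Proof.
rewrite dirlE; split=> [h|->]; last by rewrite scaler0.
exact: scale_e_eq0 h.
Qed.

Lemma vmul0 : vmul 0 = 0.
Proof. by rewrite /vmul big1 // => i _; rewrite !XE scaler0. Qed.
Lemma vmulMn v k : vmul (v *+ k) = vmul v *+ k.
Proof. by rewrite /vmul -sumrMnl; apply: eq_bigr => i _; rewrite !XE scalerMnr. Qed.
Lemma dirlD v w : dirl (v + w) = dirl v + dirl w.
Proof. by rewrite /dirl -big_split; apply: eq_bigr => i _; rewrite !DE scalerDr. Qed.
Lemma dirl0 : dirl 0 = 0.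
Proof. by rewrite /dirl big1 // => i _; rewrite !DE scaler0. Qed.
Lemma dirlMn v k : dirl (v *+ k) = dirl v *+ k.
Proof. by rewrite /dirl -sumrMnl; apply: eq_bigr => i _; rewrite !DE scalerMnr. Qed.
Lemma iter_dirl_sum (s : nat) (I : Type) (r : seq I) (P : pred I) (F : I -> V) :
  iter s dirl (\sum_(i <- r | P i) F i) = \sum_(i <- r | P i) iter s dirl (F i).
Proof.
elim: s => //= s ->; exact: (big_morph _ dirlD dirl0).
Qed.
Lemma iter_dirl0 s : iter s dirl 0 = 0.
Proof. by elim: s => //= s ->; exact: dirl0. Qed.
Lemma iter_dirlD s v w : iter s dirl (v + w) = iter s dirl v + iter s dirl w.
Proof. by elim: s => //= s ->; exact: dirlD. Qed.
Lemma iter_dirlMn s v k : iter s dirl (v *+ k) = iter s dirl v *+ k.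
Proof. by elim: s => //= s ->; exact: dirlMn. Qed.
Lemma iter_vmulMn s v k : iter s vmul (v *+ k) = iter s vmul v *+ k.
Proof. by elim: s => //= s ->; exact: vmulMn. Qed.

(** This is the basic relation of osp(1|2): the anticommutator is the dimension
    plus twice the Euler operator. *)
Lemma dirl_vmul v :
  dirl (vmul v) + vmul (dirl v) = v *+ #|B| + (\sum_(i | B i) X i (D i v)) *+ 2.
Proof.
have nla i : B i -> i != la by move=> Bi; apply: contraNneq Bla => <-.
have -> : dirl (vmul v) = \sum_(i | B i) \sum_(j | B j)
    (- (e i * e j) *: (v *+ (i == j)) - (e i * e j) *: X j (D i v)).
  rewrite /dirl; apply: eq_bigr => i Bi; rewrite /vmul lin_sumE scaler_sumr.
  apply: eq_bigr => j Bj; rewrite !DE scalerA DX.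
  have -> : e la * e i * (e j * e la) = - (e i * e j).
    rewrite (e_anti (i := la)) 1?eq_sym ?nla // mulNr mulrA -[e i * e la * e j]mulrA.
    rewrite (e_anti (i := la)) 1?eq_sym ?nla // mulrN mulNr opprK !mulrA -[_ * e la * e la]mulrA.
    by rewrite e_sqr mulrN1.
  by rewrite scalerDr scaleNr [in X in _ + X]scaleNr.
have -> : vmul (dirl v) = \sum_(i | B i) \sum_(j | B j) (- (e j * e i) *: X j (D i v)).
  rewrite exchange_big; apply: eq_bigr => j Bj; rewrite /dirl lin_sumE scaler_sumr.
  apply: eq_bigr => i Bi; rewrite !XE scalerA mulrA -[_ * e la * e la]mulrA e_sqr mulrN1.
  by rewrite mulNr.
rewrite -big_split -sumr_const -sumrMnl -big_split; apply: eq_bigr => i Bi.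
rewrite -big_split (bigD1 i) //= big1 ?addr0 => [|j /andP[Bj ji]].
  by rewrite eqxx mulr1n -!scaleNr e_sqr opprK !scale1r mulr2n addrA.
rewrite eq_sym (negPf ji) mulr0n scaler0 sub0r (e_anti (i := i)) 1?eq_sym // scaleNr opprK.
by rewrite subrr.
Qed.

Definition xv v : V := \sum_(i | B i) e i *: X i v.

Lemma vmulE v : vmul v = xv (e la *: v).
Proof. by rewrite /vmul /xv; apply: eq_bigr => i _; rewrite XE scalerA. Qed.

Lemma e_vmul v : e la *: vmul v = xv v.
Proof.
rewrite /vmul /xv scaler_sumr; apply: eq_bigr => i Bi; rewrite scalerA mulrA.
have nla : i != la by apply: contraNneq Bla => <-.
by rewrite (e_anti (i := la)) 1?eq_sym // mulNr -mulrA e_sqr mulrN1 opprK.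
Qed.

(** The square of a vector is minus its squared length. *)
Lemma xv_xv v : xv (xv v) = - \sum_(i | B i) X i (X i v).
Proof.
apply/eqP; rewrite -addr_eq0; apply/eqP; apply: (char0 (n := 1)).
have h : xv (xv v) = \sum_(i | B i) \sum_(j | B j) (e i * e j) *: X i (X j v).
  rewrite {1}/xv; apply: eq_bigr => i _; rewrite /xv lin_sumE scaler_sumr.
  by apply: eq_bigr => j _; rewrite XE scalerA.
have h' : xv (xv v) = \sum_(i | B i) \sum_(j | B j) (e j * e i) *: X i (X j v).
  rewrite h exchange_big; apply: eq_bigr => i _; apply: eq_bigr => j _.
  by rewrite XX.
rewrite mulrnDl mulr2n {1}h h' -big_split -sumrMnl -big_split big1 // => i Bi.
rewrite -big_split (bigD1 i) //= big1 ?addr0 => [|j /andP[_ ji]].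
  by rewrite e_sqr !scaleN1r; zmod.
by rewrite (e_anti ji) scaleNr subrr.
Qed.

Lemma vmul_vmul v : vmul (vmul v) = - \sum_(i | B i) X i (X i v).
Proof. by rewrite vmulE e_vmul xv_xv. Qed.

Lemma xv_vmul v : xv (vmul v) = - \sum_(i | B i) X i (X i (e la *: v)).
Proof. by rewrite vmulE xv_xv. Qed.

Definition monog k v := W k v /\ dirl v = 0.

Lemma W_vmul k v : W k v -> W k.+1 (vmul v).
Proof.
move=> hv; rewrite /vmul; elim/big_ind: _ => [|x y|i Bi]; [exact: W0|exact: WD|].
by apply: We; exact: WX.
Qed.

Lemma W_dirl k v : W k.+1 v -> W k (dirl v).
Proof.
move=> hv; rewrite /dirl; elim/big_ind: _ => [|x y|i Bi]; [exact: W0|exact: WD|].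
by apply: We; exact: WDer.
Qed.

Lemma W0_dirl v : W 0 v -> dirl v = 0.
Proof. by move=> hv; rewrite /dirl big1 // => i Bi; rewrite W0Der // scaler0. Qed.

Lemma W_iter_vmul k (j : nat) v : W k v -> W (k + j) (iter j vmul v).
Proof. by move=> hv; elim: j => [|j IH]; [rewrite addn0 | rewrite addnS; exact: W_vmul]. Qed.

(** The constants of the relation [dirl (vmul^j v) = c vmul^(j-1) v] for a monogenic
    [v] of degree [k]; by the osp(1|2) relation those of [j] and [j + 1] add up to
    [#|B| + 2 (k + j)]. *)
Definition fischer_cst (k j : nat) := if odd j then (#|B| + k.*2 + j).-1 else j.

Lemma dirl_iter_vmul k (j : nat) v : monog k v ->
  dirl (iter j.+1 vmul v) = iter j vmul v *+ fischer_cst k j.+1.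
Proof.
move=> [Wv hv]; elim: j => [|j IH].
  have := dirl_vmul v; rewrite hv vmul0 addr0 (Weul Wv) /= => ->.
  by rewrite -mulrnA -mulrnDr /fischer_cst /= addn1 muln2.
have := dirl_vmul (iter j.+1 vmul v); rewrite (Weul (W_iter_vmul j.+1 Wv)) IH vmulMn -iterS.
move/eqP; rewrite -subr_eq subr_eq => /eqP h.
have {}h : dirl (iter j.+2 vmul v) = iter j.+1 vmul v *+ (#|B| + (k + j.+1).*2) - iter j.+1 vmul v *+ fischer_cst k j.+1.
  by apply/eqP; rewrite eq_sym subr_eq; apply/eqP; rewrite [RHS]h -mulrnA -mulrnDr muln2.
rewrite h -mulrnBr; last first.
  rewrite /fischer_cst; case: ifP => _; lia.
congr (_ *+ _); rewrite /fischer_cst /=; case: (odd j) => /=; lia.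
Qed.

Lemma fischer_cst_gt0 k (j : nat) : (0 < #|B|)%N -> (0 < fischer_cst k j.+1)%N.
Proof. by move=> B0; rewrite /fischer_cst; case: ifP => _; lia. Qed.

Lemma iter_dirl_vmul_lt k (j s : nat) v : monog k v -> (j < s)%N -> iter s dirl (iter j vmul v) = 0.
Proof.
move=> hv; elim: j s => [|j IH] [//|s] js; rewrite iterSr.
  by rewrite [dirl _](proj2 hv) iter_dirl0.
by rewrite (dirl_iter_vmul j hv) iter_dirlMn IH // mul0rn.
Qed.

Lemma iter_dirl_vmul k s v : (0 < #|B|)%N -> monog k v ->
  exists c, iter s dirl (iter s vmul v) = v *+ c.+1.
Proof.
move=> B0 hv; elim: s => [|s [c IH]]; first by exists 0%N.
rewrite iterSr (dirl_iter_vmul s hv) iter_dirlMn IH -mulrnA.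
exists (c.+1 * fischer_cst k s.+1).-1; rewrite prednK // muln_gt0 /=.
exact: fischer_cst_gt0.
Qed.

(** The Fischer decomposition: the highest nonvanishing power of the Dirac
    operator on [v] is monogenic and gives the last term. *)
Lemma fischer k v s : (0 < #|B|)%N -> W k v -> (s <= k.+1)%N -> iter s dirl v = 0 ->
  exists2 p : nat -> V, forall j : nat, (j <= k)%N -> monog (k - j) (p j) &
    v = \sum_(j < s) iter j vmul (p j).
Proof.
move=> B0; elim: s v => [|s IH] v Wv sk hs.
  exists (fun=> 0) => [j _|]; last by rewrite big_ord0.
  by split; [exact: W0 | exact: dirl0].
have Wit (j : nat) u : (j <= k)%N -> W k u -> W (k - j) (iter j dirl u).
  move=> + Wu; elim: j => [|j IHj] jk; first by rewrite subn0.
  by apply: W_dirl; rewrite -subSn // subSS; apply: IHj; exact: ltnW.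
have mg : monog (k - s) (iter s dirl v) by split; [exact: Wit | exact: hs].
have [c hc] := iter_dirl_vmul s B0 mg.
have [g Wg gE] := Wdiv c (proj1 mg).
have mg' : monog (k - s) g.
  split => //; apply: (char0 (n := c)); rewrite -dirlMn gE; exact: hs.
have hg : iter s dirl (iter s vmul g) = g *+ c.+1.
  have [c' hc'] := iter_dirl_vmul s B0 mg'.
  move: hc; rewrite -gE iter_vmulMn iter_dirlMn hc' -!mulrnA => h.
  apply/eqP; rewrite -subr_eq0; apply/eqP; apply: (char0 (n := c)).
  by rewrite mulrnBl -!mulrnA h subrr.
have WN u : W k u -> W k (- u).
  move=> hu; have -> : - u = (e la * e la) *: u by rewrite e_sqr scaleN1r.
  exact: We.
have [] := IH (v - iter s vmul g).
- apply: WD => //; apply: WN.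
  by have := W_iter_vmul s Wg; rewrite subnK.
- exact: ltnW.
- have N u : iter s dirl (- u) = - iter s dirl u.
    by apply/eqP; rewrite -addr_eq0 -iter_dirlD addNr iter_dirl0.
  by rewrite iter_dirlD N hg gE subrr.
move=> p hp pE; exists (fun j : nat => if j == s then g else p j) => [j jk|].
  by case: eqP => [->|_] //; exact: hp.
rewrite big_ord_recr /= eqxx -[LHS](subrK (iter s vmul g)) pE; congr (_ + _).
apply: eq_bigr => j _; case: eqP => // js; have := ltn_ord j; by rewrite js ltnn.
Qed.

Lemma fischer_full k v : (0 < #|B|)%N -> W k v ->
  exists2 p : nat -> V, forall j : nat, (j <= k)%N -> monog (k - j) (p j) &
    v = \sum_(j < k.+1) iter j vmul (p j).
Proof.
move=> B0 Wv; apply: fischer => //; elim: k v Wv => [|k IH] v Wv; first exact: W0_dirl.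
by rewrite iterSr; apply: IH; exact: W_dirl.
Qed.

(** Applying the Dirac operator [s] times isolates the last term. *)
Lemma fischer_direct s (d : nat -> nat) (p : nat -> V) : (0 < #|B|)%N ->
  (forall j : nat, (j < s)%N -> monog (d j) (p j)) -> \sum_(j < s) iter j vmul (p j) = 0 ->
  forall j : nat, (j < s)%N -> p j = 0.
Proof.
move=> B0; elim: s => // s IH hp; rewrite big_ord_recr /= => h0.
have ps : p s = 0.
  have := congr1 (iter s dirl) h0; rewrite iter_dirlD iter_dirl_sum big1 => [|j _].
    have [c ->] := iter_dirl_vmul s B0 (hp s (ltnSn s)).
    by rewrite add0r iter_dirl0; exact: char0.
  apply: iter_dirl_vmul_lt (ltn_ord j); apply: hp; exact: leqW (ltn_ord j).
move=> j; rewrite ltnS leq_eqVlt => /orP[/eqP -> //|js].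
apply: IH js => [i is_lt|]; first by apply: hp; exact: leqW.
have v0 : iter s vmul 0 = 0 by elim: (s) => //= k ->; exact: vmul0.
by move: h0; rewrite ps v0 addr0.
Qed.

End Fischer.

(** * Raising operators *)

Section HighestWeight.
Context (B : pred 'I_m) (i0 i1 i2 : 'I_m) (n01 : i0 != i1) (n20 : i2 != i0) (n21 : i2 != i1).
Context (B0 : B i0) (B1 : B i1) (B2 : B i2).
Context (im : A) (imC : forall x, im * x = x * im) (im2 : im * im = -1).

(** The null vector [e i0 + im * e i1], the multiplication by the null coordinate
    [zl], the derivatives [dw] and [dwb] along the two null directions of the
    plane of [i0] and [i1], and the root vectors [raise q] of so. *)
Definition null_vec : A := e i0 + im * e i1.
Definition zl v : V := X i0 v + im *: X i1 v.
Definition dw v : V := D i0 v + im *: D i1 v.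
Definition dwb v : V := D i0 v - im *: D i1 v.
Definition raise q v : V := spin_rot i0 q v + im *: spin_rot i1 q v.

Local Notation F := null_vec.

Lemma scale_im v : im *: (im *: v) = - v.
Proof. by rewrite scalerA im2 scaleN1r. Qed.

Lemma null_vec_sqr : F * F = 0.
Proof.
have eim i x : e i * (im * x) = im * (e i * x) by rewrite !mulrA imC.
rewrite /F mulrDl !mulrDr e_sqr -!mulrA !eim (e_anti n01) e_sqr mulrN.
by rewrite [im * (im * _)]mulrA im2 mulrNN mulr1 addrA addrNK addNr.
Qed.

Lemma null_vec_anti q : q != i0 -> q != i1 -> F * e q = - (e q * F).
Proof.
move=> q0 q1; rewrite /F mulrDl mulrDr -mulrA (e_anti (i := i0)) 1?eq_sym //.
by rewrite (e_anti (i := i1)) 1?eq_sym // mulrN !mulrA imC opprD.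
Qed.

Lemma zlD v w : zl (v + w) = zl v + zl w.
Proof. by rewrite /zl !XE scalerDr; zmod. Qed.
Lemma zlZ b v : zl (b *: v) = b *: zl v.
Proof. by rewrite /zl !XE scalerDr !scalerA imC. Qed.
Lemma zl0 : zl 0 = 0. Proof. by rewrite /zl !XE scaler0 addr0. Qed.
Lemma zlMn v k : zl (v *+ k) = zl v *+ k.
Proof. by rewrite /zl !XE mulrnDl scalerMnr. Qed.
Lemma zlN v : zl (- v) = - zl v.
Proof. by rewrite /zl !XE scalerN; zmod. Qed.
Lemma dwZ b v : dw (b *: v) = b *: dw v.
Proof. by rewrite /dw !DE scalerDr !scalerA imC. Qed.
Lemma dwD v w : dw (v + w) = dw v + dw w.
Proof. by rewrite /dw !DE scalerDr; zmod. Qed.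
Lemma dwN v : dw (- v) = - dw v.
Proof. by rewrite /dw !DE scalerN; zmod. Qed.
Lemma dwMn v k : dw (v *+ k) = dw v *+ k.
Proof. by rewrite /dw !DE mulrnDl scalerMnr. Qed.
Lemma dwb_Z b v : dwb (b *: v) = b *: dwb v.
Proof. by rewrite /dwb !DE scalerBr !scalerA imC. Qed.

Lemma D_zl q v : q != i0 -> q != i1 -> D q (zl v) = zl (D q v).
Proof.
by move=> /negPf q0 /negPf q1; rewrite /zl !DE !DX q0 q1 !mulr0n !add0r.
Qed.

Lemma dw_zl v : dw (zl v) = zl (dw v).
Proof.
rewrite /dw /zl !DE !DX !XE eqxx [i1 == i0]eq_sym (negPf n01) eqxx !mulr1n !mulr0n !add0r.
rewrite !scalerDr !scale_im.
move: (im *: X i1 (D i0 v)) (im *: X i0 (D i1 v)) => ? ?; zmod.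
Qed.

Lemma dw_X q v : q != i0 -> q != i1 -> dw (X q v) = X q (dw v).
Proof.
move=> q0 q1; rewrite /dw !DX !XE [i0 == q]eq_sym [i1 == q]eq_sym (negPf q0) (negPf q1).
by rewrite !mulr0n !add0r.
Qed.

Lemma dw_D i v : dw (D i v) = D i (dw v).
Proof. by rewrite /dw !DE (DD i0) (DD i1). Qed.

Lemma raiseE q v : q != i0 -> q != i1 ->
  raise q v = (F * e q) *: v + (X q (dw v) - zl (D q v)) *+ 2.
Proof.
move=> q0 q1; rewrite /raise /spin_rot /rot_gen /dw /zl !XE /F mulrDl scalerDl -mulrA.
rewrite scalerDr scalerA -scalerMnr scalerBr; zmod.
Qed.

(** The vectors killed by the raising operators: only the conjugate of the null
    coordinate survives. *)
Definition extremal v := [/\ F *: v = 0, dw v = 0 & forall q, B q -> q != i0 -> q != i1 -> D q v = 0].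

Lemma raiseD q v w : raise q (v + w) = raise q v + raise q w.
Proof. by rewrite /raise !spin_rotD scalerDr; zmod. Qed.

Lemma raise0 q : raise q 0 = 0.
Proof. by rewrite /raise !spin_rot0 scaler0 addr0. Qed.

Lemma raise_im q v : raise q (im *: v) = im *: raise q v.
Proof. by rewrite /raise !(spin_rot_central _ _ _ imC) [RHS]scalerDr. Qed.

Lemma raiseX q i v : raise q (X i v) =
  X i (raise q v) + ((X q v *+ (i0 == i) + im *: X q v *+ (i1 == i)) - zl v *+ (q == i)) *+ 2.
Proof.
rewrite /raise !spin_rotX (lin_addE (X i)) (lin_scaleE (X i)) /zl [im *: (X i _ + _)]scalerDr -scalerMnr [im *: (_ - _)]scalerBr -!scalerMnr.
case: (i0 == i); case: (i1 == i); case: (q == i); rewrite ?mulr1n ?mulr0n; zmod.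
Qed.

(** The raising operators span an abelian algebra: the planes that they come
    from share the null direction. *)
Lemma raise_comm q r v : q != i0 -> q != i1 -> r != i0 -> r != i1 -> q != r ->
  raise q (raise r v) = raise r (raise q v).
Proof.
move=> q0 q1 r0 r1 qr.
have FF : (F * e q) * (F * e r) = (F * e r) * (F * e q).
  have z j c : j != i0 -> j != i1 -> F * e j * (F * c) = 0.
    move=> j0 j1; rewrite null_vec_anti // mulNr -mulrA [F * (F * _)]mulrA null_vec_sqr.
    by rewrite mul0r mulr0 oppr0.
  by rewrite !z.
pose del j w := X j (dw w) - zl (D j w).
have delZ j b w : j != i0 -> j != i1 -> del j (b *: w) = b *: del j w.
  by move=> j0 j1; rewrite /del dwZ !XE lin_scaleE zlZ scalerBr.
have delD j w w' : del j (w + w') = del j w + del j w'.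
  rewrite /del dwD (lin_addE (X j)) (lin_addE (D j)) zlD; zmod.
have delMn j w k : del j (w *+ k) = del j w *+ k.
  by rewrite /del dwMn (lin_mulnE (X j)) (lin_mulnE (D j)) zlMn mulrnBl.
have zX j w : zl (X j w) = X j (zl w).
  by rewrite /zl (lin_addE (X j)) (lin_scaleE (X j)) (XX i0) (XX i1).
have deldel j j' w : j != i0 -> j != i1 -> j' != i0 -> j' != i1 -> j != j' ->
    del j (del j' w) = X j (X j' (dw (dw w))) - X j (zl (D j' (dw w))) - X j' (zl (D j (dw w)))
      + zl (zl (D j (D j' w))).
  move=> j0 j1 j0' j1' jj; rewrite /del (dwD (X j' _)) dwN dw_X // dw_zl dw_D.
  rewrite (lin_addE (X j)) (lin_oppE (X j)) (lin_addE (D j)) (lin_oppE (D j)).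
  rewrite DX (negPf jj) mulr0n add0r D_zl // [zl (_ - _)]zlD zlN zX; zmod.
have E j w : j != i0 -> j != i1 -> raise j w = (F * e j) *: w + del j w *+ 2.
  by move=> j0 j1; rewrite raiseE.
have EE j j' : j != i0 -> j != i1 -> j' != i0 -> j' != i1 ->
    raise j (raise j' v) = (F * e j * (F * e j')) *: v
      + ((F * e j) *: del j' v + (F * e j') *: del j v) *+ 2 + del j (del j' v) *+ 4.
  move=> j0 j1 j0' j1'; rewrite (E j) // (E j' v) // [del j (_ *: v + _)]delD delMn delZ //.
  rewrite [_ *: (_ *: v + _)]scalerDr scalerA -scalerMnr; zmod.
by rewrite !EE // FF (deldel q r) // (deldel r q) // 1?eq_sym // (XX r q) (DD r q); zmod.
Qed.

(** Local nilpotency, not a uniform exponent: this is what survives the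
   multiplication by the variables. *)
Definition raise_nil q v := exists n, iter n (raise q) v = 0.

Lemma iter_raiseD q n v w : iter n (raise q) (v + w) = iter n (raise q) v + iter n (raise q) w.
Proof. by elim: n => //= n ->; exact: raiseD. Qed.

Lemma iter_raise0 q n : iter n (raise q) 0 = 0.
Proof. by elim: n => //= n ->; exact: raise0. Qed.

Lemma raise_nilD q v w : raise_nil q v -> raise_nil q w -> raise_nil q (v + w).
Proof.
move=> [a va] [b wb]; exists (a + b)%N.
by rewrite iter_raiseD [in X in X + _]addnC !iterD va wb !iter_raise0 addr0.
Qed.

Lemma raise_nil_im q v : raise_nil q v -> raise_nil q (im *: v).
Proof.
move=> [a va]; exists a; have -> : iter a (raise q) (im *: v) = im *: iter a (raise q) v.
  by elim: (a) => //= n ->; exact: raise_im.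
by rewrite va scaler0.
Qed.

Lemma raise_nil_opp q v : raise_nil q v -> raise_nil q (- v).
Proof. by rewrite -scale_im => /raise_nil_im/raise_nil_im. Qed.

Lemma raise_nilMn q v k : raise_nil q v -> raise_nil q (v *+ k).
Proof.
move=> h; elim: k => [|k IH]; first by exists 0%N.
by rewrite mulrS; exact: raise_nilD.
Qed.

Lemma raise_nilS q v : raise_nil q (raise q v) -> raise_nil q v.
Proof. by case=> a va; exists a.+1; rewrite iterSr. Qed.

(** A raising operator moves the variables along the chain from the conjugate of
    the null coordinate to [X q] and then to the null coordinate, which it
    kills. *)
Lemma raise_nilX q i v : q != i0 -> q != i1 -> raise_nil q v -> raise_nil q (X i v).
Proof.
move=> q0 q1.
have raise_zl w : raise q (zl w) = zl (raise q w).
  rewrite /zl raiseD raise_im !raiseX !eqxx (negPf q0) (negPf q1) (negPf n01) [i1 == i0]eq_sym (negPf n01).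
  rewrite !mulr1n !mulr0n !subr0 add0r addr0 scalerDr -scalerMnr scale_im; zmod.
have nil_zl w : raise_nil q w -> raise_nil q (zl w).
  case=> a wa; exists a; have -> : iter a (raise q) (zl w) = zl (iter a (raise q) w).
    by elim: (a) => //= n ->; exact: raise_zl.
  by rewrite wa zl0.
have step j (G : V -> V) : (forall w, raise q (X j w) = X j (raise q w) + G w) ->
    (forall w, raise_nil q w -> raise_nil q (G w)) -> forall w, raise_nil q w -> raise_nil q (X j w).
  move=> hj hG w [a]; elim: a w => [|a IH] w wa.
    by exists 0%N; rewrite (wa : w = 0) linear0.
  apply: raise_nilS; rewrite hj; apply: raise_nilD; last by apply: hG; exists a.+1.
  by apply: IH; rewrite -iterSr.
have nilXq w : raise_nil q w -> raise_nil q (X q w).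
  apply: (step q (fun w => - (zl w *+ 2))) => [u|u hu]; last first.
    by apply/raise_nil_opp/raise_nilMn/nil_zl.
  by rewrite raiseX eqxx [i0 == q]eq_sym [i1 == q]eq_sym (negPf q0) (negPf q1) !mulr0n mulr1n; zmod.
apply: (step i (fun w => ((X q w *+ (i0 == i) + im *: X q w *+ (i1 == i)) - zl w *+ (q == i)) *+ 2)).
  by move=> w; exact: raiseX.
move=> w hw; apply/raise_nilMn/raise_nilD; last exact/raise_nil_opp/raise_nilMn/nil_zl.
by apply: raise_nilD; [exact/raise_nilMn/nilXq | exact/raise_nilMn/raise_nil_im/nilXq].
Qed.

Lemma raise_nil_const q s : q != i0 -> q != i1 -> (forall i, D i s = 0) -> raise_nil q s.
Proof.
move=> q0 q1 Ds; have E w : (forall i, D i w = 0) -> raise q w = (F * e q) *: w.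
  by move=> Dw; rewrite raiseE // /dw !Dw scaler0 addr0 zl0 XE subrr mul0rn addr0.
exists 2%N; rewrite /= [raise q s]E // E => [|i]; last by rewrite lin_scaleE Ds scaler0.
rewrite scalerA {1}null_vec_anti // mulNr -mulrA [F * (F * _)]mulrA null_vec_sqr mul0r mulr0.
by rewrite oppr0 scale0r.
Qed.

Context (W : nat -> V -> Prop).
Context (WD : forall k v w, W k v -> W k w -> W k (v + w)).
Context (Wim : forall k v, W k v -> W k (im *: v)).
Context (WDer : forall k i v, B i -> W k.+1 v -> W k (D i v)).
Context (W0Der : forall i v, B i -> W 0 v -> D i v = 0).
Context (Wdiv : forall k n v, W k v -> exists2 w, W k w & w *+ n.+1 = v).
Context (Weul : forall k v, W k v -> \sum_(i | B i) X i (D i v) = v *+ k).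
Context (zl_inj : forall v, zl v = 0 -> v = 0).

Let Q q := [&& B q, q != i0 & q != i1].

Let sum_split (G : 'I_m -> V) : \sum_(i | B i) G i = G i0 + G i1 + \sum_(i | Q i) G i.
Proof.
rewrite (bigD1 i0) //= (bigD1 i1) /= ?B1 1?eq_sym // addrA; congr (_ + _).
by apply: eq_bigl => i; rewrite /Q andbA.
Qed.

Lemma dir_null v : dir B v *+ 2 = F *: dwb v + (e i0 - im * e i1) *: dw v + (\sum_(i | Q i) e i *: D i v) *+ 2.
Proof.
rewrite /dir sum_split mulrnDl; congr (_ + _).
rewrite /dwb /dw /F !scalerDl !scalerDr !scalerN !scaleNr !scalerA -imC.
have -> : im * e i1 * im = - e i1 by rewrite -imC mulrA im2 mulN1r.
rewrite !scaleNr; zmod.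
Qed.

Lemma dir_D i v : dir B (D i v) = D i (dir B v).
Proof. by rewrite /dir lin_sumE; apply: eq_bigr => j _; rewrite DE DD. Qed.

Lemma dir_dw v : dir B v = 0 -> dir B (dw v) = 0.
Proof.
move=> h; have dirD u w : dir B (u + w) = dir B u + dir B w.
  by rewrite /dir -big_split; apply: eq_bigr => j _; rewrite !DE scalerDr.
have dirZ u : dir B (im *: u) = im *: dir B u.
  by rewrite /dir scaler_sumr; apply: eq_bigr => j _; rewrite !DE !scalerA imC.
by rewrite /dw dirD dirZ !dir_D h !DE scaler0 addr0.
Qed.

Lemma raise_dw q v : q != i0 -> q != i1 -> raise q (dw v) = dw (raise q v).
Proof.
move=> q0 q1; rewrite !raiseE // [dw (_ *: _ + _)]dwD dwMn [dw (X q _ - _)]dwD dwN dwZ dw_X // dw_zl dw_D //.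
Qed.

(** Induction on the degree. The derivative [u] of [v] along the null direction is
    killed by the raising operators too, so it is extremal. Multiplication of
    [raise q v = 0] by the null vector, whose square is 0, shows that [R], the
    product of the null vector and [v], does not depend on the variables other
    than [X i0] and [X i1]. Summing [e q *: raise q v] over [q] and inserting the
    Dirac equation gives [eq1]; its derivative along [i2] forces [u = 0], and then
    the Euler identity turns it into a nonzero multiple of [R]. *)
Lemma extremalP k v : W k v -> dir B v = 0 ->
  (forall q, B q -> q != i0 -> q != i1 -> raise q v = 0) -> extremal v.
Proof.
elim: k v => [|k IH] v Wv dv hr.
  have D0 i : B i -> D i v = 0 by move=> Bi; exact: W0Der.
  have dw0 : dw v = 0 by rewrite /dw !D0 // scaler0 addr0.
  split=> // [|q Bq _ _]; last exact: D0.
  have := hr i2 B2 n20 n21; rewrite raiseE // dw0 D0 // zl0 XE subrr mul0rn addr0.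
  rewrite null_vec_anti // scaleNr -scalerA => /eqP; rewrite oppr_eq0 => /eqP h.
  exact: scale_e_eq0 h.
set u := dw v.
have Wu : W k u by apply: WD; [|apply: Wim]; exact: WDer.
have [Fu dwu Du] : extremal u.
  apply: IH => //; first exact: dir_dw.
  by move=> q Bq q0 q1; rewrite raise_dw // hr // /dw !DE scaler0 addr0.
have [R RE] : exists R, R = F *: v by exists (F *: v).
have DR q : Q q -> D q R = 0.
  case/and3P=> Bq q0 q1; apply: zl_inj; apply: (char0 (n := 1)).
  have := congr1 (fun w => F *: w) (hr q Bq q0 q1); rewrite /= raiseE // scaler0.
  rewrite scalerDr scalerA mulrA null_vec_sqr mul0r scale0r add0r -scalerMnr scalerBr.
  rewrite -(lin_scaleE (X q)) Fu XE sub0r -zlZ => /eqP; rewrite mulNrn oppr_eq0 => /eqP <-.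
  by rewrite RE DE.
have dwR : dw R = 0 by rewrite RE dwZ -/u.
pose y := \sum_(i | Q i) e i *: X i u.
have eq1 : R *+ #|Q| + y *+ 2 + zl (dwb R) + (e i0 - im * e i1) *: zl u = 0.
  have hs : \sum_(i | Q i) e i *: raise i v = 0.
    by apply: big1 => i /and3P[Bi i_0 i_1]; rewrite hr // scaler0.
  have hz : zl (\sum_(i | Q i) e i *: D i v) *+ 2 = - (zl (dwb R) + (e i0 - im * e i1) *: zl u).
    have := dir_null v; rewrite dv mul0rn => /esym/eqP; rewrite addrC addr_eq0 => /eqP h.
    rewrite -zlMn h zlN zlD RE -/u dwb_Z -!zlZ //.
  rewrite -[RHS]hs; transitivity (\sum_(i | Q i) (R + (e i *: X i u) *+ 2 - (e i *: zl (D i v)) *+ 2)).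
    have zs : zl (\sum_(i | Q i) e i *: D i v) = \sum_(i | Q i) e i *: zl (D i v).
      rewrite (big_morph zl zlD zl0); apply: eq_bigr => i _; exact: zlZ.
    by rewrite sumrB big_split /= sumr_const !sumrMnl -zs hz -/y; zmod.
  apply: eq_bigr => i /and3P[Bi i_0 i_1]; rewrite raiseE // -/u [e i *: (_ *: _ + _)]scalerDr.
  rewrite [e i *: (_ *: v)]scalerA null_vec_anti // mulrN mulrA e_sqr mulN1r opprK -RE.
  by rewrite -scalerMnr [e i *: (X i _ - _)]scalerBr; zmod.
have u0 : u = 0.
  have Q2 : Q i2 by rewrite /Q B2 n20 n21.
  have := congr1 (D i2) eq1; rewrite 3!lin_addE 2!lin_mulnE lin_scaleE (DR _ Q2) mul0rn add0r D_zl // D_zl // Du //.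
  have -> : D i2 (dwb R) = 0 by rewrite /dwb !DE (DD i2 i0) (DD i2 i1) (DR _ Q2) !DE scaler0 subrr.
  rewrite !zl0 scaler0 !addr0 /y lin_sumE (bigD1 i2) //= big1 => [|i /andP[/and3P[Bi i_0 i_1] ii2]].
    rewrite !DE DX Du // XE eqxx mulr1n !addr0 => h.
    have {}h : e i2 *: u = 0 by apply: (char0 (n := 1)).
    exact: scale_e_eq0 h.
  by rewrite DE DX Du // XE eq_sym (negPf ii2) mulr0n addr0 scaler0.
have R0 : R = 0.
  have hy : y = 0 by rewrite /y big1 // => i _; rewrite u0 XE scaler0.
  have := eq1; rewrite hy mul0rn addr0 u0 zl0 scaler0 addr0.
  have eulR : X i0 (D i0 R) + X i1 (D i1 R) = R *+ k.+1.
    have := Weul Wv; rewrite sum_split => h.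
    have := congr1 (fun w => F *: w) h; rewrite /= -scalerMnr scalerDr scalerDr scaler_sumr big1 => [|i Qi].
      by rewrite addr0 -!(lin_scaleE (X _)) -!(lin_scaleE (D _)) -RE.
    by rewrite -(lin_scaleE (X _)) -(lin_scaleE (D _)) -RE (DR i Qi) XE.
  have -> : zl (dwb R) = R *+ k.+1 *+ 2.
    have : zl (dwb R) + (X i0 (dw R) - im *: X i1 (dw R)) = R *+ k.+1 *+ 2.
      rewrite -eulR /zl /dwb /dw !XE !scalerDr !scalerN !scale_im.
      move: (im *: X i0 (D i1 R)) (im *: X i1 (D i0 R)) => ? ?; zmod.
    by rewrite dwR !XE scaler0 subrr addr0.
  rewrite -!mulrnA -mulrnDr addnC muln2 doubleS addSn; exact: char0.
split; rewrite -?RE // => q Bq q0 q1; apply: zl_inj; apply: (char0 (n := 1)).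
have := hr q Bq q0 q1; rewrite raiseE // -/u u0 (linear0 (X q)) null_vec_anti // scaleNr -scalerA -RE R0 scaler0 oppr0 !add0r.
by rewrite mulNrn => /eqP; rewrite oppr_eq0 => /eqP.
Qed.

(** By the Euler identity an extremal vector is a multiple of the null coordinate
    times its derivative [dwb], which is extremal of lower degree. *)
Lemma extremal_power k v : W k v -> extremal v ->
  exists s, [/\ W 0 s, F *: s = 0 & v = iter k zl s].
Proof.
elim: k v => [|k IH] v Wv [Fv dwv Dv]; first by exists v.
have Wdwb : W k (dwb v).
  have -> : dwb v = D i0 v + im *: (im *: (im *: D i1 v)) by rewrite scale_im.
  by apply: WD; [exact: WDer | do 3! apply: Wim; exact: WDer].
have [|s [W0s Fs sE]] := IH (dwb v) Wdwb.
  split; first by rewrite -dwb_Z Fv /dwb !DE scaler0 subrr.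
    by rewrite /dwb dwD dwN dwZ !dw_D dwv !DE scaler0 subrr.
  by move=> q Bq q0 q1; rewrite /dwb !DE (DD q i0) (DD q i1) Dv // !DE scaler0 subrr.
have hz : zl (dwb v) = v *+ k.+1 *+ 2.
  have eulv : X i0 (D i0 v) + X i1 (D i1 v) = v *+ k.+1.
    rewrite -(Weul Wv) sum_split [X in _ = _ + X]big1 ?addr0 // => q /and3P[Bq q0 q1].
    by rewrite Dv // XE.
  have : zl (dwb v) + (X i0 (dw v) - im *: X i1 (dw v)) = v *+ k.+1 *+ 2.
    rewrite -eulv /zl /dwb /dw !XE !scalerDr !scalerN !scale_im.
    move: (im *: X i0 (D i1 v)) (im *: X i1 (D i0 v)) => ? ?; zmod.
  by rewrite dwv !XE scaler0 subrr addr0.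
pose N := (k.+1 * 2).-1.
have NE : N.+1 = (k.+1 * 2)%N by [].
have [s' Ws' s'E] := Wdiv N W0s.
have itMn (j : nat) (w : V) c : iter j zl (w *+ c) = iter j zl w *+ c.
  by elim: j => //= j' ->; exact: zlMn.
exists s'; split => //.
  by apply: (char0 (n := N)); rewrite scalerMnr s'E.
apply/eqP; rewrite -subr_eq0; apply/eqP; apply: (char0 (n := N)).
by rewrite mulrnBl -itMn s'E iterS -sE hz -mulrnA NE subrr.
Qed.

Lemma extremal_iter k s : F *: s = 0 -> (forall i, B i -> D i s = 0) -> extremal (iter k zl s).
Proof.
move=> Fs Ds; elim: k => [|k [F0 dw0 D0]] /=; split.
- exact: Fs.
- by rewrite /dw !Ds // scaler0 addr0.
- by move=> q Bq _ _; exact: Ds.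
- by rewrite -zlZ F0 zl0.
- by rewrite dw_zl dw0 zl0.
- by move=> q Bq q0 q1; rewrite D_zl // D0 // zl0.
Qed.

Lemma dir_zl v : dir B (zl v) = zl (dir B v) + F *: v.
Proof.
have h : dir B (zl v) = \sum_(i | B i) (zl (e i *: D i v) + (e i *: v) *+ (i0 == i) + (im *: (e i *: v)) *+ (i1 == i)).
  apply: eq_bigr => i Bi; rewrite /zl !DE !DX ![i == _]eq_sym !XE.
  case: (i0 == i); case: (i1 == i); rewrite ?mulr0n ?mulr1n ?add0r ?addr0 !scalerDr !scalerA -?imC //; zmod.
rewrite h big_split big_split /= (sum_delta e (fun i => e i *: v) B0) (sum_delta e (fun i => im *: (e i *: v)) B1).
rewrite /dir (big_morph zl zlD zl0) /F scalerDl scalerA; zmod.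
Qed.

(** The null spinor contributes half a step and each factor of the null coordinate
    a full one, so that the weight of an extremal vector tells its degree. *)
Lemma weight_iter k s : F *: s = 0 -> (forall i, B i -> D i s = 0) ->
  spin_rot i0 i1 (iter k zl s) = - (im *: iter k zl s) *+ k.*2.+1.
Proof.
move=> Fs Ds; elim: k => [|k IH] /=.
  rewrite /spin_rot /rot_gen !Ds // !XE subrr mul0rn addr0 mulr1n.
  have es : e i0 *: s = - (im *: (e i1 *: s)).
    by apply/eqP; rewrite -addr_eq0 scalerA -scalerDl; apply/eqP.
  have -> : (e i0 * e i1) *: s = - (e i1 *: (e i0 *: s)) by rewrite (e_anti n01) scaleNr scalerA.
  rewrite es scalerN opprK !scalerA mulrA -imC -mulrA e_sqr mulrN1 scaleNr //.
have sz v : spin_rot i0 i1 (zl v) = zl (spin_rot i0 i1 v) - (im *: zl v) *+ 2.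
  rewrite /zl spin_rotD (spin_rot_central _ _ _ imC) !spin_rotX !eqxx [i1 == i0]eq_sym (negPf n01).
  rewrite !mulr1n !mulr0n subr0 sub0r !mulr2n !scalerDr !scalerN !scale_im; zmod.
rewrite sz IH zlMn zlN zlZ doubleS; by rewrite !mulNrn -opprD -mulrnDr addn2.
Qed.

Lemma raise_extremal q v : q != i0 -> q != i1 -> B q -> extremal v -> raise q v = 0.
Proof.
move=> q0 q1 Bq [F0 dw0 D0]; rewrite raiseE // dw0 D0 // zl0 XE subrr mul0rn addr0.
by rewrite null_vec_anti // scaleNr -scalerA F0 scaler0 oppr0.
Qed.

Lemma spin_rot_zl p q v : p != i0 -> p != i1 -> q != i0 -> q != i1 -> spin_rot p q (zl v) = zl (spin_rot p q v).
Proof.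
move=> /negPf p0 /negPf p1 /negPf q0 /negPf q1; rewrite /zl spin_rotD (spin_rot_central _ _ _ imC) !spin_rotX p0 p1 q0 q1.
by rewrite !mulr0n subrr mul0rn !addr0.
Qed.

End HighestWeight.

End WeylClifford.

(** * Polynomials with coefficients in a ring *)

Lemma alg_char0 (K : numFieldType) (A : algType K) k (a : A) : a *+ k.+1 = 0 -> a = 0.
Proof. by rewrite -scaler_nat => /eqP; rewrite scaler_eq0 pnatr_eq0 /= => /eqP. Qed.

Section PolynomialModule.
Context (A : nzRingType) (n : nat).
Local Notation P := {mpoly A[n]}.
Implicit Types (p q : P) (mon : 'X_{1..n}) (i j : 'I_n).

Definition mulX i (p : P) : P := 'X_i * p.

Lemma mulX_is_linear i : linear (mulX i).
Proof. by move=> a p q; rewrite /mulX mulrDr mulXZ. Qed.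

HB.instance Definition _ i := GRing.isLinear.Build A P P *:%R (mulX i) (mulX_is_linear i).

Definition Xl i : {linear P -> P} := mulX i.
Definition Dl i : {linear P -> P} := mderiv i.

Lemma XlE i p : Xl i p = 'X_i * p. Proof. by []. Qed.
Lemma DlE i p : Dl i p = p^`M(i). Proof. by []. Qed.

Lemma mderivXU i j : ('X_j)^`M(i) = (i == j)%:R :> P.
Proof.
rewrite mderivX mnm1E [j == i]eq_sym; case: (eqVneq i j) => [->|ij].
  by rewrite scale1r -{1}[U_(j)%MM]add0m addmK mpolyX0.
by rewrite scale0r.
Qed.

Lemma Dl_Xl i j p : Dl i (Xl j p) = p *+ (i == j) + Xl j (Dl i p).
Proof. by rewrite !DlE !XlE mderivM mderivXU mulr_natl. Qed.

Lemma Xl_comm i j p : Xl i (Xl j p) = Xl j (Xl i p).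
Proof. by rewrite !XlE !mulrA mpolyX_comm. Qed.

Lemma Dl_comm i j p : Dl i (Dl j p) = Dl j (Dl i p).
Proof. by rewrite !DlE mderiv_comm. Qed.

Lemma mcoeffXl i p mon : (Xl i p)@_mon = if mon i == 0%N then 0 else p@_(mon - U_(i)).
Proof.
rewrite XlE mpolyX_comm; case: eqP => [m0|/eqP m0].
  apply/memN_msupp_eq0; rewrite (perm_mem (msuppMX p U_(i))).
  by apply/mapP => -[k _ mE]; move: m0; rewrite mE mnmDE mnm1E eqxx.
by rewrite -{1}(submK (m := U_(i)) (m' := mon)) ?lep1mP // addmC mcoeffMX.
Qed.

Lemma mcoeffDl i p mon : (Dl i p)@_mon = p@_(mon + U_(i)) *+ (mon i).+1.
Proof. exact: mcoeff_mderiv. Qed.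

Lemma mcoeffXlDl i p mon : (Xl i (Dl i p))@_mon = p@_mon *+ mon i.
Proof.
rewrite mcoeffXl; case: eqP => [->//|/eqP m0].
rewrite mcoeffDl submK ?lep1mP // mnmBE mnm1E eqxx subn1 prednK ?lt0n //.
Qed.

Context (char0 : forall k (a : A), a *+ k.+1 = 0 -> a = 0).

Lemma mpoly_char0 k p : p *+ k.+1 = 0 -> p = 0.
Proof.
move=> h; apply/mpolyP => mon; rewrite mcoeff0; apply: (char0 (k := k)).
by rewrite -mcoeffMn h mcoeff0.
Qed.

Section Homogeneous.
Context (B : pred 'I_n) (S : A -> Prop).
Context (S0 : S 0) (SD : forall a b, S a -> S b -> S (a + b)).
Context (inv : nat -> A) (invE : forall k a, (inv k * a) *+ k.+1 = a).
Context (Sinv : forall k a, S a -> S (inv k * a)).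

(** Homogeneous polynomials in the variables of [B], with coefficients in [S]. *)
Definition homS k p := forall mon, S p@_mon /\
  (p@_mon <> 0 -> mdeg mon = k /\ forall i, ~~ B i -> mon i = 0%N).

Lemma S_mulrn a k : S a -> S (a *+ k).
Proof. by move=> Sa; elim: k => [|k IH]; rewrite ?mulr0n // mulrS; exact: SD. Qed.

Lemma homS0 k : homS k 0.
Proof. by move=> mon; rewrite mcoeff0. Qed.

Lemma homSD k p q : homS k p -> homS k q -> homS k (p + q).
Proof.
move=> hp hq mon; rewrite mcoeffD; split; first exact: SD (hp mon).1 (hq mon).1.
case: (eqVneq p@_mon 0) => [->|/eqP p0 _]; last exact: (hp mon).2.
by rewrite add0r; exact: (hq mon).2.
Qed.

Lemma homSZ c k p : (forall a, S a -> S (c * a)) -> homS k p -> homS k (c *: p).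
Proof.
move=> Sc hp mon; rewrite mcoeffZ; split; first exact: Sc (hp mon).1.
by case: (eqVneq p@_mon 0) => [->|/eqP p0 _]; [rewrite mulr0 | exact: (hp mon).2].
Qed.

Lemma homSX k i p : B i -> homS k p -> homS k.+1 (Xl i p).
Proof.
move=> Bi hp mon; rewrite mcoeffXl; case: ifP => // /negbT m0.
split; first exact: (hp _).1.
move=> /(hp _).2 [<- hB]; rewrite -{1}(submK (m := U_(i)) (m' := mon)) ?lep1mP // mdegD mdeg1 addn1.
split=> // j Bj; have := hB j Bj; rewrite mnmBE mnm1E.
by case: eqP => [ij|_]; rewrite ?subn0 //; rewrite -ij Bi in Bj.
Qed.

Lemma homSDer k i p : B i -> homS k.+1 p -> homS k (Dl i p).
Proof.
move=> Bi hp mon; rewrite mcoeffDl; split; first exact: S_mulrn (hp _).1.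
move=> h; have {h} : p@_(mon + U_(i)) <> 0 by move=> h0; rewrite h0 mul0rn in h.
move=> /(hp _).2 []; rewrite mdegD mdeg1 addn1 => -[->] hB; split=> // j Bj.
by have := hB j Bj; rewrite mnmDE => /eqP; rewrite addn_eq0 => /andP[/eqP].
Qed.

Lemma homS0Der i p : B i -> homS 0 p -> Dl i p = 0.
Proof.
move=> Bi hp; apply/mpolyP => mon; rewrite mcoeffDl mcoeff0.
case: (eqVneq p@_(mon + U_(i)) 0) => [->|/eqP]; first by rewrite mul0rn.
by move=> /(hp _).2 []; rewrite mdegD mdeg1 addn1.
Qed.

Lemma homSdiv k c p : homS k p -> exists2 q, homS k q & q *+ c.+1 = p.
Proof.
move=> hp; exists (inv c *: p); first by apply: homSZ hp => a; exact: Sinv.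
by apply/mpolyP => mon; rewrite mcoeffMn mcoeffZ invE.
Qed.

Lemma homSeul k p : homS k p -> \sum_(i | B i) Xl i (Dl i p) = p *+ k.
Proof.
move=> hp; apply/mpolyP => mon; rewrite raddf_sum mcoeffMn /=.
under eq_bigr do rewrite mcoeffXlDl.
rewrite sumrMnr; case: (eqVneq p@_mon 0) => [->|/eqP]; first by rewrite !mul0rn.
move=> /(hp _).2 [<- hB]; congr (_ *+ _); rewrite mdegE [RHS](bigID B) /=.
by rewrite [X in (_ + X)%N]big1 ?addn0.
Qed.

End Homogeneous.

(** The homogeneous null solutions of the Dirac operator in the variables of
    [B]. *)
Definition mono (e : 'I_n -> A) S B k p := homS B S k p /\ dir e (@Dl) B p = 0.

(** The null coordinate has a leading term in [X i0]: compare coefficients by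
    induction on the exponent of [i1]. *)
Lemma zl_mpoly_inj (im : A) (i0 i1 : 'I_n) p : i0 != i1 ->
  zl (@Xl) i0 i1 im p = 0 -> p = 0.
Proof.
move=> n01 hz; apply/mpolyP => mon; rewrite mcoeff0.
have [k] := ubnP (mon i1); elim: k mon => // k IH mon; rewrite ltnS => hk.
have := congr1 (mcoeff (mon + U_(i0))) hz.
rewrite mcoeffD mcoeffZ !mcoeffXl mcoeff0 addmK !mnmDE !mnm1E eqxx addn1 /= (negPf n01) addn0.
case: eqP => [_|/eqP m1]; first by rewrite mulr0 addr0.
rewrite [p@_(_ - _)]IH ?mulr0 ?addr0 // mnmBE mnmDE !mnm1E eqxx (negPf n01) addn0 subn1.
by rewrite -ltnS prednK // lt0n.
Qed.

(** Uniqueness of the Cauchy-Kovalevskaya extension: the Dirac equation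
    expresses the derivative along [la] by the other derivatives. *)
Lemma ck_unique (e : 'I_n -> A) (la : 'I_n) (B : pred 'I_n) p :
  (forall i, e i * e i = -1) -> (forall i, B i) -> dir e (@Dl) B p = 0 ->
  (forall mon, mon la = 0%N -> p@_mon = 0) -> p = 0.
Proof.
move=> e_sqr hB hd h0; apply/mpolyP => mon; rewrite mcoeff0.
have [k] := ubnP (mon la); elim: k mon => // k IH mon; rewrite ltnS => hk.
case: (posnP (mon la)) => [/h0 //|m0].
pose mon' := (mon - U_(la))%MM.
have mE : (mon' + U_(la))%MM = mon by rewrite submK // lep1mP -lt0n.
have := congr1 (mcoeff mon') hd; rewrite mcoeff0 /dir raddf_sum (bigD1 la) ?hB //= big1.
  rewrite addr0 mcoeffZ mcoeffDl mE => h; apply: (char0 (k := mon' la)).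
  have : e la * (e la * (p@_mon *+ (mon' la).+1)) = 0 by rewrite h mulr0.
  by rewrite mulrA e_sqr mulN1r => /eqP; rewrite oppr_eq0 => /eqP.
move=> i /andP[_ ila]; rewrite mcoeffZ mcoeffDl IH ?mul0rn ?mulr0 //.
rewrite mnmDE mnm1E (negPf ila) addn0 /mon' mnmBE mnm1E eqxx subn1.
by rewrite -ltnS prednK.
Qed.

Section Restriction.
Context (la : 'I_n).

(** The restriction to the hyperplane where the variable [la] vanishes. *)
Definition rst p : P := \sum_(mon <- msupp p | mon la == 0%N) p@_mon *: 'X_[mon].

Lemma mcoeff_rst p mon : (rst p)@_mon = if mon la == 0%N then p@_mon else 0.
Proof.
rewrite /rst raddf_sum /=; under eq_bigr do rewrite mcoeffZ mcoeffX.
case: (boolP (mon la == 0%N)) => m0; last first.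
  by apply: big1 => k k0; case: eqP => [kE|_]; rewrite ?mulr0 //; rewrite -kE k0 in m0.
case: (boolP (mon \in msupp p)) => mp.
  rewrite (big_rem mon) //= m0 eqxx mulr1 big_seq_cond big1 ?addr0 // => k /andP[kr _].
  case: eqP => [kE|_]; rewrite ?mulr0 //; move: kr.
  by rewrite kE mem_rem_uniq ?msupp_uniq // inE eqxx.
rewrite (memN_msupp_eq0 mp) big_seq_cond big1 // => k /andP[kr _].
by case: eqP => [kE|_]; rewrite ?mulr0 //; rewrite kE (negPf mp) in kr.
Qed.

Lemma rstD p q : rst (p + q) = rst p + rst q.
Proof. by apply/mpolyP => mon; rewrite mcoeffD !mcoeff_rst mcoeffD; case: ifP; rewrite ?addr0. Qed.

Lemma rst0 : rst 0 = 0.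
Proof. by apply/mpolyP => mon; rewrite mcoeff_rst mcoeff0 if_same. Qed.

Lemma rstZ a p : rst (a *: p) = a *: rst p.
Proof. by apply/mpolyP => mon; rewrite mcoeffZ !mcoeff_rst mcoeffZ; case: ifP; rewrite ?mulr0. Qed.

Lemma rst_sum (I : Type) (r : seq I) (Q : pred I) (F : I -> P) :
  rst (\sum_(i <- r | Q i) F i) = \sum_(i <- r | Q i) rst (F i).
Proof. exact: (big_morph _ rstD rst0). Qed.

Lemma rstM p q : rst (p * q) = rst p * rst q.
Proof.
apply/mpolyP => mon; rewrite mcoeff_rst !mcoeffM.
case: eqP => [m0|/eqP m0].
  apply: eq_bigr => k /eqP mE; rewrite !mcoeff_rst.
  have := congr1 (fun k : 'X_{1..n} => k la) mE; rewrite m0 mnmDE => /esym/eqP.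
  by rewrite addn_eq0 => /andP[-> ->].
rewrite big1 // => k /eqP mE; rewrite !mcoeff_rst.
have := congr1 (fun k : 'X_{1..n} => k la) mE; rewrite mnmDE => mE'.
move: m0; rewrite mE' addn_eq0 negb_and => /orP[] /negPf ->; by rewrite ?mul0r ?mulr0.
Qed.

Lemma rstX i : rst 'X_i = if i == la then 0 else 'X_i.
Proof.
apply/mpolyP => mon; rewrite mcoeff_rst mcoeffX; case: (eqVneq i la) => [->|ila].
  rewrite mcoeff0; case: eqP => // m0; case: eqP => // mE.
  by move: m0; rewrite -mE mnm1E eqxx.
rewrite mcoeffX; case: eqP => // m0; case: eqP => // mE.
by move: m0; rewrite -mE mnm1E (negPf ila).
Qed.

Lemma rst1 : rst 1 = 1.
Proof.
apply/mpolyP => mon; rewrite mcoeff_rst mcoeff1; case: eqP => // m0; case: eqP => // mE.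
by move: m0; rewrite mE mnm0E.
Qed.

Lemma rst_id p : (forall mon, p@_mon <> 0 -> mon la = 0%N) -> rst p = p.
Proof.
move=> hp; apply/mpolyP => mon; rewrite mcoeff_rst; case: eqP => // m0.
by case: (eqVneq p@_mon 0) => [->|/eqP/hp].
Qed.

End Restriction.
End PolynomialModule.

(** * Homogeneous Gegenbauer polynomials *)

Section GegenbauerPolynomials.
Context (R : realType) (T : comAlgType R) (u rho : T).
Implicit Types (nu : R) (n i a : nat).

(** The coefficient of [u^a rho^i] in the Gegenbauer polynomial of degree
    [a + 2 i], where [u] stands for [2 x] and [rho] for the squared radius. *)
Definition gterm nu a i : R := (-1) ^+ i * rising nu (a + i) / ((i`!)%:R * (a`!)%:R).

Lemma risingS nu j : rising nu j.+1 = nu * rising (nu + 1) j.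
Proof.
rewrite /rising big_ord_recl /= addr0; congr (_ * _); apply: eq_bigr => i _.
by rewrite /bump /= add1n -natr1 addrAC addrA.
Qed.

Lemma risingSr nu j : rising nu j.+1 = rising nu j * (nu + j%:R).
Proof. by rewrite /rising big_ord_recr. Qed.

Let fact_neq0 k : (k`!)%:R != 0 :> R.
Proof. by rewrite pnatr_eq0 -lt0n fact_gt0. Qed.

Lemma gterm_i nu a i : i.+1%:R * gterm nu a i.+1 = - nu * gterm (nu + 1) a i.
Proof.
rewrite /gterm addnS risingS exprS factS natrM.
have := fact_neq0 i; have := fact_neq0 a; have : i.+1%:R != 0 :> R by rewrite pnatr_eq0.
move: (rising _ _) ((-1) ^+ i) (i.+1%:R) ((i`!)%:R) ((a`!)%:R) => x s y z w y0 w0 z0.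
by field; rewrite y0 w0 z0.
Qed.

Lemma gterm_a nu a i : a.+1%:R * gterm nu a.+1 i = nu * gterm (nu + 1) a i.
Proof.
rewrite /gterm addSn risingS factS natrM.
have := fact_neq0 i; have := fact_neq0 a; have : a.+1%:R != 0 :> R by rewrite pnatr_eq0.
move: (rising _ _) ((-1) ^+ i) (a.+1%:R) ((i`!)%:R) ((a`!)%:R) => x s y z w y0 w0 z0.
by field; rewrite y0 w0 z0.
Qed.

Lemma gterm_rec l a i : gterm l a i = gterm (l + 1) a i
  - (if a is a'.+1 then gterm (l + 1) a' i else 0)
  + (if i is i'.+1 then gterm (l + 1) a i' else 0).
Proof.
case: a => [|a]; case: i => [|i].
- by rewrite /gterm /rising !big_ord0 subr0 addr0.
- rewrite /gterm !add0n risingS (risingSr (l + 1)) exprS factS natrM fact0.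
  have := fact_neq0 i; have : i.+1%:R != 0 :> R by rewrite pnatr_eq0.
  rewrite -natr1; move: (rising _ _) ((-1) ^+ i) (i%:R) ((i`!)%:R) => x s y z y0 z0.
  by field; rewrite y0 z0.
- rewrite /gterm !addn0 risingS (risingSr (l + 1)) factS natrM fact0 expr0.
  have := fact_neq0 a; have : a.+1%:R != 0 :> R by rewrite pnatr_eq0.
  rewrite -natr1; move: (rising _ _) (a%:R) ((a`!)%:R) => x y z y0 z0.
  by field; rewrite y0 z0.
rewrite /gterm [(a.+1 + i)%N]addSnnS [(a.+1 + i.+1)%N]addSn risingS (risingSr (l + 1)) exprS !factS !natrM natrD.
have := fact_neq0 i; have : i.+1%:R != 0 :> R by rewrite pnatr_eq0.
have := fact_neq0 a; have : a.+1%:R != 0 :> R by rewrite pnatr_eq0.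
rewrite -!natr1; move: (rising _ _) ((-1) ^+ i) (a%:R) ((a`!)%:R) (i%:R) ((i`!)%:R) => x s y z y' z' y0 z0 y0' z0'.
by field; rewrite y0 z0 y0' z0'.
Qed.

(** [gg nu n] is the homogeneous Gegenbauer polynomial of degree [n]; [gg1] and
    [gg2] are those of degree [n - 1] and [n - 2], indexed by the same range so
    that the recurrences compare coefficients term by term. *)
Definition gg nu n : T := \sum_(i < n.+1) (if (i.*2 <= n)%N then gterm nu (n - i.*2) i *: (u ^+ (n - i.*2) * rho ^+ i) else 0).
Definition gg1 nu n : T := \sum_(i < n.+1) (if (i.*2 < n)%N then gterm nu (n - i.*2).-1 i *: (u ^+ (n - i.*2).-1 * rho ^+ i) else 0).
Definition gg2 nu n : T := \sum_(i < n.+1) (if (0 < i)%N && (i.*2 <= n)%N then gterm nu (n - i.*2) i.-1 *: (u ^+ (n - i.*2) * rho ^+ i.-1) else 0).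

Lemma gg1_0 nu : gg1 nu 0 = 0.
Proof. by rewrite /gg1 big1 // => i _; rewrite ltn0. Qed.

Lemma gg1_S nu n : gg1 nu n.+1 = gg nu n.
Proof.
rewrite /gg1 big_ord_recr /= ltnNge.
have -> : (n.+1 <= n.+1.*2)%N by lia.
rewrite addr0; apply: eq_bigr => i _; rewrite ltnS; case: ifP => // hi.
by rewrite subSn.
Qed.

Lemma gg2_0 nu : gg2 nu 0 = 0.
Proof. by rewrite /gg2 big_ord_recl big_ord0 /= addr0. Qed.

Lemma gg2_1 nu : gg2 nu 1 = 0.
Proof. by rewrite /gg2 !big_ord_recl big_ord0 /= !addr0. Qed.

Lemma gg2_SS nu n : gg2 nu n.+2 = gg nu n.
Proof.
rewrite /gg2 big_ord_recl /= add0r big_ord_recr /= /bump /= add1n.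
have -> : (n.+2.*2 <= n.+2)%N = false by lia.
rewrite addr0; apply: eq_bigr => i _; rewrite add1n /= doubleS ltnS.
by case: ifP => // hi; rewrite !subSS.
Qed.

Lemma gg2_S nu n : gg2 nu n.+1 = gg1 nu n.
Proof. by case: n => [|n]; rewrite ?gg2_1 ?gg1_0 // gg2_SS gg1_S. Qed.

Let half_le n (i : 'I_n.+1) : (0 < n - i.*2)%N = (i.*2 < n)%N.
Proof. by rewrite subn_gt0. Qed.

(** The three recurrences hold term by term. In the variable [x = u / 2], with
    [rho = 1], this one is [C_n^l = C_n^(l+1) - 2 x C_(n-1)^(l+1) + C_(n-2)^(l+1)]. *)
Lemma gg_shift l n : gg l n = gg (l + 1) n - u * gg1 (l + 1) n + rho * gg2 (l + 1) n.
Proof.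
rewrite /gg /gg1 /gg2 !mulr_sumr -sumrB -big_split; apply: eq_bigr => i _ /=.
case: (leqP i.*2 n) => hi; last first.
  by rewrite ltnNge (ltnW hi) andbF /= !mulr0 subrr addr0.
rewrite andbT gterm_rec !scalerDl scaleNr; congr (_ - _ + _).
  rewrite -half_le; case E: (n - i.*2)%N => [|a] /=; first by rewrite scale0r mulr0.
  by rewrite -scalerAr exprS mulrA.
case: (nat_of_ord i) => [|i'] /=; first by rewrite scale0r mulr0.
by rewrite -scalerAr exprS mulrCA.
Qed.

Lemma gg_euler l n : n%:R *: gg l n = l *: (u * gg1 (l + 1) n) - (2 * l) *: (rho * gg2 (l + 1) n).
Proof.
rewrite /gg /gg1 /gg2 !mulr_sumr !scaler_sumr -sumrB; apply: eq_bigr => i _ /=.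
case: (leqP i.*2 n) => hi; last first.
  by rewrite ltnNge (ltnW hi) andbF /= !mulr0 !scaler0 subrr.
rewrite andbT; set w := u ^+ (n - i.*2) * rho ^+ i.
have -> : n%:R = (n - i.*2)%:R + 2 * i%:R :> R.
  by rewrite natrB // -mul2n natrM subrK.
rewrite scalerDl !scalerA /w {w}; congr (_ + _).
  rewrite -half_le; case E: (n - i.*2)%N => [|a] /=; first by rewrite mul0r scale0r mulr0 scaler0.
  rewrite (gterm_a l a i).
  by rewrite -[in RHS]scalerAr scalerA exprS -mulrA.
case: (nat_of_ord i) => [|i'] /=; first by rewrite mulr0 mul0r scale0r mulr0 scaler0 oppr0.
rewrite -[2 * i'.+1%:R * _]mulrA (gterm_i l (n - i'.+1.*2) i').
rewrite -[in RHS]scalerAr scalerA exprS [rho * (_ * _)]mulrCA -scaleNr; congr (_ *: _); ring.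
Qed.

Lemma gg_raise l n : (n%:R + 2 * l) *: gg l n = (2 * l) *: gg (l + 1) n - l *: (u * gg1 (l + 1) n).
Proof.
rewrite scalerDl gg_euler {1}[gg l n]gg_shift !scalerDr scalerN.
have -> : (2 * l) *: (u * gg1 (l + 1) n) = l *: (u * gg1 (l + 1) n) + l *: (u * gg1 (l + 1) n).
  by rewrite -scalerDl; congr (_ *: _); ring.
zmod.
Qed.

(** The rule [d C_n^nu / d x = 2 nu C_(n-1)^(nu+1)] in homogeneous form, for any
    derivation of the algebra. *)
Lemma gg_deriv (d : T -> T) nu n : (forall x y, d (x + y) = d x + d y) ->
  (forall (c : R) x, d (c *: x) = c *: d x) -> (forall x y, d (x * y) = d x * y + x * d y) ->
  d (gg nu n) = nu *: (gg1 (nu + 1) n * d u) - nu *: (gg2 (nu + 1) n * d rho).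
Proof.
move=> dD dZ dM; have d0 : d 0 = 0 by have := dZ 0 0; rewrite !scale0r.
have d1 : d 1 = 0 by apply: (addIr (d 1)); rewrite add0r -[in RHS](mulr1 1) dM mulr1 mul1r.
have dX x k : d (x ^+ k.+1) = k.+1%:R *: (x ^+ k * d x).
  elim: k => [|k IH]; first by rewrite expr1 expr0 mul1r scale1r.
  rewrite exprS dM IH -scalerAr mulrA -exprS -[k.+2%:R]natr1 scalerDl scale1r addrC.
  by rewrite [d x * _]mulrC.
rewrite /gg (big_morph _ dD d0) /gg1 /gg2 !mulr_suml !scaler_sumr -sumrB; apply: eq_bigr => i _ /=.
case: (leqP i.*2 n) => hi; last first.
  by rewrite ltnNge (ltnW hi) andbF /= !mul0r !scaler0 subrr d0.
rewrite andbT dZ dM scalerDr; congr (_ + _).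
  rewrite -half_le; case E: (n - i.*2)%N => [|a] /=; first by rewrite expr0 d1 mul0r scaler0 mul0r scaler0.
  rewrite dX -!scalerAl !scalerA mulrC gterm_a; congr (_ *: _); ring.
case: (nat_of_ord i) => [|i'] /=; first by rewrite expr0 d1 mulr0 scaler0 mul0r scaler0 oppr0.
rewrite dX -scalerAr -scalerAl !scalerA mulrC gterm_i -scaleNr mulNr; congr (_ *: _); ring.
Qed.

(** The two components of the Dirac equation for the multipliers: the coefficient
    of the vector variable here, the scalar part in [gg_dirac2]. *)
Lemma gg_dirac1 nu n (c := 2 * nu / (2 * nu + n.+1%:R)) : 2 * nu + n.+1%:R != 0 ->
  c *: ((2 * (nu + 1)) *: gg1 (nu + 1 + 1) n - (nu + 1) *: (u * gg2 (nu + 1 + 1) n))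
  = (2 * nu) *: gg2 (nu + 1) n.+1.
Proof.
move=> nz; case: n @c nz => [|n] c nz; first by rewrite gg1_0 gg2_0 gg2_1 mulr0 !scaler0 subrr scaler0.
rewrite gg2_SS gg1_S gg2_S -gg_raise scalerA; congr (_ *: _).
rewrite /c -!natr1; field; by rewrite !natr1.
Qed.

Lemma gg_dirac2 nu n rho0 (c := 2 * nu / (2 * nu + n.+1%:R)) : 2 * nu + n.+1%:R != 0 ->
  rho0 *+ 4 = rho *+ 4 - u ^+ 2 ->
  (2 * nu) *: gg1 (nu + 1) n.+1 - nu *: (u * gg2 (nu + 1) n.+1)
  + (c * (2 * (nu + 1))) *: (rho0 * gg2 (nu + 1 + 1) n)
  - (c * (2 * nu + 1)) *: gg (nu + 1) n = 0.
Proof.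
move=> nz hr; rewrite gg1_S gg2_S.
set l := nu + 1; set d := 2 * nu + n.+1%:R in c nz *.
have sE (k : R) (x : T) : k *: x = in_alg T k * x by rewrite /= mulr_algl.
have dE : d = 2 * l + n%:R - 1 by rewrite /d /l -natr1; ring.
have h1 := gg_euler l n.
have h2 : d *: gg1 l n = (2 * l) *: gg1 (l + 1) n - l *: (u * gg2 (l + 1) n).
  rewrite dE; case: (n) => [|n']; first by rewrite !gg1_0 gg2_0 mulr0 !scaler0 subrr.
  rewrite !gg1_S gg2_S -gg_raise; congr (_ *: _); rewrite -!natr1; ring.
have hc : d * c = 2 * nu by rewrite /c mulrC divfK.
set E := (X in X = 0).
have hE : (4 * d) *: E = 0.
  move: h1 h2; rewrite /E {E} !sE.
  move: (gg l n) (gg1 l n) (gg1 (l + 1) n) (gg2 (l + 1) n) hr => g gm g1 g2 hr.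
  move/eqP; rewrite -subr_eq0 => /eqP; set h1 := (X in X = 0 -> _) => H1.
  move/eqP; rewrite -subr_eq0 => /eqP; set h2 := (X in X = 0 -> _) => H2.
  move: hr => /eqP; rewrite -subr_eq0 => /eqP; set h3 := (X in X = 0 -> _) => H3.
  have H4 : in_alg T d * in_alg T c - in_alg T (2 * nu) = 0 by rewrite -rmorphM hc subrr.
  set h4 := (X in X = 0) in H4.
  (* The Euler identity [h1], the raising identity [h2], the relation [h3] of the
     two squared radii and the definition [h4] of [c]; the factor [4 * d] clears
     their denominators. *)
  transitivity (in_alg T (8 * nu) * h1 - in_alg T (4 * nu) * u * h2
     + in_alg T (4 * nu * l) * g2 * h3 + h4 * (in_alg T (8 * l) * rho0 * g2 - in_alg T (4 * (2 * nu + 1)) * g)).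
    by rewrite /h1 /h2 /h3 /h4 dE /l; ring.
  by rewrite H1 H2 H3 H4 !mulr0 mul0r subrr !addr0.
move/eqP: hE; rewrite scaler_eq0 mulf_eq0 (negPf nz) pnatr_eq0 /= => /eqP //.
Qed.

(** Where [u] vanishes only the last term of an even polynomial survives. *)
Lemma gg_vanish (f : T -> T) nu n : (forall x y, f (x + y) = f x + f y) ->
  (forall (c : R) x, f (c *: x) = c *: f x) -> (forall x y, f (x * y) = f x * f y) ->
  f 1 = 1 -> f u = 0 ->
  f (gg nu n) = if odd n then 0 else gterm nu 0 n./2 *: f rho ^+ n./2.
Proof.
move=> fD fZ fM f1 fu; have f0 : f 0 = 0 by have := fZ 0 0; rewrite !scale0r.
have fX x k : f (x ^+ k) = f x ^+ k.
  by elim: k => [|k IH]; rewrite ?expr0 // !exprS fM IH.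
have z (i : 'I_n.+1) : (i.*2 != n) -> f (if (i.*2 <= n)%N then gterm nu (n - i.*2) i *: (u ^+ (n - i.*2) * rho ^+ i) else 0) = 0.
  move=> i2; case: ifP => // hi; rewrite fZ fM !fX fu expr0n subn_eq0.
  by rewrite leqNgt ltn_neqAle i2 hi /= mul0r scaler0.
rewrite /gg (big_morph _ fD f0); case: ifP => on.
  by apply: big1 => i _; apply: z; apply: contraTneq on => <-; rewrite odd_double.
have hn : (n./2 < n.+1)%N by lia.
have n2 : n./2.*2 = n by rewrite -[RHS]odd_double_half on.
rewrite (bigD1 (Ordinal hn)) //= big1 ?addr0 => [|i ih].
  by rewrite n2 leqnn subnn fZ fM !fX expr0 mul1r.
apply: z; apply: contraNneq ih => hi; apply/eqP/val_inj => /=; lia.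
Qed.

Lemma gterm0_neq0 nu l : 0 < nu -> gterm nu 0 l != 0.
Proof.
move=> nu0; rewrite /gterm fact0 mulr1 !mulf_neq0 ?invr_eq0 ?fact_neq0 ?signr_eq0 //.
rewrite /rising; apply/prodf_neq0 => i _; rewrite gt_eqF //.
by rewrite ltr_wpDr.
Qed.

End GegenbauerPolynomials.

Section GegenbauerHom.
Context (R : realType) (m : nat) (la : 'I_m) (hla : la = m.-1 :> nat).

Lemma at_lastE (T : nmodType) (F : 'I_m -> T) : at_last F = F la.
Proof.
by rewrite /at_last; case: insubP => [i _ iE|]; [congr F; apply: val_inj; rewrite /= in iE *; rewrite iE -hla | rewrite -hla ltn_ord].
Qed.

Definition rho_all : {mpoly R[m]} := \sum_(p < m) 'X_p ^+ 2.
Definition u_la : {mpoly R[m]} := (2 : R) *: 'X_la.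

Lemma gegen_coefE (nu : R) j i : (i.*2 <= j)%N -> gegen_coef nu j i = gterm nu (j - i.*2) i.
Proof.
move=> ij; rewrite /gegen_coef /gterm; congr (_ * rising _ _ / _).
by rewrite -addnn in ij *; lia.
Qed.

Lemma gegen_range (V : nmodType) j (F : nat -> V) :
  \sum_(i < j./2.+1) F i = \sum_(i < j.+1) (if (i.*2 <= j)%N then F i else 0).
Proof.
rewrite -big_mkcond /= (big_ord_widen_cond j.+1 xpredT F) ?ltnS; last by lia.
by apply: eq_bigl => i /=; lia.
Qed.

Lemma gegenbauer_hom_gg nu j : gegenbauer_hom nu j m = gg u_la rho_all nu j.
Proof.
rewrite /gegenbauer_hom /gg at_lastE.
rewrite (gegen_range j (fun i => gegen_coef nu j i *: (u_la ^+ (j - i.*2) * rho_all ^+ i))).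
by apply: eq_bigr => i _; case: ifP => // /gegen_coefE ->.
Qed.

Lemma gegenbauer_at0 (nu : R) l : (gegenbauer nu l.*2).[0] = gterm nu 0 l.
Proof.
rewrite /gegenbauer horner_sum doubleK big_ord_recr /= big1 ?add0r => [|i _].
  by rewrite subnn expr0 hornerZ hornerC mulr1 gegen_coefE // subnn.
rewrite hornerZ horner_exp hornerZ hornerX mulr0 expr0n subn_eq0.
by rewrite leq_double leqNgt ltn_ord mulr0.
Qed.

End GegenbauerHom.

(** * The multipliers of the branching law *)

(** The coefficients of [x] and of [y] vanish separately. *)
Lemma two_component_sum (T : pzRingType) (a1 a2 b1 b2 c r x y : T) N :
  a1 + b2 = 0 -> a2 - b1 * r - c *+ N = 0 ->
  a1 * x + a2 * y + (b1 * - (r * y) + b2 * x + c * (y *- N)) = 0.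
Proof.
move=> h1 h2; rewrite -[RHS](mul0r x) -{}h1 -[RHS]addr0 -[X in _ = _ + X](mul0r y) -{}h2.
rewrite !mulrDl !mulNr !mulrN mulrA mulrnAl mulrnAr; zmod.
Qed.

Lemma rot_mul_sum (T : zmodType) (a b d : T) : a + b - (a + d) = b - d.
Proof. by rewrite opprD addrACA subrr add0r. Qed.

Section Branching.
Context (R : realType) (A : algType R[i]) (m : nat) (e : 'I_m -> A).
Context (e_sqr : forall i, e i * e i = -1).
Context (e_anti : forall i j, i != j -> e i * e j = - (e j * e i)).
Context (la : 'I_m) (hla : la = m.-1 :> nat).
Local Notation V := {mpoly A[m]}.
Local Notation X := (@Xl A m).
Local Notation D := (@Dl A m).
Local Notation B := (fun i : 'I_m => (i < m.-1)%N).
Local Notation all := (fun i : 'I_m => (i < m)%N).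
Implicit Types (i j p q : 'I_m) (P Q : V) (g h : {mpoly R[m]}).

Lemma below_last i : (i < m.-1)%N = (i != la).
Proof. by rewrite -(inj_eq val_inj) /= hla; have := ltn_ord i; lia. Qed.

(** [cl_poly] for an arbitrary algebra in place of the Clifford algebra. *)
Definition clp g : V := map_mpoly (in_alg A \o real_complex R) g.

Lemma clpD g h : clp (g + h) = clp g + clp h. Proof. exact: rmorphD. Qed.
Lemma clpN g : clp (- g) = - clp g. Proof. exact: rmorphN. Qed.
Lemma clpM g h : clp (g * h) = clp g * clp h. Proof. exact: rmorphM. Qed.
Lemma clpMn g k : clp (g *+ k) = clp g *+ k. Proof. exact: rmorphMn. Qed.
Lemma clp1 : clp 1 = 1. Proof. exact: rmorph1. Qed.
Lemma clp0 : clp 0 = 0. Proof. exact: rmorph0. Qed.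
Lemma clpXU i : clp 'X_i = 'X_i. Proof. exact: map_mpolyX. Qed.
Lemma clp_sum (I : Type) (r : seq I) (T : pred I) (F : I -> {mpoly R[m]}) :
  clp (\sum_(i <- r | T i) F i) = \sum_(i <- r | T i) clp (F i).
Proof. exact: rmorph_sum. Qed.
Lemma mcoeff_clp g mon : (clp g)@_mon = ((g@_mon)%:C%C)%:A.
Proof. by rewrite mcoeff_map_mpoly. Qed.

Lemma clp_deriv g i : (clp g)^`M(i) = clp g^`M(i).
Proof.
apply/mpolyP => mon; rewrite mcoeff_mderiv !mcoeff_clp mcoeff_mderiv.
by rewrite rmorphMn scalerMnl.
Qed.

Lemma clp_comm g Q : clp g * Q = Q * clp g.
Proof.
elim/mpolyind: g => [|c mon g _ _ IH]; first by rewrite clp0 mulr0 mul0r.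
rewrite clpD mulrDr mulrDl IH; congr (_ + _).
rewrite -mul_mpolyC clpM.
have -> : clp c%:MP = (c%:C%C%:A)%:MP by exact: map_mpolyC.
have -> : clp 'X_[mon] = 'X_[mon] by exact: map_mpolyX.
rewrite -mulrA -commr_mpolyX [LHS]mulrA [RHS]mulrA mpolyC_comm // => a.
exact: alg_comm.
Qed.

Lemma clp_scale g a Q : clp g * (a *: Q) = a *: (clp g * Q).
Proof. by rewrite -!mul_mpolyC mulrA clp_comm mulrA. Qed.

Lemma clp_X g i Q : clp g * X i Q = X i (clp g * Q).
Proof. by rewrite !XlE !mulrA clp_comm. Qed.

Lemma D_clp g i Q : D i (clp g * Q) = clp g^`M(i) * Q + clp g * D i Q.
Proof. by rewrite !DlE mderivM clp_deriv. Qed.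

(** A scalar polynomial [g] whose gradient in the first variables is radial,
    with [h] the radial factor. *)
Definition radial g h := forall i, (i < m.-1)%N -> g^`M(i) = 'X_i * h.

Lemma dir_clp g h Q : radial g h ->
  dir e D all (clp g * Q) = clp h * xv e X B Q + clp g^`M(la) * (e la *: Q) + clp g * dir e D all Q.
Proof.
move=> hg; rewrite /dir; under eq_bigr do rewrite D_clp scalerDr.
rewrite big_split /=; congr (_ + _); last first.
  by rewrite mulr_sumr; apply: eq_bigr => i _; rewrite clp_scale.
rewrite (bigD1 la) //= addrC clp_scale; congr (_ + _).
rewrite /xv mulr_sumr; apply: eq_big => [i|i /andP[_ ila]].
  by rewrite ltn_ord below_last.
by rewrite hg ?below_last // clpM clpXU -mulrA clp_scale clp_X.
Qed.

Lemma dir_all_below Q : D la Q = 0 -> dir e D all Q = dir e D B Q.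
Proof.
move=> h; rewrite /dir (bigD1 la) //= h scaler0 add0r; apply: eq_bigl => i.
by rewrite ltn_ord below_last.
Qed.

(** [Xpoly] for an arbitrary algebra in place of the Clifford algebra: only the
    relations of the generators matter. *)
Definition Xp (j k : nat) : V :=
  if j is j'.+1 then
    clp (mu_const m k j *: gegenbauer_hom (m%:R / 2%:R + k%:R - 1) j m)
    + clp ((mu_const m k j *
                (((m + 2 * k)%:R - 2%:R) / ((m + 2 * k + j)%:R - 2%:R)))
               *: gegenbauer_hom (m%:R / 2%:R + k%:R) j' m)
      * ((\sum_(i < m | (i < m.-1)%N) e i *: 'X_i) * (at_last e)%:MP)
  else 1.

Lemma vmul_mpoly Q : (\sum_(i < m | (i < m.-1)%N) e i *: 'X_i) * (at_last e)%:MP * Q = vmul e X B la Q.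
Proof.
rewrite !mulr_suml /vmul; apply: eq_bigr => i _; rewrite (at_lastE hla).
rewrite -scalerAl mpolyX_comm -scalerAl -mulrA mul_mpolyC -mul_mpolyC.
by rewrite -mul_mpolyC XlE -mul_mpolyC mpolyCM -!mulrA.
Qed.

Let Bla : ~~ (la < m.-1)%N. Proof. by rewrite hla ltnn. Qed.

Context (hm : (2 < m)%N).

Let cardB : #|(fun i : 'I_m => (i < m.-1)%N)| = m.-1.
Proof.
rewrite (eq_card (B := predC1 la)) => [|i]; first by rewrite cardC1 card_ord.
by rewrite !inE unfold_in below_last.
Qed.

Local Notation u := (u_la R la).
Local Notation rho := (rho_all R m).
Definition rho_below : {mpoly R[m]} := \sum_(i < m | (i < m.-1)%N) 'X_i * 'X_i.

Lemma rho_split : rho = rho_below + 'X_la * 'X_la.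
Proof.
rewrite /rho_all (bigD1 la) //= addrC expr2; congr (_ + _).
by apply: eq_big => [i|i _]; rewrite ?below_last ?expr2.
Qed.

Lemma rho_u : rho_below *+ 4 = rho *+ 4 - u ^+ 2.
Proof.
rewrite rho_split /u_la expr2 -scalerAl -scalerAr scalerA -natrM scaler_nat mulrnDl.
by rewrite addrK.
Qed.

Let mderivXU' i j : ('X_j)^`M(i) = (i == j)%:R :> {mpoly R[m]}.
Proof. exact: mderivXU. Qed.

Lemma deriv_u i : u^`M(i) = (2 * (i == la)%:R)%:MP.
Proof. by rewrite /u_la mderivZ mderivXU' -mul_mpolyC mpolyCM !mpolyC_nat. Qed.

Lemma deriv_rho i : rho^`M(i) = 2 *: 'X_i.
Proof.
rewrite /rho_all raddf_sum (bigD1 i) //= big1 => [|j ji].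
  by rewrite expr2 mderivM mderivXU' eqxx mul1r mulr1 addr0 -mulr2n scaler_nat.
by rewrite expr2 mderivM mderivXU' eq_sym (negPf ji) mul0r mulr0 addr0.
Qed.

Let gg_mderiv nu n i : (gg u rho nu n)^`M(i) =
  nu *: (gg1 u rho (nu + 1) n * u^`M(i)) - nu *: (gg2 u rho (nu + 1) n * rho^`M(i)).
Proof.
exact: (@gg_deriv _ _ u rho (mderiv i) nu n (mderivD i) (mderivZ i) (mderivM i)).
Qed.

Lemma radial_gg nu n : radial (gg u rho nu n) (- (2 * nu) *: gg2 u rho (nu + 1) n).
Proof.
move=> i; rewrite below_last => /negPf ila; rewrite gg_mderiv deriv_u deriv_rho ila mulr0 mpolyC0 mulr0 scaler0 sub0r.
by rewrite [2 * nu]mulrC scaleNr mulrN -!scalerAr scalerA [gg2 _ _ _ _ * _]mulrC.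
Qed.

Lemma gg_dla nu n : (gg u rho nu n)^`M(la) =
  (2 * nu) *: gg1 u rho (nu + 1) n - nu *: (u * gg2 u rho (nu + 1) n).
Proof.
rewrite gg_mderiv deriv_u deriv_rho eqxx mulr1 mulrC mul_mpolyC scalerA [nu * 2]mulrC.
by rewrite [_ * (2 *: _)]mulrC.
Qed.

Let nuk k : R := m%:R / 2%:R + k%:R - 1.

Let nuk2 k : 2 * nuk k = (m + 2 * k)%:R - 2.
Proof. by rewrite /nuk natrD natrM; field. Qed.

Let ratio k n : ((m + 2 * k)%:R - 2%:R) / ((m + 2 * k + n.+1)%:R - 2%:R) = 2 * nuk k / (2 * nuk k + n.+1%:R) :> R.
Proof. by rewrite nuk2 [(m + 2 * k + n.+1)%:R]natrD [(m + 2 * k)%:R + _ - _]addrAC. Qed.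

Let nuk_gt0 k : 0 < nuk k.
Proof.
rewrite -(@pmulr_rgt0 R 2) // nuk2 subr_gt0 ltr_nat.
by apply: leq_trans hm _; exact: leq_addr.
Qed.

Let den_neq0 k n : 2 * nuk k + n.+1%:R != 0.
Proof. by rewrite gt_eqF // ltr_wpDr ?mulr_gt0. Qed.

Let mu (k j : nat) : R := mu_const m k j.

Let Xg1 k n : {mpoly R[m]} := mu k n.+1 *: gg u rho (nuk k) n.+1.
Let Xg2 k n : {mpoly R[m]} := (mu k n.+1 * (2 * nuk k / (2 * nuk k + n.+1%:R))) *: gg u rho (nuk k + 1) n.

Lemma XpE (n k : nat) Q : Xp n.+1 k * Q = clp (Xg1 k n) * Q + clp (Xg2 k n) * vmul e X B la Q.
Proof.
rewrite /Xp mulrDl -[X in _ = _ + _ * X]vmul_mpoly -[clp _ * _ * Q]mulrA.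
rewrite !(gegenbauer_hom_gg hla) ratio /Xg1 /Xg2.
have -> : nuk k + 1 = m%:R / 2 + k%:R by rewrite /nuk subrK.
by [].
Qed.

Lemma radialZ c g h : radial g h -> radial (c *: g) (c *: h).
Proof. by move=> hg i /hg hi; rewrite mderivZ hi scalerAr. Qed.

Let Bvmul := dirl_vmul e_sqr e_anti (@Dl_Xl A m) (B := B) Bla.

Lemma dir_vmul k Q : dir e D B Q = 0 -> \sum_(i < m | (i < m.-1)%N) X i (D i Q) = Q *+ k ->
  dir e D B (vmul e X B la Q) = - (e la *: (Q *+ (m.-1 + k.*2))).
Proof.
move=> dQ eQ; have := Bvmul Q; rewrite !dirlE dQ scaler0.
have -> : vmul e X B la 0 = 0 by rewrite vmul0.
rewrite addr0 eQ cardB -mulrnA -mulrnDr muln2 => h.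
have := congr1 (fun w => e la *: w) h; rewrite /= scalerA e_sqr scaleN1r => <-.
by rewrite opprK.
Qed.

Lemma D_la_vmul Q : D la Q = 0 -> D la (vmul e X B la Q) = 0.
Proof.
move=> h; rewrite /vmul lin_sumE big1 // => i; rewrite below_last => ila.
by rewrite lin_scaleE Dl_Xl h linear0 eq_sym (negPf ila) mulr0n addr0 scaler0.
Qed.

(** Multiplication by [Xp] preserves monogenicity: the two components of the
    Dirac equation are the Gegenbauer identities. *)
Lemma Xp_monogenic (j k : nat) Q : D la Q = 0 -> dir e D B Q = 0 ->
  \sum_(i < m | (i < m.-1)%N) X i (D i Q) = Q *+ k -> dir e D all (Xp j k * Q) = 0.
Proof.
move=> Dla dQ eQ; case: j => [|n]; first by rewrite mul1r dir_all_below.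
rewrite XpE.
have dirD Q1 Q2 : dir e D all (Q1 + Q2) = dir e D all Q1 + dir e D all Q2.
  by rewrite /dir -big_split; apply: eq_bigr => i _; rewrite linearD scalerDr.
rewrite dirD (dir_clp _ (radialZ _ (radial_gg _ _))) (dir_clp _ (radialZ _ (radial_gg _ _))).
rewrite !dir_all_below ?D_la_vmul // dQ mulr0 addr0 (dir_vmul dQ eQ).
rewrite (e_vmul X e_sqr e_anti (B := B) Bla) (xv_vmul e_sqr e_anti (@Xl_comm A m) (mpoly_char0 (@alg_char0 _ A))).
have -> : \sum_(i < m | (i < m.-1)%N) X i (X i (e la *: Q)) = clp rho_below * (e la *: Q).
  rewrite /rho_below clp_sum mulr_suml; apply: eq_bigr => i _.
  by rewrite clpM clpXU -mulrA.
rewrite -scalerMnr !mderivZ !gg_dla.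
set c := 2 * nuk k / _; set M := mu k n.+1; set nu := nuk k.
have id1 : M *: (- (2 * nu) *: gg2 u rho (nu + 1) n.+1) + (M * c) *: ((2 * (nu + 1)) *: gg1 u rho (nu + 1 + 1) n - (nu + 1) *: (u * gg2 u rho (nu + 1 + 1) n)) = 0.
  by rewrite -[(M * c) *: _]scalerA (gg_dirac1 _ _ (den_neq0 k n)) scaleNr scalerN addNr.
have id2 : M *: ((2 * nu) *: gg1 u rho (nu + 1) n.+1 - nu *: (u * gg2 u rho (nu + 1) n.+1))
   - ((M * c) *: (- (2 * (nu + 1)) *: gg2 u rho (nu + 1 + 1) n)) * rho_below
   - ((M * c) *: gg u rho (nu + 1) n) *+ (m.-1 + k.*2) = 0.
  have := congr1 (GRing.scale M) (gg_dirac2 (den_neq0 k n) rho_u); rewrite scaler0 => id2.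
  rewrite -[RHS]id2 -/nu -/c [RHS]scalerDr [in RHS]scalerDr.
  congr (_ + _ + _).
    by rewrite -scalerAl -scalerAl scaleNr scalerN opprK scalerA scalerA -mulrA [rho_below * _]mulrC.
  rewrite -scaler_nat scalerN scalerA scalerA; congr (- (_ *: _)).
  have -> : (m.-1 + k.*2)%:R = 2 * nu + 1 :> R.
    by rewrite nuk2 -[m in RHS]prednK ?(ltn_trans _ hm) // -mul2n !natrD -natr1; ring.
  ring.
apply: two_component_sum; first by rewrite -clpD id1 clp0.
by rewrite -clpM -!clpN -clpD -clpMn -clpN -clpD id2 clp0.
Qed.

Let mpc0 := mpoly_char0 (n := m) (@alg_char0 _ A).
Local Notation vm := (vmul e X B la).

Lemma rst_XB i Q : (i < m.-1)%N -> rst la (X i Q) = X i (rst la Q).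
Proof. by rewrite below_last => ila; rewrite !XlE rstM rstX (negPf ila). Qed.

Lemma rst_vmul Q : rst la (vm Q) = vm (rst la Q).
Proof.
rewrite /vmul rst_sum; apply: eq_bigr => i hi; by rewrite rstZ rst_XB.
Qed.

Lemma rst_clp g : rst la (clp g) = clp (rst la g).
Proof.
apply/mpolyP => mon; rewrite mcoeff_rst !mcoeff_clp mcoeff_rst.
by case: ifP => //; rewrite rmorph0 scale0r.
Qed.

Lemma iter_vmul_even (l : nat) Q : iter l.*2 vm Q = clp ((-1) ^+ l *: rho_below ^+ l) * Q.
Proof.
elim: l => [|l IH]; first by rewrite scale1r expr0 clp1 mul1r.
rewrite doubleS !iterS IH (vmul_vmul e_sqr e_anti (@Xl_comm A m) mpc0 (B := B) Bla).
have -> P : \sum_(i < m | (i < m.-1)%N) X i (X i P) = clp rho_below * P.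
  rewrite /rho_below clp_sum mulr_suml; apply: eq_bigr => i _.
  by rewrite clpM clpXU -mulrA.
by rewrite mulrA -mulNr -clpM -clpN -scalerAr -exprS [(-1) ^+ l.+1]exprS mulN1r scaleNr.
Qed.

Lemma rst_gg nu n : rst la (gg u rho nu n) = if odd n then 0 else gterm nu 0 n./2 *: rho_below ^+ n./2.
Proof.
rewrite (@gg_vanish _ _ u rho (rst la) nu n (rstD la) (rstZ la) (rstM la) (rst1 _ la)).
  case: ifP => // _; congr (_ *: _ ^+ _).
  rewrite rho_split rstD rstM rstX eqxx mul0r addr0 /rho_below rst_sum.
  by apply: eq_bigr => i; rewrite below_last => /negPf ila; rewrite rstM rstX ila.
by rewrite /u_la rstZ rstX eqxx scaler0.
Qed.

(** The multipliers are the Cauchy-Kovalevskaya extensions of the powers of the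
    vector variable. *)
Lemma rst_Xp (j k : nat) Q : rst la Q = Q -> rst la (Xp j k * Q) = iter j vm Q.
Proof.
move=> hQ; case: j => [|n]; first by rewrite mul1r.
rewrite XpE rstD !rstM !rst_clp rst_vmul hQ /Xg1 /Xg2 !rstZ !rst_gg.
have nu1 : m%:R / 2 + k%:R = nuk k + 1 :> R by rewrite /nuk subrK.
case: (boolP (odd n)) => on.
  rewrite scaler0 clp0 mul0r addr0 /= on /=.
  have [l nE] : exists l, n.+1 = l.*2 by exists n.+1./2; rewrite -[LHS]odd_double_half /= on.
  have uE : uphalf n = l by rewrite -[uphalf n]/(n.+1./2) nE doubleK.
  rewrite uE -iterS nE iter_vmul_even; congr (clp _ * _); rewrite scalerA; congr (_ *: _).
  rewrite /mu /mu_const odd_double doubleK (gegenbauer_at0 hla) -/(nuk k).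
  by rewrite divfK // gterm0_neq0.
rewrite /= on /= scaler0 clp0 mul0r add0r.
have [l nE] : exists l, n = l.*2 by exists n./2; rewrite -[LHS]odd_double_half (negPf on).
rewrite nE doubleK -iterS iterSr iter_vmul_even; congr (clp _ * _).
rewrite scalerA; congr (_ *: _).
rewrite /mu /mu_const /= odd_double uphalf_double (gegenbauer_at0 hla) nu1.
have g0 : gterm (nuk k + 1) 0 l != 0 :> R by rewrite gterm0_neq0 // ltr_wpDr // ltW.
have -> : (m + 2 * k + 2 * l)%:R - 1 = 2 * nuk k + l.*2.+1%:R :> R.
  by rewrite nuk2 natrD -natr1 -mul2n; ring.
rewrite -nuk2.
have n0 : 2 * nuk k != 0 by rewrite gt_eqF // mulr_gt0.
have d0 := den_neq0 k l.*2.
rewrite /=; set s := gterm _ _ _ in g0 *; set d := 2 * nuk k + _ in d0 *; set b := 2 * nuk k in n0 *.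
by field; rewrite d0 n0 g0.
Qed.

Lemma gg_homog nu n : gg u rho nu n \is n.-homog.
Proof.
apply: rpred_sum => i _; case: ifP => hi; last exact: rpred0.
apply: rpredZ.
have uh : u \is 1.-homog by apply: rpredZ; rewrite dhomogX /= mdeg1.
have rh : rho \is 2.-homog.
  by apply: rpred_sum => j _; rewrite (_ : 2 = (1 * 2))%N //; apply: dhomogMn; rewrite dhomogX /= mdeg1.
have := dhomogM (dhomogMn (n - i.*2) uh) (dhomogMn i rh).
by rewrite mul1n mul2n subnK.
Qed.

Section Coefficients.
Context (S : A -> Prop) (S0 : S 0) (SD : forall a b, S a -> S b -> S (a + b)).
Context (SC : forall (c : R[i]) a, S a -> S (c *: a)).
Context (Se : forall i j a, S a -> S (e i * e j * a)).
Local Notation homB := (homS B S).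
Local Notation homA := (homS all S).

Let inv k : A := (k.+1%:R^-1)%:A.
Let invE k (a : A) : (inv k * a) *+ k.+1 = a.
Proof. by rewrite mulr_algl -scaler_nat scalerA divff ?scale1r // pnatr_eq0. Qed.
Let Sinv k a : S a -> S (inv k * a).
Proof. by rewrite mulr_algl; exact: SC. Qed.

Let Ssum (I : Type) (r : seq I) (T : pred I) (F : I -> A) :
  (forall t, T t -> S (F t)) -> S (\sum_(t <- r | T t) F t).
Proof. by move=> h; elim/big_ind: _ => [|x y|t Tt]; [exact: S0|exact: SD|exact: h]. Qed.

Lemma homS_clp (g : {mpoly R[m]}) (j k : nat) Q : g \is j.-homog -> homB k Q -> homA (j + k)%N (clp g * Q).
Proof.
move=> gj hQ mon; split.
  rewrite mcoeffM; apply: Ssum => t _; rewrite mcoeff_clp mulr_algl; apply: SC.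
  exact: (hQ _).1.
move=> nz; split; last by move=> i; rewrite ltn_ord.
apply/eqP; apply: contraT => md; case: nz.
rewrite mcoeffM big1 // => t /eqP tE; rewrite mcoeff_clp.
case: (eqVneq (mdeg (val t.1)) j) => [t1|t1]; last first.
  by rewrite (dhomog_nemf_coeff gj) // rmorph0 scale0r mul0r.
case: (eqVneq Q@_t.2 0) => [->|/eqP /(hQ _).2 [t2 _]]; first by rewrite mulr0.
by case/eqP: md; rewrite (congr1 mdeg tE) mdegD t1 t2.
Qed.

Lemma homS_all_of_below k Q : homB k Q -> homA k Q.
Proof.
move=> hQ mon; split; first exact: (hQ _).1.
by move=> /(hQ _).2 [-> _]; split=> // i; rewrite ltn_ord.
Qed.

Let We k i j Q : homB k Q -> homB k ((e i * e j) *: Q).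
Proof. by apply: homSZ => a; exact: Se. Qed.

Lemma homB_vmul k Q : homB k Q -> homB k.+1 (vm Q).
Proof.
apply: W_vmul => //.
- by move=> k'; exact: homS0.
- by move=> k' P1 P2; exact: homSD.
- by move=> k' i P1; exact: homSX.
Qed.

Lemma homA_Xp (j k k' : nat) Q : homB k Q -> homA (j + k)%N (Xp j k' * Q).
Proof.
case: j => [|n] hQ; first by rewrite mul1r; exact: homS_all_of_below.
rewrite XpE; apply: homSD => //.
  by apply: homS_clp => //; apply: rpredZ; exact: gg_homog.
rewrite addSnnS; apply: homS_clp; last exact: homB_vmul.
by apply: rpredZ; exact: gg_homog.
Qed.

Lemma homB_D_la k Q : homB k Q -> D la Q = 0.
Proof.
move=> hQ; apply/mpolyP => mon; rewrite mcoeffDl mcoeff0.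
case: (eqVneq Q@_(mon + U_(la)) 0) => [->|/eqP /(hQ _).2 [_ /(_ la Bla)]]; first by rewrite mul0rn.
by rewrite mnmDE mnm1E eqxx addn1.
Qed.

Lemma homB_rst k Q : homB k Q -> rst la Q = Q.
Proof. by move=> hQ; apply: rst_id => mon /(hQ _).2 [_ /(_ la Bla)]. Qed.

Lemma rst_homA k P : homA k P -> homB k (rst la P).
Proof.
move=> hP mon; rewrite mcoeff_rst; case: eqP => [m0|//]; split; first exact: (hP _).1.
move=> /(hP _).2 [-> _]; split=> // i; rewrite below_last negbK => /eqP ->.
exact: m0.
Qed.

Local Notation mono T := (mono e S T).

Lemma branch_mem (j k : nat) Q : mono B k Q -> mono all (j + k)%N (Xp j k * Q).
Proof.
case=> hQ dQ; split; first exact: homA_Xp.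
apply: Xp_monogenic => //; first exact: homB_D_la hQ.
exact: homSeul hQ.
Qed.

Let B0 : (0 < #|B|)%N. Proof. by rewrite cardB; case: (m) hm => // -[]. Qed.

Let monogE k Q : mono B k Q <-> monog e D B la homB k Q.
Proof. by split=> -[hQ dQ]; split=> //; apply/(dirl_eq0 D e_sqr B la). Qed.

(** The extensions of the terms of the Fischer decomposition of the restriction have
    the right restriction, and a monogenic polynomial is determined by it. *)
Lemma branch_exists k P : mono all k P ->
  exists2 p : nat -> V, forall j : nat, (j <= k)%N -> mono B (k - j) (p j) &
    P = \sum_(j < k.+1) Xp j (k - j) * p j.
Proof.
case=> hP dP; have hR := rst_homA hP.
have [||||||||p hp pE] := fischer_full e_sqr e_anti (@Dl_Xl A m) mpc0 (B := B) Bla (W := homB) _ _ _ _ _ _ _ _ B0 hR.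
- by move=> k'; exact: homS0.
- by move=> k' P1 P2; exact: homSD.
- by move=> k' i P1; exact: homSX.
- by move=> k' i P1; exact: homSDer.
- by move=> i P1; exact: homS0Der.
- by [].
- by move=> k' c P1; exact: homSdiv invE Sinv _ _ _.
- by move=> k' P1; exact: homSeul.
exists p => [j jk|]; first exact/monogE/hp.
have hp' (j : 'I_k.+1) : mono B (k - j) (p j) by apply/monogE/hp; rewrite -ltnS.
apply/eqP; rewrite -subr_eq0; apply/eqP; apply: (ck_unique (@alg_char0 _ A) (e := e) (la := la) (B := all)) => //.
  have dirN Q1 : dir e D all (- Q1) = - dir e D all Q1.
    by rewrite /dir -sumrN; apply: eq_bigr => i _; rewrite lin_oppE scalerN.
  have dirD Q1 Q2 : dir e D all (Q1 + Q2) = dir e D all Q1 + dir e D all Q2.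
    by rewrite /dir -big_split; apply: eq_bigr => i _; rewrite lin_addE scalerDr.
  have dir0 : dir e D all 0 = 0 by rewrite /dir big1 // => i _; rewrite linear0 scaler0.
  rewrite dirD dirN dP (big_morph _ dirD dir0) big1 ?subrr // => j _.
  exact: (branch_mem j (hp' j)).2.
move=> mon m0; have := congr1 (mcoeff mon) pE; rewrite mcoeff_rst m0 eqxx => E.
rewrite mcoeffB E; apply/eqP; rewrite subr_eq0; apply/eqP.
rewrite !raddf_sum; apply: eq_bigr => j _ /=.
rewrite -(rst_Xp j (k - j) (homB_rst (hp' j).1)).
by rewrite mcoeff_rst m0 eqxx.
Qed.

Lemma branch_direct k (p : nat -> V) : (forall j : nat, (j <= k)%N -> mono B (k - j) (p j)) ->
  \sum_(j < k.+1) Xp j (k - j) * p j = 0 -> forall j : nat, (j <= k)%N -> p j = 0.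
Proof.
move=> hp h0 j jk.
have Wp (t : nat) : (t < k.+1)%N -> monog e D B la homB (k - t) (p t).
  by move=> tk; apply/monogE/hp.
have s0 : \sum_(t < k.+1) iter t vm (p t) = 0.
  have := congr1 (rst la) h0; rewrite rst_sum rst0 => {2}<-; apply: eq_bigr => t _.
  by rewrite rst_Xp //; apply: homB_rst (hp t _).1; rewrite -ltnS.
have W0 k' : homB k' 0 by exact: homS0.
have WD k' P1 P2 : homB k' P1 -> homB k' P2 -> homB k' (P1 + P2) by exact: homSD.
have WX k' i P1 : B i -> homB k' P1 -> homB k'.+1 (X i P1) by exact: homSX.
have WE k' P1 : homB k' P1 -> \sum_(i | B i) X i (D i P1) = P1 *+ k' by exact: homSeul.
exact: (fischer_direct e_sqr e_anti (@Dl_Xl A m) mpc0 Bla W0 WD WX We WE B0 Wp s0 jk).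
Qed.

Lemma Xp_inj (j k : nat) Q : mono B k Q -> Xp j k * Q = 0 -> Q = 0.
Proof.
move=> hQ h0; have := congr1 (rst la) h0; rewrite rst_Xp ?rst0; last exact: homB_rst hQ.1.
have WD k' P1 P2 : homB k' P1 -> homB k' P2 -> homB k' (P1 + P2) by exact: homSD.
have WX k' i P1 : B i -> homB k' P1 -> homB k'.+1 (X i P1) by exact: homSX.
have WE k' P1 : homB k' P1 -> \sum_(i | B i) X i (D i P1) = P1 *+ k' by exact: homSeul.
have W0 k' : homB k' 0 by exact: homS0.
move=> h; have [c] := iter_dirl_vmul e_sqr e_anti (@Dl_Xl A m) Bla W0 WD WX We WE j B0 ((monogE _ _).1 hQ).
by rewrite h iter_dirl0 => /esym/mpc0.
Qed.

End Coefficients.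

Lemma spin_rot_clp g h p q Q : radial g h -> (p < m.-1)%N -> (q < m.-1)%N ->
  spin_rot e X D p q (clp g * Q) = clp g * spin_rot e X D p q Q.
Proof.
move=> hg hp hq; rewrite /spin_rot mulrDr clp_scale; congr (_ + _).
rewrite [in RHS]mulrnAr; congr (_ *+ 2); rewrite /rot_gen mulrBr !D_clp (lin_addE (X q)) (lin_addE (X p)) !hg //.
have -> : X q (clp ('X_p * h) * Q) = X p (clp ('X_q * h) * Q).
  by rewrite !clpM !clpXU -!mulrA -!XlE Xl_comm.
by rewrite !clp_X; exact: rot_mul_sum.
Qed.

Lemma spin_rot_vmul p q Q : (p < m.-1)%N -> (q < m.-1)%N -> p != q ->
  spin_rot e X D p q (vm Q) = vm (spin_rot e X D p q Q).
Proof.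
move=> hp hq pq; rewrite /vmul.
apply: (spin_rot_pairing (Y := fun i => X i) (a := fun i => e i * e la) (B := B)) => //.
  by apply: vector_like_M => //; rewrite -below_last.
by move=> i w; exact: (spin_rotX _ (@Dl_Xl A m) (@Xl_comm A m)).
Qed.

(** The multipliers are built from the last variable, the radius and the vector
    variable, which are invariant under the rotations that fix [la]. *)
Lemma spin_rot_Xp (j k : nat) p q Q : (p < m.-1)%N -> (q < m.-1)%N -> p != q ->
  spin_rot e X D p q (Xp j k * Q) = Xp j k * spin_rot e X D p q Q.
Proof.
move=> hp hq pq; case: j => [|n]; first by rewrite !mul1r.
rewrite !XpE spin_rotD (spin_rot_clp _ (radialZ _ (radial_gg _ _))) // (spin_rot_clp _ (radialZ _ (radial_gg _ _))) //.
by rewrite spin_rot_vmul.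
Qed.

End Branching.

(** * Orthogonal projection *)

Section Projection.
Context (K : numClosedFieldType) (V : zmodType) (sc : K -> V -> V).
Context (sc1 : forall v, sc 1 v = v) (scN1 : forall v, sc (-1) v = - v).

Definition subsp (U : V -> Prop) := U 0 /\ forall c u v, U u -> U v -> U (sc c u + v).

Lemma subspD U u v : subsp U -> U u -> U v -> U (u + v).
Proof. by case=> _ Ulin Uu Uv; rewrite -[u]sc1; exact: Ulin. Qed.

Lemma subspZ U c u : subsp U -> U u -> U (sc c u).
Proof. by case=> U0 Ulin Uu; rewrite -[sc c u]addr0; exact: Ulin. Qed.

Lemma subspN U u : subsp U -> U u -> U (- u).
Proof. by move=> sU Uu; rewrite -scN1; exact: subspZ. Qed.

Context (ip : V -> V -> K).
Context (ipD : forall u v w, ip u (v + w) = ip u v + ip u w).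
Context (ipZ : forall c u v, ip u (sc c v) = c * ip u v).
Context (ipC : forall u v, ip u v = (ip v u)^*).

Lemma ip_orth0 u : ip u 0 = 0.
Proof. by apply: (addrI (ip u 0)); rewrite -ipD !addr0. Qed.

(** Gram-Schmidt, by induction on the number of linear functionals needed to
    separate the points of [U]: no basis of [U] has to be chosen. *)
Lemma orthogonal_projection N (phi : nat -> V -> K) (U : V -> Prop) :
  (forall t v w, phi t (v + w) = phi t v + phi t w) ->
  (forall t c v, phi t (sc c v) = c * phi t v) ->
  subsp U -> (forall u, U u -> ip u u = 0 -> u = 0) ->
  (forall u, U u -> (forall t, (t < N)%N -> phi t u = 0) -> u = 0) ->
  forall v, exists2 u, U u & forall u', U u' -> ip u' (v - u) = 0.
Proof.
move=> phiD phiZ; elim: N U => [|N IH] U sU ip_eq0 sep v.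
  by exists 0 => [|u' /sep ->] //; [exact: sU.1 | rewrite ipC ip_orth0 rmorph0].
have phi0 t : phi t 0 = 0 by apply: (addrI (phi t 0)); rewrite -phiD !addr0.
have phiN t u : phi t (- u) = - phi t u by rewrite -scN1 phiZ mulN1r.
have ipN w u : ip w (- u) = - ip w u by rewrite -scN1 ipZ mulN1r.
pose U' u := U u /\ phi N u = 0.
have sub' : subsp U'.
  split=> [|c u w [Uu pu] [Uw pw]]; first by split; [exact: sU.1 | exact: phi0].
  by split; [exact: sU.2 | rewrite phiD phiZ pu pw mulr0 addr0].
have sep' u : U' u -> (forall t, (t < N)%N -> phi t u = 0) -> u = 0.
  by move=> [Uu pu] h; apply: sep => // t; rewrite ltnS leq_eqVlt => /orP[/eqP -> //|/h].
have {}IH := IH U' sub' (fun u Uu => ip_eq0 u Uu.1) sep'.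
have [[u0 Uu0 pu0]|none] := boolp.pselect (exists2 u, U u & phi N u <> 0); last first.
  have [u [Uu _] hu] := IH v; exists u => // u' Uu'; apply: hu; split=> //.
  by have [//|nz] := eqVneq (phi N u') 0; case: none; exists u' => //; apply/eqP.
have [w [Uw pw] hw] := IH u0; pose u1 := u0 - w.
have Uu1 : U u1 by apply: subspD => //; exact: subspN.
have pu1 : phi N u1 != 0 by rewrite /u1 phiD phiN pw subr0; apply/eqP.
have ip1 : ip u1 u1 != 0.
  by apply/eqP => /(ip_eq0 _ Uu1) u10; move: pu1; rewrite u10 phi0 eqxx.
have [v' Uv' hv] := IH v; pose c := ip u1 v / ip u1 u1.
have orth u' : U' u' -> ip u' u1 = 0 by exact: hw.
exists (sc c u1 + v'); first by apply: sU.2 => //; exact: Uv'.1.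
have E u' : ip u' (v - (sc c u1 + v')) = ip u' (v - v') - c * ip u' u1.
  by rewrite opprD !(ipD, ipN, ipZ); ring.
(* [u'] is a multiple of [u1] up to an element of [U']. *)
move=> u' Uu'; pose b := phi N u' / phi N u1.
have Uu'' : U' (u' - sc b u1).
  split; first by apply: subspD => //; apply: subspN => //; exact: subspZ.
  by rewrite phiD phiN phiZ divfK // subrr.
have ip_l (x y z : V) : ip (x + y) z = ip x z + ip y z.
  by rewrite ipC ipD rmorphD [ip x z]ipC [ip y z]ipC.
have ip_Zl (a : K) x z : ip (sc a x) z = a^* * ip x z.
  by rewrite ipC ipZ rmorphM [ip x z]ipC.
have u1_0 : ip u1 (v - (sc c u1 + v')) = 0.
  by rewrite E divfK // ipD ipN [ip u1 v']ipC (orth v') // rmorph0 subr0 subrr.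
rewrite -[u'](subrK (sc b u1)) ip_l ip_Zl u1_0 mulr0 addr0 E orth // mulr0 subr0.
exact: hv.
Qed.

End Projection.

(** * The Fischer inner product *)

Section FischerProduct.
Context (K : numClosedFieldType) (A : algType K) (n b : nat).
Context (hA : A -> A -> K).
Context (hAD : forall x y z, hA x (y + z) = hA x y + hA x z).
Context (hAZ : forall c x y, hA x (c *: y) = c * hA x y).
Context (hAC : forall x y, hA x y = (hA y x)^*).
Context (hA_ge0 : forall x, 0 <= hA x x) (hA_eq0 : forall x, hA x x = 0 -> x = 0).
Local Notation V := {mpoly A[n]}.
Implicit Types (P Q : V) (u v : 'X_{1..n}) (p q i : 'I_n).

Definition mfac u : nat := \prod_i (u i)`!.

Lemma mfac_gt0 u : (0 < mfac u)%N.
Proof. by apply: prodn_gt0 => i; exact: fact_gt0. Qed.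

Lemma mfacS u q : mfac (u + U_(q)) = (mfac u * (u q).+1)%N.
Proof.
rewrite /mfac (bigD1 q) //= [in RHS](bigD1 q) //= mnmDE mnm1E eqxx addn1 factS.
rewrite [RHS]mulnC mulnA; congr (_ * _)%N.
by apply: eq_bigr => i /negPf iq; rewrite mnmDE mnm1E eq_sym iq addn0.
Qed.

Definition fischer_ip P Q : K := \sum_(u : 'X_{1..n < b}) (mfac u)%:R * hA P@_u Q@_u.

Lemma fischer_ipD P Q Q' : fischer_ip P (Q + Q') = fischer_ip P Q + fischer_ip P Q'.
Proof. by rewrite -big_split; apply: eq_bigr => u _; rewrite mcoeffD hAD mulrDr. Qed.

Lemma fischer_ipZ (c : K) P Q : fischer_ip P (c%:A *: Q) = c * fischer_ip P Q.
Proof.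
rewrite mulr_sumr; apply: eq_bigr => u _.
by rewrite mcoeffZ mulr_algl hAZ mulrCA.
Qed.

Lemma fischer_ipC P Q : fischer_ip P Q = (fischer_ip Q P)^*.
Proof.
rewrite /fischer_ip rmorph_sum; apply: eq_bigr => u _.
by rewrite rmorphM rmorph_nat [in LHS]hAC.
Qed.

Definition bdd P := forall u, P@_u <> 0 -> (mdeg u < b)%N.

Lemma fischer_ip_eq0 P : bdd P -> fischer_ip P P = 0 -> P = 0.
Proof.
move=> hP h; have pos (u : 'X_{1..n < b}) : 0 <= (mfac u)%:R * hA P@_u P@_u.
  by rewrite mulr_ge0 ?ler0n.
apply/mpolyP => u; rewrite mcoeff0; have [//|/eqP/hP hu] := eqVneq P@_u 0.
have /eqP := h; rewrite psumr_eq0 // => /allP/(_ (BMultinom hu) (mem_index_enum _)).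
by rewrite /= mulf_eq0 pnatr_eq0 -leqn0 leqNgt mfac_gt0 => /eqP/hA_eq0.
Qed.

Lemma fischer_ipDl P P' Q : fischer_ip (P + P') Q = fischer_ip P Q + fischer_ip P' Q.
Proof. by rewrite fischer_ipC fischer_ipD rmorphD [fischer_ip P Q]fischer_ipC [fischer_ip P' Q]fischer_ipC. Qed.

Lemma fischer_ip_suml (I : Type) (r : seq I) (F : I -> V) Q :
  fischer_ip (\sum_(t <- r) F t) Q = \sum_(t <- r) fischer_ip (F t) Q.
Proof.
have Z : fischer_ip 0 Q = 0 by rewrite fischer_ipC (ip_orth0 fischer_ipD) rmorph0.
by rewrite (big_morph (fischer_ip^~ Q) (fun P P' => fischer_ipDl P P' Q) Z).
Qed.

Lemma hA0l x : hA 0 x = 0.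
Proof. by rewrite hAC (ip_orth0 hAD) rmorph0. Qed.

Lemma fischer_ip_monomial a u Q : (mdeg u < b)%N -> fischer_ip (a *: 'X_[u]) Q = (mfac u)%:R * hA a Q@_u.
Proof.
move=> hu; rewrite /fischer_ip (bigD1 (BMultinom hu)) //= mcoeffZ mcoeffX eqxx mulr1 big1 ?addr0 // => v.
rewrite -(inj_eq val_inj) /= eq_sym => /negPf vu.
by rewrite mcoeffZ mcoeffX vu mulr0 hA0l mulr0.
Qed.

(** Multiplication by a variable is adjoint to the partial derivative: this is
    what the factorials are for. *)
Lemma fischer_ip_adjoint q P Q : (forall u, P@_u <> 0 -> ((mdeg u).+1 < b)%N) ->
  fischer_ip (Xl A q P) Q = fischer_ip P (Dl A q Q).
Proof.
move=> hP; rewrite {1 2}[P]mpolyE.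
have -> : Xl A q (\sum_(u <- msupp P) P@_u *: 'X_[u]) = \sum_(u <- msupp P) P@_u *: 'X_[(u + U_(q))%MM].
  rewrite (big_morph (Xl A q) (lin_addE (Xl A q)) (linear0 (Xl A q))); apply: eq_bigr => u _.
  by rewrite (lin_scaleE (Xl A q)) XlE -mpolyXD addmC.
rewrite !fischer_ip_suml big_seq [RHS]big_seq; apply: eq_bigr => u.
rewrite mcoeff_msupp => /eqP/hP hu.
rewrite !fischer_ip_monomial ?(ltnW hu) ?mdegD ?mdeg1 ?addn1 // mcoeffDl mfacS natrM -mulrA; congr (_ * _).
by rewrite -[in RHS]scaler_nat hAZ.
Qed.

Context (e : 'I_n -> A).
Context (hAe : forall p q x y, p != q -> hA (e p * e q * x) y = - hA x (e p * e q * y)).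
Local Notation sg := (spin_rot e (@Xl A n) (@Dl A n)).

(** The adjoint of [x_q d_p] is [x_p d_q], and the products of two generators are
    skew by assumption. *)
Lemma fischer_ip_sog p q P Q : p != q -> bdd P -> bdd Q -> fischer_ip (sg p q P) Q = - fischer_ip P (sg p q Q).
Proof.
move=> pq hP hQ.
have fN P1 P2 : fischer_ip P1 (- P2) = - fischer_ip P1 P2.
  by have := fischer_ipZ (-1) P1 P2; rewrite !scaleN1r mulN1r.
have fMn P1 P2 : fischer_ip P1 (P2 *+ 2) = fischer_ip P1 P2 *+ 2 by rewrite !mulr2n fischer_ipD.
have fNl P1 P2 : fischer_ip (- P1) P2 = - fischer_ip P1 P2.
  by rewrite fischer_ipC fN rmorphN [in RHS]fischer_ipC.
have fMnl P1 P2 : fischer_ip (P1 *+ 2) P2 = fischer_ip P1 P2 *+ 2 by rewrite !mulr2n fischer_ipDl.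
have hD i P1 : bdd P1 -> forall u, (Dl A i P1)@_u <> 0 -> ((mdeg u).+1 < b)%N.
  move=> hP1 u; rewrite mcoeffDl => h; have : P1@_(u + U_(i)) <> 0 by move=> h0; rewrite h0 mul0rn in h.
  by move=> /hP1; rewrite mdegD mdeg1 addn1.
have XD i j P1 P2 : bdd P1 -> bdd P2 -> fischer_ip (Xl A i (Dl A j P1)) P2 = fischer_ip P1 (Xl A j (Dl A i P2)).
  move=> h1 h2; rewrite fischer_ip_adjoint; last exact: hD.
  by rewrite fischer_ipC -fischer_ip_adjoint; [rewrite -fischer_ipC | exact: hD].
have E : fischer_ip ((e p * e q) *: P) Q = - fischer_ip P ((e p * e q) *: Q).
  by rewrite /fischer_ip -sumrN; apply: eq_bigr => u _; rewrite !mcoeffZ hAe // mulrN.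
have R : fischer_ip (rot_gen (@Xl A n) (@Dl A n) p q P) Q = - fischer_ip P (rot_gen (@Xl A n) (@Dl A n) p q Q).
  by rewrite /rot_gen fischer_ipDl fNl !XD // fischer_ipD fN opprB addrC.
by rewrite /spin_rot fischer_ipDl fMnl E R [in RHS](fischer_ipD P (_ *: Q)) fMn opprD mulNrn.
Qed.

End FischerProduct.

(** * Extremal vectors and irreducibility *)

Section Extremal.
Context (K : numClosedFieldType) (A : algType K) (n : nat) (e : 'I_n -> A).
Context (e_sqr : forall i, e i * e i = -1).
Context (e_anti : forall i j, i != j -> e i * e j = - (e j * e i)).
Context (B : pred 'I_n) (i0 i1 i2 : 'I_n) (n01 : i0 != i1) (n20 : i2 != i0) (n21 : i2 != i1).
Context (B0 : B i0) (B1 : B i1) (B2 : B i2).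
Context (S : A -> Prop) (S0 : S 0) (SD : forall a b, S a -> S b -> S (a + b)).
Context (SC : forall (c : K) a, S a -> S (c *: a)).
Context (Se : forall i j a, S a -> S (e i * e j * a)).
Local Notation V := {mpoly A[n]}.
Local Notation X := (@Xl A n).
Local Notation D := (@Dl A n).
Local Notation sg := (spin_rot e X D).
Local Notation im := ('i%:A : A).
Local Notation F := (null_vec e i0 i1 im).
Local Notation z := (zl X i0 i1 im).
Local Notation up := (raise e X D i0 i1 im).
Local Notation W := (homS B S).
Implicit Types (i p q : 'I_n) (P Q : V) (U : V -> Prop).

Let imC (x : A) : im * x = x * im. Proof. by rewrite mulr_algl mulr_algr. Qed.
Let im2 : im * im = -1 :> A.
Proof. by rewrite mulr_algl scalerA -expr2 sqrCi scaleN1r. Qed.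
Let c0 := mpoly_char0 (n := n) (@alg_char0 _ A).

Let W0 k : W k 0. Proof. exact: homS0. Qed.
Let WD k P Q : W k P -> W k Q -> W k (P + Q). Proof. exact: homSD. Qed.
Let WC k c P : W k P -> W k (c%:A *: P).
Proof. by apply: homSZ => a Sa; rewrite mulr_algl; exact: SC. Qed.
Let We k i j P : W k P -> W k ((e i * e j) *: P).
Proof. by apply: homSZ => a; exact: Se. Qed.
Let WX k i P : B i -> W k P -> W k.+1 (X i P). Proof. exact: homSX. Qed.
Let WDer k i P : B i -> W k.+1 P -> W k (D i P). Proof. exact: homSDer. Qed.
Let W0Der i P : B i -> W 0 P -> D i P = 0. Proof. exact: homS0Der. Qed.
Let WE k P : W k P -> \sum_(i | B i) X i (D i P) = P *+ k. Proof. exact: homSeul. Qed.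
Let Wdiv k t P : W k P -> exists2 Q, W k Q & Q *+ t.+1 = P.
Proof.
apply: (@homSdiv A n B S (fun t => (t.+1%:R^-1 : K)%:A)) => [j a|j a Sa].
  by rewrite mulr_algl -scaler_nat scalerA divff ?scale1r // pnatr_eq0.
by rewrite mulr_algl; exact: SC.
Qed.

Definition rot_stable U := subsp (fun (c : K) P => c%:A *: P) U /\
  forall p q P, B p -> B q -> p != q -> U P -> U (sg p q P).

Let scE : (forall P, (1 : K)%:A *: P = P) /\ (forall P, (-1 : K)%:A *: P = - P).
Proof. by split=> P; rewrite ?scaleNr !scale1r // scaleN1r. Qed.

Lemma rot_stable_ext U U' : (forall P, U P <-> U' P) -> rot_stable U -> rot_stable U'.
Proof.
move=> E [[U0 Ulin] Urot]; split; first split=> [|c P Q /E UP /E UQ].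
- exact/E.
- by apply/E; exact: Ulin.
by move=> p q P Bp Bq pq /E UP; apply/E; exact: Urot.
Qed.

Lemma rot_stableD U P Q : rot_stable U -> U P -> U Q -> U (P + Q).
Proof. by case=> sU _; apply: subspD sU; exact: scE.1. Qed.

Lemma rot_stableZ U c P : rot_stable U -> U P -> U (c%:A *: P).
Proof. by case=> sU _; exact: (subspZ c sU). Qed.

Lemma rot_stableP U : rot_stable U <-> subsp (fun (c : K) P => c%:A *: P) U /\
  forall p q P, B p -> B q -> (p < q)%N -> U P -> U (sg p q P).
Proof.
split=> -[sU hU]; split=> // p q P Bp Bq pq UP.
  by apply: hU => //; rewrite -(inj_eq val_inj) neq_ltn pq.
have : (p != q :> nat) by rewrite (inj_eq val_inj).
rewrite neq_ltn => /orP[pq'|qp]; first exact: hU.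
have UN Q : U Q -> U (- Q) by rewrite -scE.2; exact: (subspZ _ sU).
have -> : sg p q P = - sg q p P by apply: (spin_rot_swap X D e_anti); rewrite eq_sym.
by apply: UN; exact: hU.
Qed.

(** Local nilpotency holds on constants and survives the multiplication by the
    variables. *)
Lemma raise_mpoly_nil q P : q != i0 -> q != i1 -> raise_nil e X D i0 i1 im q P.
Proof.
move=> q0 q1; elim/mpolyind: P => [|c u P _ _ IH].
  by exists 0%N.
apply: raise_nilD => //.
have [k] := ubnP (mdeg u); elim: k u => // k IHk u; rewrite ltnS => uk.
case: (pickP (fun i => u i != 0%N)) => [i ui|u0]; last first.
  have -> : u = 0%MM by apply/mnmP => i; rewrite mnm0E; apply/eqP/negbFE/u0.
  apply: (raise_nil_const X e_sqr e_anti n01 imC im2) => // i.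
  by rewrite mpolyX0 lin_scaleE DlE mderivC scaler0.
have uE : u = (U_(i) + (u - U_(i)))%MM by rewrite addmC submK // lep1mP.
have -> : c *: 'X_[u] = X i (c *: 'X_[(u - U_(i))%MM]) by rewrite lin_scaleE XlE -mpolyXD -uE.
apply: (raise_nilX (@Dl_Xl A n) (@Xl_comm A n) n01 imC im2) => //; apply: IHk.
by apply: leq_trans uk; rewrite [in X in (_ < X)%N]uE mdegD mdeg1.
Qed.

Lemma raise_stable U q P : B q -> q != i0 -> q != i1 -> rot_stable U -> U P -> U (up q P).
Proof.
move=> Bq q0 q1 hU UP; apply: rot_stableD => //; first by apply: hU.2; rewrite // eq_sym.
by apply: rot_stableZ => //; apply: hU.2; rewrite // eq_sym.
Qed.

(** Commuting, locally nilpotent operators have a common kernel. *)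
Lemma common_kernel U (l : seq 'I_n) P : uniq l -> {in l, forall q, [&& B q, q != i0 & q != i1]} ->
  rot_stable U -> U P -> P <> 0 ->
  exists Q, [/\ U Q, Q <> 0 & {in l, forall q, up q Q = 0}].
Proof.
move=> + + hU UP P0; elim: l => [|q l IH] /= => [_ _|/andP[ql ul] hl].
  by exists P.
have [|Q [UQ Q0 hQ]] := IH ul; first by move=> r rl; apply: hl; rewrite inE rl orbT.
have /and3P[Bq q0 q1] := hl q (mem_head _ _).
have [t] := raise_mpoly_nil Q q0 q1; elim: t Q UQ Q0 hQ => [//|t IHt] Q UQ Q0 hQ Qt.
have [E|/eqP ne] := eqVneq (up q Q) 0.
  by exists Q; split=> // r; rewrite inE => /predU1P[->|/hQ].
apply: (IHt (up q Q)) => //; first exact: raise_stable.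
  move=> r rl; have /and3P[Br r0 r1] := hl r (mem_behead (s := q :: l) rl).
  rewrite (raise_comm e_sqr e_anti (@Dl_Xl A n) (@Xl_comm A n) (@Dl_comm A n) n01 imC im2) ?hQ //.
    exact: raise0.
  by apply: contraNneq ql => <-.
by rewrite -iterSr.
Qed.

(** A vector of the common kernel is extremal, hence a power of the null coordinate
    times a constant. *)
Lemma raise_kernel k Q : mono e S B k Q -> (forall q, B q -> q != i0 -> q != i1 -> up q Q = 0) ->
  exists s, [/\ S s, F * s = 0 & Q = iter k z s%:MP].
Proof.
move=> [WQ dQ] hQ.
have WI j Q1 : W j Q1 -> W j (im *: Q1) by exact: WC.
have xQ : extremal e D B i0 i1 im Q.
  apply: (extremalP e_sqr e_anti (@Dl_Xl A n) (@Dl_comm A n) c0 n01 n20 n21 B0 B1 B2 imC im2 WD WI WDer W0Der WE _ WQ dQ hQ).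
  by move=> Q1; exact: zl_mpoly_inj.
have [s [Ws Fs sE]] := extremal_power (@Dl_comm A n) c0 n01 B0 B1 imC im2 WD WI WDer Wdiv WE WQ xQ.
have sC : s = (s@_0%MM)%:MP.
  apply/mpolyP => u; rewrite mcoeffC; have [->|u0] := eqVneq u 0%MM; first by rewrite mulr1.
  rewrite mulr0; have [//|/eqP/(Ws u).2 [/eqP]] := eqVneq s@_u 0.
  by rewrite mdeg_eq0 (negPf u0).
exists s@_0%MM; split; [exact: (Ws _).1 | by rewrite -mcoeffZ Fs mcoeff0 | by rewrite -sC].
Qed.

Lemma ex_extremal U k P : rot_stable U -> (forall Q, U Q -> mono e S B k Q) -> U P -> P <> 0 ->
  exists s, [/\ S s, s <> 0, F * s = 0 & U (iter k z s%:MP)].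
Proof.
move=> hU hm UP P0.
have [||Q [UQ Q0 hQ]] := common_kernel (l := [seq q <- enum 'I_n | [&& B q, q != i0 & q != i1]]) _ _ hU UP P0.
- by rewrite filter_uniq ?enum_uniq.
- by move=> q; rewrite mem_filter => /andP[].
have [|s [Ss Fs sE]] := raise_kernel (hm _ UQ).
  by move=> q Bq q0 q1; apply: hQ; rewrite mem_filter Bq q0 q1 mem_enum.
exists s; split; rewrite -?sE // => h; apply: Q0; rewrite sE h mpolyC0.
by elim: (k) => //= j ->; exact: zl0.
Qed.

Let Dconst i (a : A) : D i (a%:MP) = 0. Proof. by rewrite DlE mderivC. Qed.
Let mpolyCM (a b : A) : (a * b)%:MP = a *: (b%:MP) :> V.
Proof. by rewrite -mul_mpolyC -mpolyCM. Qed.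

Let F_const s : F * s = 0 -> F *: (s%:MP : V) = 0.
Proof. by move=> Fs; rewrite -mpolyCM Fs mpolyC0. Qed.

Let extremal_power_const k s : F * s = 0 -> extremal e D B i0 i1 im (iter k z s%:MP).
Proof.
move=> /F_const Fs.
by apply: (extremal_iter (@Dl_Xl A n) n01 B0 B1 imC im2 k Fs) => i _; exact: Dconst.
Qed.

Lemma iter_zl_mono k s : S s -> F * s = 0 -> mono e S B k (iter k z s%:MP).
Proof.
move=> Ss Fs; elim: k => [|k [IHW IHd]].
  split; last by rewrite /dir big1 // => i _; rewrite Dconst scaler0.
  move=> u; rewrite mcoeffC; have [->|u0] := eqVneq u 0%MM.
    by rewrite mulr1 mdeg0; split=> // _; split=> // i _; rewrite mnm0E.
  by rewrite mulr0.
split; first by rewrite iterS /zl; apply: WD; [exact: WX|apply: WC; exact: WX].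
have [Fk _ _] := extremal_power_const k Fs.
by rewrite iterS (dir_zl e (@Dl_Xl A n) B0 B1 imC) Fk IHd addr0 zl0.
Qed.

Let dirD P Q : dir e D B (P + Q) = dir e D B P + dir e D B Q.
Proof. by rewrite /dir -big_split; apply: eq_bigr => i _; rewrite lin_addE scalerDr. Qed.

Let dirZ (c : K) P : dir e D B (c%:A *: P) = c%:A *: dir e D B P.
Proof.
rewrite /dir scaler_sumr; apply: eq_bigr => i _.
by rewrite lin_scaleE !scalerA mulr_algl mulr_algr.
Qed.

Lemma mono_stable k : rot_stable (mono e S B k).
Proof.
split; first split=> [|c P Q [hP dP] [hQ dQ]].
- split; first exact: W0.
  by rewrite /dir big1 // => i _; rewrite linear0 scaler0.
- by split; [apply: WD => //; exact: WC | rewrite dirD dirZ dP dQ scaler0 addr0].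
- move=> p q P Bp Bq pq [hP dP]; split; last first.
    by rewrite (spin_rot_dir e_sqr e_anti (@Dl_Xl A n) (@Dl_comm A n) P Bp Bq pq) dP spin_rot0.
  have WN Q : W k Q -> W k (- Q) by rewrite -scE.2; exact: WC.
  have WXD i j : B i -> B j -> W k (X i (D j P)).
    case: (k) hP => [|k'] hP Bi Bj; first by rewrite W0Der ?linear0.
    by apply: WX => //; exact: WDer.
  rewrite /spin_rot mulr2n; apply: WD; first exact: We.
  by apply: WD; (apply: WD; [exact: WXD|apply: WN; exact: WXD]).
Qed.

Lemma iter_zl_neq0 k s : s <> 0 -> iter k z s%:MP <> 0 :> V.
Proof.
move=> s0; elim: k => [|k IH] /=; first by move/eqP; rewrite mpolyC_eq0 => /eqP.
by move=> /(zl_mpoly_inj n01).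
Qed.

Lemma iter_zl_raise k s q : F * s = 0 -> B q -> q != i0 -> q != i1 -> up q (iter k z s%:MP) = 0.
Proof.
move=> /(extremal_power_const k) h Bq q0 q1.
exact: (raise_extremal X e_anti imC q0 q1 Bq h).
Qed.

Lemma iter_zl_weight k s : F * s = 0 ->
  sg i0 i1 (iter k z s%:MP) = (- ('i *+ k.*2.+1))%:A *: iter k z s%:MP.
Proof.
move=> /F_const Fs.
rewrite (weight_iter e_sqr e_anti (@Dl_Xl A n) (@Xl_comm A n) n01 B0 B1 imC im2 k Fs) //.
by rewrite scaleNr -scalerMnl scaleNr -scalerMnl mulNrn.
Qed.

(** If the null vector does not kill [s], it kills its own image; the factor [e i2]
    makes this image even. *)
Lemma ex_null_spinor : (exists2 s, S s & s <> 0) -> exists s, [/\ S s, s <> 0 & F * s = 0].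
Proof.
case=> s Ss s0; have [Fs|Fs] := eqVneq (F * s) 0; first by exists s.
exists (e i2 * (F * s)); split.
- rewrite mulrA mulrDr mulrDl mulr_algl -scalerAr -scalerAl.
  by apply: SD; [exact: Se|apply: SC; exact: Se].
- move=> h; have : (e i2 * e i2) * (F * s) = 0 by rewrite -mulrA h mulr0.
  by rewrite e_sqr mulN1r => /eqP; rewrite oppr_eq0 (negPf Fs).
rewrite mulrA null_vec_anti // mulNr -!mulrA [F * (F * _)]mulrA null_vec_sqr //.
by rewrite mul0r mulr0 oppr0.
Qed.

Section Irreducible.
Context (irr : forall T : A -> Prop, T 0 -> (forall (c : K) a b, T a -> T b -> T (c *: a + b)) ->
  (forall a, T a -> S a) ->
  (forall p q a, B p -> B q -> p != q -> T a -> T (e p * e q * a)) ->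
  (exists2 a, T a & a <> 0) -> forall a, S a -> T a).

(** One extremal vector gives them all: the spinors [t] with [iter k z t] in [U]
    form a module [T] under the rotations that fix the plane of [i0] and [i1],
    and [T + e i0 * e i2 * T] is a module under all rotations, hence equal to
    [S]. *)
Lemma all_extremal U k s : rot_stable U -> S s -> s <> 0 -> F * s = 0 -> U (iter k z s%:MP) ->
  forall t, S t -> F * t = 0 -> U (iter k z t%:MP).
Proof.
move=> hU Ss s0 Fs Us; pose T t := [/\ S t, F * t = 0 & U (iter k z t%:MP)].
have TC c a b : T a -> T b -> T (c *: a + b).
  move=> [Sa Fa Ua] [Sb Fb Ub]; split; first by apply: SD => //; exact: SC.
    by rewrite mulrDr -scalerAr Fa Fb scaler0 addr0.
  have -> : iter k z (c *: a + b)%:MP = c%:A *: iter k z a%:MP + iter k z b%:MP.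
    elim: (k) => /= [|j ->]; first by rewrite mpolyCD -mpolyCM mulr_algl.
    by rewrite zlD zlZ.
  by apply: rot_stableD => //; exact: rot_stableZ.
have T0 : T 0.
  split=> //; first by rewrite mulr0.
  have -> : iter k z (0 : A)%:MP = 0 by elim: (k) => /= [|j ->]; rewrite ?mpolyC0 ?zl0.
  by have [[]] := hU.
have TD a b : T a -> T b -> T (a + b) by move=> Ta Tb; rewrite -[a]scale1r; exact: TC.
have TZ c a : T a -> T (c *: a) by move=> Ta; rewrite -[c *: a]addr0; exact: TC.
have TN a : T a -> T (- a) by rewrite -scaleN1r; exact: TZ.
pose Q p := [&& B p, p != i0 & p != i1].
have Te p q a : Q p -> Q q -> T a -> T (e p * (e q * a)).
  move=> /and3P[Bp p0 p1] /and3P[Bq q0 q1] Ta.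
  have [->|pq] := eqVneq p q; first by rewrite mulrA e_sqr mulN1r; exact: TN.
  have [Sa Fa Ua] := Ta; rewrite mulrA; split; first exact: Se.
    rewrite mulrA [F * _]mulrA null_vec_anti // mulNr -mulrA null_vec_anti // mulrN opprK.
    by rewrite -!mulrA Fa !mulr0.
  have -> : iter k z (e p * e q * a)%:MP = sg p q (iter k z a%:MP).
    elim: (k) => /= [|j ->].
      by rewrite mpolyCM /spin_rot /rot_gen !Dconst (linear0 (X q)) (linear0 (X p)) subrr mul0rn addr0.
    by rewrite (spin_rot_zl e (@Dl_Xl A n) (@Xl_comm A n) imC).
  by apply: hU.2.
have Q2 : Q i2 by rewrite /Q B2 n20 n21.
have e1 a : F * a = 0 -> e i1 * a = e i0 * ('i *: a).
  rewrite mulrDl mulr_algl -scalerAl => /eqP; rewrite addr_eq0 => /eqP h.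
  by rewrite -scalerAr h scalerN scalerA -expr2 sqrCi scaleN1r opprK.
(* Each generator exchanges [G] and [G'], so that products of two preserve [G]. *)
pose G a := exists t t', [/\ T t, T t' & a = t + e i0 * (e i2 * t')].
pose G' a := exists t t', [/\ T t, T t' & a = e i2 * t + e i0 * t'].
have Bcases p : B p -> [\/ p = i0, p = i1 | Q p].
  move=> Bp; have [->|p0] := eqVneq p i0; first by constructor 1.
  by have [->|p1] := eqVneq p i1; [constructor 2|constructor 3; rewrite /Q Bp p0 p1].
have anti p q a : p != q -> e p * (e q * a) = - (e q * (e p * a)).
  by move=> pq; rewrite mulrA e_anti // mulNr mulrA.
have sq p a : e p * (e p * a) = - a by rewrite mulrA e_sqr mulN1r.
have GG' p a : B p -> G a -> G' (e p * a).
  move=> Bp [t [t' [Tt Tt' ->]]]; have [_ Ft _] := Tt; have [_ Ft' _] := Tt'.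
  have [->|->|Qp] := Bcases p Bp.
  - exists (- t'), t; split=> //; first exact: TN.
    by rewrite mulrDr sq mulrN addrC.
  - exists ('i *: t'), ('i *: t); split; [exact: TZ|exact: TZ|].
    rewrite mulrDr e1 // (anti i1 i0) 1?eq_sym // (anti i1 i2) 1?eq_sym // e1 //.
    by rewrite (anti i2 i0) // !mulrN opprK sq opprK addrC.
  - exists (- (e i2 * (e p * t))), (- (e p * (e i2 * t'))); split; [exact/TN/Te|exact/TN/Te|].
    have /and3P[_ p0 _] := Qp.
    by rewrite mulrDr (anti p i0) // !mulrN sq opprK.
have G'G p a : B p -> G' a -> G (e p * a).
  move=> Bp [t [t' [Tt Tt' ->]]]; have [_ Ft _] := Tt; have [_ Ft' _] := Tt'.
  have [->|->|Qp] := Bcases p Bp.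
  - exists (- t'), t; split=> //; first exact: TN.
    by rewrite mulrDr sq addrC.
  - exists ('i *: t'), ('i *: t); split; [exact: TZ|exact: TZ|].
    rewrite mulrDr (anti i1 i0) 1?eq_sym // (anti i1 i2) 1?eq_sym // !e1 //.
    by rewrite (anti i2 i0) // opprK sq opprK addrC.
  - exists (e p * (e i2 * t)), (e i2 * (e p * t')); split; [exact: Te|exact: Te|].
    have /and3P[_ p0 _] := Qp.
    by rewrite mulrDr (anti p i0) // sq mulrN.
have GS a : S a -> G a.
  apply: irr.
  - by exists 0, 0; split=> //; rewrite !mulr0 addr0.
  - move=> c a1 b1 [t [t' [Tt Tt' ->]]] [u [u' [Tu Tu' ->]]].
    exists (c *: t + u), (c *: t' + u'); split; [exact: TC|exact: TC|].
    by rewrite scalerDr !mulrDr !scalerAr addrACA.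
  - move=> a1 [t [t' [[St _ _] [St' _ _] ->]]]; apply: SD => //.
    by rewrite mulrA; exact: Se.
  - by move=> p q a1 Bp Bq _ Ga; rewrite -mulrA; apply: G'G => //; exact: GG'.
  - by exists s => //; exists s, 0; split=> //; rewrite !mulr0 addr0.
(* On [e i0 * e i2 * T] the null vector is invertible. *)
move=> t St Ft; have [u [u' [Tu Tu' tE]]] := GS t St.
have [_ Fu Uu] := Tu; have [_ Fu' _] := Tu'.
suff u'0 : u' = 0 by rewrite tE u'0 !mulr0 addr0.
have := Ft; rewrite tE mulrDr Fu add0r.
have Fe0 a : F * (e i0 * a) = - (e i0 * (F * a)) - a *+ 2.
  rewrite /null_vec !mulrDl !mulr_algl -!scalerAl [e i0 * (_ + _)]mulrDr -scalerAr sq (anti i1 i0) 1?eq_sym //.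
  by rewrite scalerN mulr2n !opprD opprK; zmod.
rewrite Fe0 [F * (e i2 * u')]mulrA null_vec_anti // mulNr -mulrA Fu' !mulr0 oppr0 mulr0 oppr0 add0r.
move=> /eqP; rewrite oppr_eq0 => /eqP/(@alg_char0 _ A 1) h.
by rewrite -[u']opprK -(sq i2 u') h mulr0 oppr0.
Qed.

Context (hA : A -> A -> K).
Context (hAD : forall x y w, hA x (y + w) = hA x y + hA x w).
Context (hAZ : forall c x y, hA x (c *: y) = c * hA x y).
Context (hAC : forall x y, hA x y = (hA y x)^*).
Context (hA_ge0 : forall x, 0 <= hA x x) (hA_eq0 : forall x, hA x x = 0 -> x = 0).
Context (hAe : forall p q x y, p != q -> hA (e p * e q * x) y = - hA x (e p * e q * y)).
Context (J : finType) (crd : J -> A -> K).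
Context (crdD : forall t x y, crd t (x + y) = crd t x + crd t y).
Context (crdZ : forall t c x, crd t (c *: x) = c * crd t x).
Context (crd_inj : forall x, (forall t, crd t x = 0) -> x = 0).

(** A proper submodule and its orthogonal complement would share the extremal
    vectors. *)
Lemma mono_irreducible k U : rot_stable U -> (forall P, U P -> mono e S B k P) ->
  (exists2 P, U P & P <> 0) -> forall P, mono e S B k P -> U P.
Proof.
move=> hU Um [P1 UP1 P1_0] P hP.
pose ip := fischer_ip (n := n) k.+1 hA.
have bd Q : mono e S B k Q -> bdd k.+1 Q by move=> [hQ _] u /(hQ u).2 [-> _].
pose phi t (Q : V) : K := if insub t is Some j then
   let x := enum_val (j : 'I_#|{: 'X_{1..n < k.+1} * J}|) in crd x.2 Q@_x.1 else 0.
have phiD t Q Q' : phi t (Q + Q') = phi t Q + phi t Q'.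
  by rewrite /phi; case: insub => [j|]; rewrite ?addr0 // mcoeffD crdD.
have phiZ t (c : K) Q : phi t (c%:A *: Q) = c * phi t Q.
  by rewrite /phi; case: insub => [j|]; rewrite ?mulr0 // mcoeffZ mulr_algl crdZ.
have pos Q : U Q -> ip Q Q = 0 -> Q = 0 by move=> /Um/bd bQ; exact: fischer_ip_eq0.
have sep Q : U Q -> (forall t, (t < #|{: 'X_{1..n < k.+1} * J}|)%N -> phi t Q = 0) -> Q = 0.
  move=> /Um/bd bQ h; apply/mpolyP => w; rewrite mcoeff0.
  have [//|/eqP/bQ wk] := eqVneq Q@_w 0; apply: crd_inj => t.
  have := h (enum_rank (BMultinom wk, t)) (ltn_ord _).
  by rewrite /phi valK enum_rankK.
have [u Uu orth] := orthogonal_projection scE.1 scE.2 (fischer_ipD k.+1 hAD) (fischer_ipZ k.+1 hAZ) (fischer_ipC k.+1 hAC)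
  phiD phiZ hU.1 pos sep P.
pose Q := P - u.
have mN : mono e S B k (- u).
  by rewrite -scE.2; apply: rot_stableZ; [exact: mono_stable | exact: Um].
have mQ : mono e S B k Q by apply: rot_stableD => //; exact: mono_stable.
have [/eqP|/eqP Q0] := eqVneq Q 0; first by rewrite subr_eq0 => /eqP ->.
pose U' R := mono e S B k R /\ forall u', U u' -> ip u' R = 0.
have hU' : rot_stable U'.
  have [[m0 mlin] mrot] := mono_stable k.
  split; first split=> [|c R R' [mR oR] [mR' oR']].
  - by split=> // u' _; exact: (ip_orth0 (fischer_ipD k.+1 hAD)).
  - split=> [|u' Uu']; first exact: mlin.
    by rewrite /ip fischer_ipD // fischer_ipZ // -/ip oR // oR' // mulr0 addr0.
  - move=> p q R Bp Bq pq [mR oR]; split=> [|u' Uu']; first exact: mrot.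
    have /eqP := fischer_ip_sog hAD hAZ hAC hAe pq (bd _ (Um _ Uu')) (bd _ mR).
    rewrite -/ip [ip (sg p q u') R]oR; last exact: hU.2.
    by rewrite eq_sym oppr_eq0 => /eqP.
have [s [Ss s0 Fs Us]] := ex_extremal hU Um UP1 P1_0.
have [s' [Ss' s'0 Fs' Us']] := ex_extremal hU' (fun R h => h.1) (conj mQ orth) Q0.
have [mR] := all_extremal hU' Ss' s'0 Fs' Us' Ss Fs.
move=> /(_ _ Us)/(fischer_ip_eq0 hA_ge0 hA_eq0 (bd _ mR)).
by move/(iter_zl_neq0 s0).
Qed.

End Irreducible.

End Extremal.

(** * The branches *)

Section Branches.
Context (R : realType) (A : algType R[i]) (m : nat) (e : 'I_m -> A).
Context (e_sqr : forall i, e i * e i = -1).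
Context (e_anti : forall i j, i != j -> e i * e j = - (e j * e i)).
Context (la : 'I_m) (hla : la = m.-1 :> nat) (hm : (3 < m)%N).
Context (S : A -> Prop) (S0 : S 0) (SD : forall a b, S a -> S b -> S (a + b)).
Context (SC : forall (c : R[i]) a, S a -> S (c *: a)).
Context (Se : forall i j a, S a -> S (e i * e j * a)).
Local Notation V := {mpoly A[m]}.
Local Notation X := (@Xl A m).
Local Notation D := (@Dl A m).
Local Notation B := (fun i : 'I_m => (i < m.-1)%N).
Local Notation all := (fun i : 'I_m => (i < m)%N).
Local Notation sg := (spin_rot e X D).
Implicit Types (p q : 'I_m) (P Q : V) (U : V -> Prop).

Let hm2 : (2 < m)%N. Proof. exact: ltnW. Qed.
Let i0 : 'I_m := Ordinal (ltn_trans (isT : 0 < 3)%N hm).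
Let i1 : 'I_m := Ordinal (ltn_trans (isT : 1 < 3)%N hm).
Let i2 : 'I_m := Ordinal (ltn_trans (isT : 2 < 3)%N hm).
Let n01 : i0 != i1. Proof. by []. Qed.
Let n20 : i2 != i0. Proof. by []. Qed.
Let n21 : i2 != i1. Proof. by []. Qed.
Let hm1 : (2 < m.-1)%N. Proof. by case: (m) hm. Qed.
Let B0 : B i0. Proof. exact: ltn_trans hm1. Qed.
Let B1 : B i1. Proof. exact: ltn_trans hm1. Qed.
Let B2 : B i2. Proof. exact: hm1. Qed.
Local Notation im := ('i%:A : A).
Local Notation up := (raise e X D i0 i1 im).

(** [Xmonogenic] for an arbitrary algebra in place of the Clifford algebra. *)
Definition branch k (j : nat) P := exists2 Q, mono e S B (k - j) Q & P = Xp e j (k - j) * Q.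

Lemma mul_central (c : R[i]) P Q : P * (c%:A *: Q) = c%:A *: (P * Q).
Proof.
rewrite -!mul_mpolyC !mulrA; congr (_ * _).
by rewrite mpolyC_comm // => a; exact: alg_comm.
Qed.

Lemma branch_stable k j : rot_stable e B (branch k j).
Proof.
have [[m0 mlin] mrot] := mono_stable e_sqr e_anti B S0 SD SC Se (k - j).
split; first split=> [|c P P' [Q mQ ->] [Q' mQ' ->]].
- by exists 0 => //; rewrite mulr0.
- exists (c%:A *: Q + Q'); first exact: mlin.
  by rewrite mulrDr mul_central.
move=> p q P Bp Bq pq [Q mQ ->]; exists (sg p q Q); first exact: mrot.
exact: (spin_rot_Xp e_sqr e_anti hla).
Qed.

Lemma branch_direct_sum k :
  (forall P, mono e S all k P <-> exists2 Q : 'I_k.+1 -> V, (forall j : 'I_k.+1, branch k j (Q j)) & P = \sum_j Q j) /\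
  (forall Q : 'I_k.+1 -> V, (forall j : 'I_k.+1, branch k j (Q j)) -> \sum_j Q j = 0 -> forall j : 'I_k.+1, Q j = 0).
Proof.
split=> [P|Q hQ Q0 j].
  split=> [/(branch_exists e_sqr e_anti hla hm2 S0 SD SC Se)[p hp ->]|[Q hQ ->]].
    exists (fun j : 'I_k.+1 => Xp e j (k - j) * p j) => // j.
    by exists (p j) => //; apply: hp; rewrite -ltnS.
  have hst := mono_stable e_sqr e_anti all S0 SD SC Se k.
  elim/big_ind: _ => [|P1 P2|j _]; [exact: hst.1.1|exact: (rot_stableD hst)|].
  have [p hp ->] := hQ j.
  have := branch_mem e_sqr e_anti hla hm2 S0 SD SC Se j hp.
  by rewrite subnKC // -ltnS.
have [p hp Qp] := fin_all_exists2 hQ.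
pose p' (t : nat) : V := if insub t is Some i then p i else 0.
have p'E (i : 'I_k.+1) : p' i = p i by rewrite /p' valK.
have hp' (t : nat) : (t <= k)%N -> mono e S B (k - t) (p' t).
  by move=> tk; have := hp (Ordinal (tk : t < k.+1)%N); rewrite -p'E.
have s0 : \sum_(t < k.+1) Xp e t (k - t) * p' t = 0.
  by rewrite -[RHS]Q0; apply: eq_bigr => t _; rewrite p'E Qp.
have := branch_direct e_sqr e_anti hla hm2 S0 SD Se hp' s0 (j := j).
by rewrite -ltnS ltn_ord p'E Qp => -> //; rewrite mulr0.
Qed.

Context (irr : forall T : A -> Prop, T 0 -> (forall (c : R[i]) a b, T a -> T b -> T (c *: a + b)) ->
  (forall a, T a -> S a) ->
  (forall p q a, B p -> B q -> p != q -> T a -> T (e p * e q * a)) ->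
  (exists2 a, T a & a <> 0) -> forall a, S a -> T a).
Context (S_neq0 : exists2 s, S s & s <> 0).

Lemma ex_null_power k : exists s : A,
  [/\ S s, s <> 0, null_vec e i0 i1 im * s = 0 & mono e S B k (iter k (zl X i0 i1 im) s%:MP)].
Proof.
have [s [Ss s0 Fs]] := ex_null_spinor e_sqr e_anti n01 n20 n21 SD SC Se S_neq0.
by exists s; split=> //; exact: iter_zl_mono.
Qed.

Lemma branch_neq0 k j : exists2 P, branch k j P & P <> 0.
Proof.
have [s [Ss s0 Fs ms]] := ex_null_power (k - j).
exists (Xp e j (k - j) * iter (k - j) (zl X i0 i1 im) s%:MP); first by exists (iter (k - j) (zl X i0 i1 im) s%:MP).
move=> /(Xp_inj e_sqr e_anti hla hm2 S0 SD Se ms); exact: iter_zl_neq0.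
Qed.

(** The multiplier is injective and invariant, and the weight of a vector killed
    by the raising operators determines its degree. *)
Lemma branch_inequivalent k (i j : nat) (f : V -> V) : (i <= k)%N -> (j <= k)%N ->
  (forall (c : R[i]) P Q, branch k i P -> branch k i Q -> f (c%:A *: P + Q) = c%:A *: f P + f Q) ->
  (forall P Q, branch k i P -> branch k i Q -> f P = f Q -> P = Q) ->
  (forall P, branch k i P -> branch k j (f P)) ->
  (forall p q P, B p -> B q -> (p < q)%N -> branch k i P -> f (sg p q P) = sg p q (f P)) -> i = j.
Proof.
move=> ik jk flin finj fim frot.
have [[W0 Wlin] Wrot] := branch_stable k i.
have f0 : f 0 = 0.
  have := flin (-1) 0 0 W0 W0; rewrite scaler0 add0r => ->.
  by rewrite scaleNr !scale1r scaleN1r addNr.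
have fZ (c : R[i]) P : branch k i P -> f (c%:A *: P) = c%:A *: f P.
  by move=> WP; rewrite -[c%:A *: P]addr0 flin // f0 addr0.
have frot' p q P : B p -> B q -> p != q -> branch k i P -> f (sg p q P) = sg p q (f P).
  move=> Bp Bq pq WP; have : (p != q :> nat) by rewrite (inj_eq val_inj).
  rewrite neq_ltn => /orP[pq'|qp]; first exact: frot.
  have sw Q : sg p q Q = (-1)%:A *: sg q p Q.
    by rewrite scaleNr scale1r scaleN1r; apply: (spin_rot_swap X D e_anti); rewrite eq_sym.
  by rewrite !sw fZ ?frot //; apply: Wrot => //; rewrite eq_sym.
have [s [Ss s0 Fs ms]] := ex_null_power (k - i).
pose P := Xp e i (k - i) * iter (k - i) (zl X i0 i1 im) s%:MP.
have WP : branch k i P by exists (iter (k - i) (zl X i0 i1 im) s%:MP).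
have P0 : P <> 0.
  move=> /(Xp_inj e_sqr e_anti hla hm2 S0 SD Se ms); exact: iter_zl_neq0.
have [Q mQ fPQ] := fim P WP.
have [mst1 mst2] := mono_stable e_sqr e_anti B S0 SD SC Se (k - j).
have Qker q : B q -> q != i0 -> q != i1 -> up q Q = 0.
  move=> Bq q0 q1.
  apply: (Xp_inj e_sqr e_anti hla hm2 S0 SD Se (j := j) (k := k - j)).
    exact: (raise_stable B0 B1 Bq q0 q1 (conj mst1 mst2) mQ).
  have XE p P1 : B p -> p != q -> Xp e j (k - j) * sg p q P1 = sg p q (Xp e j (k - j) * P1).
    by move=> Bp pq; rewrite (spin_rot_Xp e_sqr e_anti hla).
  have XE' p P1 : B p -> p != q -> Xp e i (k - i) * sg p q P1 = sg p q (Xp e i (k - i) * P1).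
    by move=> Bp pq; rewrite (spin_rot_Xp e_sqr e_anti hla).
  rewrite /raise mulrDr mul_central !XE 1?eq_sym // -fPQ.
  rewrite -!frot' 1?eq_sym //.
  rewrite addrC -flin; [|by apply: Wrot; rewrite // eq_sym..].
  rewrite -!XE' 1?eq_sym // -mul_central -mulrDr addrC.
  have := iter_zl_raise (e := e) e_anti n01 B0 B1 (k - i) Fs Bq q0 q1.
  by rewrite /raise => ->; rewrite mulr0.
have [s' [Ss' Fs' QE]] := raise_kernel e_sqr e_anti n01 n20 n21 B0 B1 B2 S0 SD SC mQ Qker.
have fP0 : f P <> 0 by move=> h; apply: P0; apply: finj; rewrite // h f0.
have wt : (- ('i *+ (k - i).*2.+1) : R[i])%:A *: f P = (- ('i *+ (k - j).*2.+1))%:A *: f P.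
  rewrite -fZ // {1}/P -mul_central -(iter_zl_weight e_sqr e_anti n01 B0 B1 (k - i) Fs).
  rewrite -(spin_rot_Xp e_sqr e_anti hla) // frot' // fPQ (spin_rot_Xp e_sqr e_anti hla) //.
  by rewrite QE (iter_zl_weight e_sqr e_anti n01 B0 B1 (k - j) Fs') mul_central.
have cancel (c c' : R[i]) : c%:A *: f P = c'%:A *: f P -> c = c'.
  move=> h; apply/eqP; rewrite -subr_eq0; apply/eqP.
  have [//|nz] := eqVneq (c - c') 0; case: fP0.
  have : ((c - c')^-1)%:A *: ((c - c')%:A *: f P) = 0 by rewrite !scalerBl h subrr scaler0.
  by rewrite scalerA mulr_algl scalerA mulVf // !scale1r.
have /eqP := cancel _ _ wt; rewrite eqr_opp -[_ *+ _]mulr_natr -[X in _ == X]mulr_natr.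
rewrite (inj_eq (mulfI (neq0Ci _))) eqr_nat eqSS (inj_eq double_inj) => /eqP h.
by rewrite -(subKn ik) -(subKn jk) h.
Qed.

Context (hA : A -> A -> R[i]).
Context (hAD : forall x y w, hA x (y + w) = hA x y + hA x w).
Context (hAZ : forall c x y, hA x (c *: y) = c * hA x y).
Context (hAC : forall x y, hA x y = (hA y x)^*).
Context (hA_ge0 : forall x, 0 <= hA x x) (hA_eq0 : forall x, hA x x = 0 -> x = 0).
Context (hAe : forall p q x y, p != q -> hA (e p * e q * x) y = - hA x (e p * e q * y)).
Context (J : finType) (crd : J -> A -> R[i]).
Context (crdD : forall t x y, crd t (x + y) = crd t x + crd t y).
Context (crdZ : forall t c x, crd t (c *: x) = c * crd t x).
Context (crd_inj : forall x, (forall t, crd t x = 0) -> x = 0).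

(** A submodule of a branch is the image of a submodule of the monogenic
    polynomials under the multiplier. *)
Lemma branch_irreducible k (j : nat) U : rot_stable e B U -> (forall P, U P -> branch k j P) ->
  (forall P, U P -> P = 0) \/ (forall P, branch k j P -> U P).
Proof.
move=> hU Ub; have [[P UP P0]|none] := boolp.pselect (exists2 P, U P & P <> 0); last first.
  by left=> P UP; have [//|/eqP nz] := eqVneq P 0; case: none; exists P.
right; have hst := mono_stable e_sqr e_anti B S0 SD SC Se (k - j).
pose U' Q := mono e S B (k - j) Q /\ U (Xp e j (k - j) * Q).
have hU' : rot_stable e B U'.
  split; first split=> [|c Q Q' [mQ UQ] [mQ' UQ']].
  - by split; [exact: hst.1.1 | rewrite mulr0; exact: hU.1.1].
  - by split; [exact: hst.1.2 | rewrite mulrDr mul_central; exact: hU.1.2].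
  move=> p q Q Bp Bq pq [mQ UQ]; split; first exact: hst.2.
  by rewrite -(spin_rot_Xp e_sqr e_anti hla) //; exact: hU.2.
have [Q0 mQ0 PE] := Ub P UP.
move=> _ [Q mQ ->].
have [] // := mono_irreducible e_sqr e_anti n01 n20 n21 B0 B1 B2 S0 SD SC Se irr hAD hAZ hAC
  hA_ge0 hA_eq0 hAe crdD crdZ crd_inj hU' (fun Q1 h => h.1) _ mQ.
exists Q0; first by split=> //; rewrite -PE.
by move=> Q00; apply: P0; rewrite PE Q00 mulr0.
Qed.

End Branches.

(** * The branching law for the Clifford algebra *)

Section HermitianForm.
Context (K : numClosedFieldType) (m : nat).
Local Notation Cl := (clifford K m).
Implicit Types (a b : Cl) (i p q : 'I_m).

Definition cl_herm a b : K := \sum_C (a C)^* * b C.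

Lemma cl_hermD a b c : cl_herm a (b + c) = cl_herm a b + cl_herm a c.
Proof. by rewrite -big_split; apply: eq_bigr => C _; rewrite cl_addE mulrDr. Qed.

Lemma cl_hermZ (k : K) a b : cl_herm a (k *: b) = k * cl_herm a b.
Proof. by rewrite mulr_sumr; apply: eq_bigr => C _; rewrite cl_scaleE mulrCA. Qed.

Lemma cl_hermC a b : cl_herm a b = (cl_herm b a)^*.
Proof. by rewrite rmorph_sum; apply: eq_bigr => C _; rewrite rmorphM /= conjCK mulrC. Qed.

Lemma cl_herm_ge0 a : 0 <= cl_herm a a.
Proof. by apply: sumr_ge0 => C _; rewrite mulrC mul_conjC_ge0. Qed.

Lemma cl_herm_eq0 a : cl_herm a a = 0 -> a = 0.
Proof.
move=> /eqP; rewrite psumr_eq0 => [|C _]; last by rewrite mulrC mul_conjC_ge0.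
move=> /allP h; apply/ffunP => C; have := h C (mem_index_enum C).
by rewrite /= mulrC mul_conjC_eq0 => /eqP ->; rewrite cl_zeroE.
Qed.

Lemma cl_gen_coef i a C : (cl_gen i * a) C = cl_sign [set i] (symdiff [set i] C) * a (symdiff [set i] C).
Proof.
rewrite ffunE (bigD1 [set i]) //= big1 ?addr0 ?cl_basisE ?eqxx ?mul1r // => B /negPf Bi.
by rewrite cl_basisE Bi mul0r mulr0.
Qed.

(** The generators are isometries with square [-1], hence skew. *)
Lemma cl_herm_gen i a b : cl_herm (cl_gen i * a) b = - cl_herm a (cl_gen i * b).
Proof.
have iso x y : cl_herm (cl_gen i * x) (cl_gen i * y) = cl_herm x y.
  rewrite /cl_herm [RHS](reindex_inj (inv_inj (symdiffK [set i]))) /=.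
  apply: eq_bigr => C _; rewrite !cl_gen_coef rmorphM /= mulrACA.
  have -> : (cl_sign [set i] (symdiff [set i] C))^* = cl_sign [set i] (symdiff [set i] C) :> K.
    by rewrite /cl_sign rmorph_prod; apply: eq_bigr => j _; rewrite rmorph_prod; apply: eq_bigr => l _; rewrite rmorphN rmorph1.
  by rewrite cl_sign_sqr mul1r.
have := iso a (cl_gen i * b); rewrite mulrA cl_gen_sqr mulN1r -(scaleN1r b) cl_hermZ mulN1r => <-.
by rewrite opprK.
Qed.

Lemma cl_herm_pair p q a b : p != q ->
  cl_herm (cl_gen p * cl_gen q * a) b = - cl_herm a (cl_gen p * cl_gen q * b).
Proof.
move=> pq; rewrite -mulrA !cl_herm_gen opprK mulrA (cl_gen_anticomm (i := q)) 1?eq_sym //.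
by rewrite mulNr -(scaleN1r (_ * b)) cl_hermZ mulN1r.
Qed.

End HermitianForm.

Section Main.
Context (R : realType) (n : nat) (hn : (2 <= n)%N).
Local Notation m := (2 * n)%N.
Local Notation Cl := ('Cl[R]_m).
Context (S : {vspace Cl}) (hS : basic_spinor S).
Local Notation V := {mpoly Cl[m]}.
Implicit Types (l k : nat) (P : V).
Local Notation e := (@cl_gen R[i] m).
Local Notation inS := (fun a : Cl => a \in S).
Local Notation below l := (fun i : 'I_m => (i < l)%N).

Lemma monogenicE l k P : monogenic l k S P <-> mono e inS (below l) k P.
Proof.
have dE : dirac l P = dir e (@Dl Cl m) (below l) P.
  by apply: eq_bigr => i _; exact: mul_mpolyC.
split=> [[hP SP zP dP]|[hP dP]].
  split; last by rewrite -dE.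
  move=> u; split; first exact: SP.
  move=> /eqP; rewrite -mcoeff_msupp => uP.
  split; first exact: (dhomog_mf hP uP).
  by move=> i il; apply: zP uP _; rewrite leqNgt.
split; rewrite ?dE //.
- by apply/dhomogP => u; rewrite mcoeff_msupp => /eqP/(hP u).2 [].
- by move=> u; exact: (hP u).1.
- by move=> u i; rewrite mcoeff_msupp => /eqP/(hP u).2 [_ h] il; apply: h; rewrite -leqNgt.
Qed.

Lemma XmonogenicE k (j : 'I_k.+1) P : Xmonogenic S j P <-> branch e inS k j P.
Proof. by split=> -[p /monogenicE hp ->]; exists p. Qed.

Lemma so_moduleE l (U : V -> Prop) : so_module l U <-> rot_stable e (below l) U.
Proof.
apply: (iff_trans (so_moduleP l U)).
apply: iff_trans (iff_sym (rot_stableP (@cl_gen_anticomm R[i] m) (below l) U)).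
split=> -[sU hU]; split=> // p q P.
  by move=> _ ql pq; apply: hU; rewrite pq ql.
by move=> /andP[pq ql]; apply: hU => //; exact: ltn_trans pq ql.
Qed.

Let m_gt3 : (3 < m)%N. Proof. by rewrite (leq_mul2l 2 2 n) hn. Qed.
Let n_gt0 : (0 < n)%N. Proof. exact: ltn_trans hn. Qed.
Let la : 'I_m := Ordinal (eq_leq (ltn_predK m_gt3)).
Let hla : la = m.-1 :> nat. Proof. by []. Qed.

Let S0 : inS 0. Proof. exact: mem0v. Qed.
Let SD a b : inS a -> inS b -> inS (a + b). Proof. exact: memvD. Qed.
Let SC (c : R[i]) a : inS a -> inS (c *: a). Proof. exact: memvZ. Qed.
Let Se i j a : inS a -> inS (e i * e j * a). Proof. exact: spinor_pair. Qed.
Let S_neq0 : exists2 s, inS s & s <> 0.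
Proof. by have [s Ss /eqP] := spinor_neq0 n_gt0 hS; exists s. Qed.
Let irr (T : Cl -> Prop) : T 0 -> (forall (c : R[i]) a b, T a -> T b -> T (c *: a + b)) ->
  (forall a, T a -> inS a) ->
  (forall (p q : 'I_m) a, (p < m.-1)%N -> (q < m.-1)%N -> p != q -> T a -> T (e p * e q * a)) ->
  (exists2 a, T a & a <> 0) -> forall a, inS a -> T a.
Proof.
move=> T0 Tlin TS Te [a Ta /eqP a0]; apply: (spinor_irr n_gt0 hS) => //.
by exists a.
Qed.

Lemma monogenic_module k : so_module m (monogenic m k S).
Proof.
apply/so_moduleE; apply: (rot_stable_ext (U := mono e inS (below m) k)).
  by move=> P; apply: iff_sym; exact: monogenicE.
exact: (mono_stable (@cl_gen_sqr R[i] m) (@cl_gen_anticomm R[i] m) (below m) S0 SD SC Se k).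
Qed.

Lemma Xmonogenic_module k (j : 'I_k.+1) : so_module m.-1 (Xmonogenic S j).
Proof.
apply/so_moduleE; apply: (rot_stable_ext (U := branch e inS k j)).
  by move=> P; apply: iff_sym; exact: XmonogenicE.
exact: (branch_stable (@cl_gen_sqr R[i] m) (@cl_gen_anticomm R[i] m) hla S0 SD SC Se k j).
Qed.

Lemma monogenic_direct_sum k : direct_sum (monogenic m k S) (@Xmonogenic R m k S).
Proof.
have [ex un] := branch_direct_sum (@cl_gen_sqr R[i] m) (@cl_gen_anticomm R[i] m) hla m_gt3 S0 SD SC Se k.
split=> [P|Q hQ Q0 j]; last by apply: un => // i; exact/XmonogenicE.
apply: (iff_trans (monogenicE m k P)); apply: (iff_trans (ex P)).
by split=> -[Q hQ ->]; exists Q => // j; exact/XmonogenicE.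
Qed.

Lemma Xmonogenic_irreducible k (j : 'I_k.+1) : so_irreducible m.-1 (Xmonogenic S j).
Proof.
split; first exact: Xmonogenic_module.
  have [P /XmonogenicE hP P0] := branch_neq0 (@cl_gen_sqr R[i] m) (@cl_gen_anticomm R[i] m) hla m_gt3 S0 SD SC Se S_neq0 k j.
  by exists P.
move=> U /so_moduleE hU UX.
have cD (C : {set 'I_m}) (x y : Cl) : (x + y) C = x C + y C by exact: cl_addE.
have cZ (C : {set 'I_m}) (c : R[i]) (x : Cl) : (c *: x) C = c * x C by exact: cl_scaleE.
have cI (x : Cl) : (forall C, x C = 0) -> x = 0.
  by move=> h; apply/ffunP => C; rewrite h cl_zeroE.
have [h|h] := branch_irreducible (@cl_gen_sqr R[i] m) (@cl_gen_anticomm R[i] m) hla m_gt3 S0 SD SC Se irr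
  (@cl_hermD R[i] m) (@cl_hermZ R[i] m) (@cl_hermC R[i] m) (@cl_herm_ge0 R[i] m) (@cl_herm_eq0 R[i] m)
  (@cl_herm_pair R[i] m) cD cZ cI hU (fun P UP => (XmonogenicE j P).1 (UX P UP)).
  by left.
by right=> P /XmonogenicE; exact: h.
Qed.

Lemma Xmonogenic_inequivalent k (i j : 'I_k.+1) : i <> j ->
  ~ so_equivalent m.-1 (Xmonogenic S i) (Xmonogenic S j).
Proof.
move=> ij [f [flin finj fim frot]]; apply: ij; apply: val_inj.
apply: (branch_inequivalent (@cl_gen_sqr R[i] m) (@cl_gen_anticomm R[i] m) hla m_gt3 S0 SD SC Se S_neq0 (f := f) (k := k)).
- by rewrite -ltnS; exact: ltn_ord.
- by rewrite -ltnS; exact: ltn_ord.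
- by move=> c P Q /XmonogenicE hP /XmonogenicE hQ; exact: flin.
- by move=> P Q /XmonogenicE hP /XmonogenicE hQ; exact: finj.
- by move=> P /XmonogenicE hP; apply/XmonogenicE/fim; exists P.
- move=> p q P pm qm pq /XmonogenicE hP; have pql : (p < q < m.-1)%N by rewrite pq.
  have [hw hP'] := so_act_pair P pql; have [_ hfP] := so_act_pair (f P) pql.
  by rewrite -[spin_rot _ _ _ _ _ P]hP' frot // hfP.
Qed.

End Main.

Theorem theorem1 (R : realType) (n : nat) (hn : (2 <= n)%N)
    (S : {vspace 'Cl[R]_(2 * n)%N}) (hS : basic_spinor S) (k : nat) :
  [/\ so_module (2 * n)%N (monogenic (2 * n)%N k S),
      direct_sum (monogenic (2 * n)%N k S) (@Xmonogenic R (2 * n)%N k S),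
      forall j : 'I_k.+1, so_irreducible (2 * n - 1)%N (Xmonogenic S j)
    & forall i j : 'I_k.+1, i <> j ->
        ~ so_equivalent (2 * n - 1)%N (Xmonogenic S i) (Xmonogenic S j)].
Proof.
split; [exact: monogenic_module | exact: monogenic_direct_sum | |].
  by move=> j; rewrite subn1; exact: Xmonogenic_irreducible.
by move=> i j; rewrite subn1; exact: Xmonogenic_inequivalent.
Qed.
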